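(* Let $f \in \mathfrak{C}$. Let $\mathcal{U}$ be a neighborhood of the set of turning points $\mathfrak{T}$ of $f$. Then there are numbers $K_n$ with $K_n \to \infty$ as $n \to \infty$, so that $$|Df^n(p_n)| \geq K_n$$ for each periodic point $p_n$ with minimal period $n$ and $\mathcal{O}(p_n) \subset I \backslash \mathcal{U}$. If all periodic orbits in $I \backslash \mathcal{U}$ are hyperbolic, then there are $C > 0$, $\lambda > 1$, so that for each $n \in \mathbb{N}$ and $x \in \Gamma_n(\mathcal{U} \cup B_0)$, $$|Df^n(x)| \geq C \lambda^n.$$ Here $B_0$ denotes the union of the immediate basins of the periodic attractors.
   Context: $I$ is a compact interval. $\mathfrak{C}$ is the class of continuous maps $f:I\to I$ such that $f$ is $C^1$ except possibly at a finite set, there exists $C\ge 1$ with $1/C\le |Df|\le C$, and $\ln|Df|$ has bounded variation. A turning point of $f$ is a local extremum in the interior of $I$; $\mathfrak{T}$ is the set of turning points. $\mathcal{O}(x)$ is the forward orbit of $x$. For a subset $\mathcal{W}\subset I$, $\Gamma_n(\mathcal{W})=\{x\in I : x,f(x),\ldots,f^n(x)\in I\backslash\mathcal{W}\}$. Convention: since $Df^n$ may fail to exist at a point $x$, $|Df^n(x)|\ge C$ is written for $\liminf_{y\to x}|Df^n(y)|\ge C$. A periodic point $p$ with minimal period $n$ is hyperbolic if $\lim_{y\uparrow p}|Df^n(y)|$ and $\lim_{y\downarrow p}|Df^n(y)|$ are either both smaller than one or both larger than one. A periodic attractor is a periodic orbit $\mathcal{O}$ whose basin $\{x : f^k(x)\to\mathcal{O}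 \text{ as } k\to\infty\}$ contains an open set; its immediate basin is the union of the components of the basin that contain a point of $\mathcal{O}$.
   Formalization: In the second part the neighborhood U of the turning points is required to be open in I; for a non-open U (e.g. one containing a neutral, weakly repelling fixed point as an isolated point) the exponential bound fails. The first part holds for arbitrary neighborhoods. *)

(* Defs.v *)
Set Warnings "-notation-overridden,-notation-incompatible-prefix".
From mathcomp Require Export all_boot all_order all_algebra.
From mathcomp Require Export all_classical all_reals all_analysis.

Set Implicit Arguments.
Unset Strict Implicit.
Unset Printing Implicit Defensive.

Export Order.TTheory GRing.Theory Num.Theory.
Export numFieldNormedType.Exports.

Local Open Scope classical_set_scope.
Local Open Scope ring_scope.

(* A map of the compact interval I = [a, b] is represented by a total function
   f : R -> R that maps I to I; every notion below depends only on the
   restriction of f to I.  In particular derivatives are only taken at points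
   of the interior `]a, b[ of I, where they are determined by f on I. *)
Section IntervalMaps.
Context {R : realType}.
Implicit Types (a b x p : R) (f : R -> R) (n : nat) (U W O : set R).

(* derive1 f is total, with an unspecified real value where f is not
   differentiable and at the endpoints of I; this concerns finitely many points
   only, so it does not affect whether ln|Df| has bounded variation.  The
   endpoints may be left out of the C^1 condition: f is one-sidedly C^1 there
   because bounded variation of ln|Df| gives Df one-sided limits. *)
Definition class_C a b f : Prop :=
  [/\ {within `[a, b], continuous f},
      (forall x, a <= x <= b -> a <= f x <= b),
      exists2 E : set R, finite_set E &
        (forall x, a < x < b -> ~ E x ->
           derivable f x 1 /\ {for x, continuous (derive1 f)}) /\
        (exists2 C : R, 1 <= C & forall x, a < x < b -> ~ E x ->
           C^-1 <= `| derive1 f x | <= C) &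
      bounded_variation a b (fun x => ln `| derive1 f x |)].

Definition turning_points a b f : set R :=
  [set x | a < x < b /\
           ((\forall y \near x, f y <= f x) \/ (\forall y \near x, f x <= f y))].

Definition forward_orbit f x : set R := [set iter k f x | k in [set: nat]].

Definition periodic_point a b f n p : Prop :=
  [/\ (0 < n)%N, a <= p <= b, iter n f p = p &
      forall k, (0 < k < n)%N -> iter k f p <> p].

Definition Gamma a b f n W : set R :=
  [set x | forall k, (k <= n)%N -> ([set` `[a, b]] `\` W) (iter k f x)].

(* liminf_{y -> x} |Df^n(y)|, over the y <> x interior to I at which f^n is
   differentiable; "|Df^n(x)| >= C" means (C%:E <= liminf_absD a b f n x)%E. *)
Definition liminf_absD a b f n x : \bar R :=
  limf_einf (fun y : R => (`| derive1 (iter n f) y |)%:E)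
    (within [set y | a < y < b /\ derivable (iter n f) y 1] (x^')).

(* At an endpoint of I only the limit from inside I is considered. *)
Definition hyperbolic a b f n p : Prop :=
  let absD := fun y : R => `| derive1 (iter n f) y | in
  let one_sided_limits (Q : R -> Prop) :=
    (a < p -> exists2 l, absD y @[y --> p^'-] --> l & Q l) /\
    (p < b -> exists2 l, absD y @[y --> p^'+] --> l & Q l) in
  one_sided_limits (fun l => l < 1) \/ one_sided_limits (fun l => 1 < l).

Definition basin a b f O : set R :=
  [set x | a <= x <= b /\ (iter k f x @[k --> \oo]) `=>` set_nbhs O].

(* A nonempty relatively open subset of I contains a nonempty open subset of R,
   so interiors may be taken in R. *)
Definition periodic_attractor a b f O : Prop :=
  (exists n p, periodic_point a b f n p /\ O = forward_orbit f p) /\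
  (basin a b f O)^° !=set0.

Definition immediate_basin a b f O : set R :=
  \bigcup_(q in O) connected_component (basin a b f O) q.

Definition immediate_basins a b f : set R :=
  \bigcup_(O in periodic_attractor a b f) immediate_basin a b f O.

End IntervalMaps.

(* Main.v *)
(** The map is extended to the line by isometries.  Away from the turning points its
    distortion is controlled by the variation of ln|Df|, so a family of intervals of bounded total
    length and total variation is mapped with bounded distortion.  Every point of a finite orbit
    has a gap on either side, reaching to the next point of the orbit or to a fixed length.  The
    gaps on one side, resp. on the sides transported along the orbit, are disjoint, and each is
    mapped over the next gap, up to a loss that is summable; hence the product of the slopes of the
    gaps bounds the derivative from below in terms of the first and the last gap.  For a periodic
    orbit one starts at a point with a long gap and returns to it: the pulled back long gap is short
    when the period is large, since otherwise a fixed interval would have summable images that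
    return with a fixed length, so the derivative is large.

    For the second part an orbit is cut, from its end backwards, into tiles x, .., f^k x, where x is
    the point of the orbit nearest to the end point.  The same gap argument gives a uniform lower
    bound for the derivative along a tile and a large one along a long tile; here the pulled back
    gaps shrink because a limit interval would be wandering, which Denjoy's argument excludes, or
    asymptotic to a periodic orbit in the closure, which is repelling by hyperbolicity.  A short tile
    whose end points are close is near a repelling periodic orbit.  All but boundedly many tiles are
    therefore expanding. *)
Require Import Defs.
From mathcomp Require Import all_boot all_order all_algebra.
From mathcomp Require Import all_classical all_reals all_analysis.
From mathcomp Require Import ring lra zify.

Set Implicit Arguments.
Unset Strict Implicit.
Unset Printing Implicit Defensive.

Import Order.TTheory GRing.Theory Num.Theory.
Import numFieldNormedType.Exports.

Local Open Scope classical_set_scope.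
Local Open Scope ring_scope.

(** * Sums and sequences *)

(** Lengths of images are compared in product form, so that neither differentiability nor nonzero
    lengths are assumed on the way; derivatives enter only when the extended map is built and when
    local expansion is turned into a lower limit of |Df^n|. Two obstacles shape the argument. The
    end point F^n x of a tile is not among the points that bound its gaps; it is replaced by x, the
    point nearest to it, at the price of a factor 2. This factor, and the factor C lost where a gap
    is cut at the fixed length r, concern boundedly many gaps only, so both are charged, together
    with the variation of ln|DF|, to one bounded monotone function. On the line no circular order is
    available for Denjoy's argument: an interval H_n next to the image X_n of a wandering interval
    may pull back over X_n itself. As long as this does not happen, the pullbacks of equal
    orientation are disjoint, which gives the distortion constant exp(3V): one V for the images X_t
    and one for the pullbacks of each orientation. Two scales for H_n are compared to exclude the
    bad case. *)

Ltac between := apply/andP; split; lra.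

Section Tools.
Context {R : realType}.
Implicit Types (u v : nat -> R) (e p B : R).

Lemma dist_lt_half (x y z e : R) : `|x - y| < e / 2 -> `|y - z| < e / 2 -> `|x - z| < e.
Proof.
move=> h1 h2; rewrite -(subrKA y); apply: le_lt_trans (ler_normD _ _) _.
by rewrite [e]splitr ltrD.
Qed.

(** The intervals other than the first listed one lie wholly to its left or to its right; strong
    induction on the length of the list treats both families and replaces sorting. *)
Lemma disjoint_sum (I : eqType) (s : seq I) (lo hi : I -> R) (Phi : R -> R) (A B : R) :
  {homo Phi : x y / x <= y} -> A <= B -> uniq s ->
  (forall i, i \in s -> [/\ A <= lo i, lo i <= hi i & hi i <= B]) ->
  (forall i j, i \in s -> j \in s -> i != j -> hi i <= lo j \/ hi j <= lo i) ->
  \sum_(i <- s) (Phi (hi i) - Phi (lo i)) <= Phi B - Phi A.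
Proof.
move=> Pmono.
have [n] := ubnP (size s); elim: n s A B => // n IH [|i s] A B.
  by move=> _ AB _ _ _; rewrite big_nil subr_ge0 Pmono.
rewrite /= ltnS => sn AB /andP[iNs us] bnd dis.
have [Ai ii iB] := bnd i (mem_head _ _).
rewrite big_cons (bigID (fun j => hi j <= lo i)) /= -!(big_filter s).
have left_ : \sum_(j <- [seq j <- s | hi j <= lo i]) (Phi (hi j) - Phi (lo j))
    <= Phi (lo i) - Phi A.
  apply: IH => //.
  - by rewrite size_filter (leq_ltn_trans (count_size _ _)).
  - exact: filter_uniq.
  - move=> j; rewrite mem_filter => /andP[jl js].
    by have [] := bnd j _; rewrite ?inE ?js ?orbT.
  - move=> j k; rewrite !mem_filter => /andP[_ js] /andP[_ ks].
    by apply: dis; rewrite inE ?js ?ks orbT.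
have right_ : \sum_(j <- [seq j <- s | ~~ (hi j <= lo i)]) (Phi (hi j) - Phi (lo j))
    <= Phi B - Phi (hi i).
  apply: IH => //.
  - by rewrite size_filter (leq_ltn_trans (count_size _ _)).
  - exact: filter_uniq.
  - move=> j; rewrite mem_filter => /andP[jl js].
    have [] := bnd j _; rewrite ?inE ?js ?orbT // => ? ? ?; split => //.
    have ij : i != j by apply: contraNneq iNs => ->.
    have js' : j \in i :: s by rewrite inE js orbT.
    by have [//|] := dis i j (mem_head _ _) js' ij; rewrite (negbTE jl).
  - move=> j k; rewrite !mem_filter => /andP[_ js] /andP[_ ks].
    by apply: dis; rewrite inE ?js ?ks orbT.
lra.
Qed.

Lemma disjoint_sum_ord M (P : pred nat) (lo hi : nat -> R) (Phi : R -> R) (V : R) :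
  {homo Phi : x y / x <= y} -> (forall x, 0 <= Phi x <= V) ->
  (forall i, (i < M)%N -> lo i <= hi i) ->
  (forall i j, (i < M)%N -> (j < M)%N -> P i -> P j -> i != j ->
    hi i <= lo j \/ hi j <= lo i) ->
  \sum_(i < M | P i) (Phi (hi i) - Phi (lo i)) <= V.
Proof.
move=> Pmono PV lh dis.
rewrite -(big_mkord P (fun i => Phi (hi i) - Phi (lo i))) /index_iota subn0 -big_filter.
have [A HA] : exists A, forall i, (i < M)%N -> A <= lo i.
  elim: (M) => [|m [A HA]]; first by exists 0.
  exists (Num.min A (lo m)) => i; rewrite ltnS leq_eqVlt => /predU1P[->|im].
    by rewrite ge_min lexx orbT.
  by rewrite ge_min HA.
have [B HB] : exists B, forall i, (i < M)%N -> hi i <= B.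
  elim: (M) => [|m [B HB]]; first by exists 0.
  exists (Num.max B (hi m)) => i; rewrite ltnS leq_eqVlt => /predU1P[->|im].
    by rewrite le_max lexx orbT.
  by rewrite le_max HB.
apply: (@le_trans _ _ (Phi (Num.max A B) - Phi A)); last first.
  have /andP[_] := PV (Num.max A B); have /andP[+ _] := PV A; lra.
apply: disjoint_sum => //.
- by rewrite le_max lexx.
- by rewrite filter_uniq // iota_uniq.
- move=> i; rewrite mem_filter mem_iota add0n => /andP[_ /andP[_ iM]].
  by rewrite HA // lh // le_max HB // orbT.
- move=> i j; rewrite !mem_filter !mem_iota !add0n.
  by move=> /andP[Pi /andP[_ iM]] /andP[Pj /andP[_ jM]]; exact: dis.
Qed.

Definition tends u p := forall e, 0 < e -> exists N, forall m, (N <= m)%N -> `|u m - p| < e.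

Lemma tends_cvg u p : (u @ \oo --> p) -> tends u p.
Proof.
move=> /cvgrPdist_lt up e e0; have [N _ H] := up e e0.
by exists N => m Nm; rewrite distrC; exact: H.
Qed.

Lemma nondecreasing_tends u B : (forall m, u m <= u m.+1) -> (forall m, u m <= B) ->
  exists p, tends u p.
Proof.
move=> um uB; exists (sup (range u)); apply: tends_cvg; apply: nondecreasing_cvgn.
  by apply/nondecreasing_seqP.
by exists B => _ [m _ <-].
Qed.

Lemma nonincreasing_tends u B : (forall m, u m.+1 <= u m) -> (forall m, B <= u m) ->
  exists p, tends u p.
Proof.
move=> um uB; have [||p pP] := @nondecreasing_tends (fun m => - u m) (- B).
- by move=> m; rewrite lerN2.
- by move=> m; rewrite lerN2.
exists (- p) => e /pP[N H]; exists N => m /H.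
by rewrite -opprD normrN opprK.
Qed.

Lemma summable_small (w : nat -> R) B : (forall m, 0 <= w m) ->
  (forall n, \sum_(m < n) w m <= B) ->
  forall e, 0 < e -> exists N, forall m, (N <= m)%N -> w m < e.
Proof.
move=> w0 wB e e0.
have [|//|p pP] := @nondecreasing_tends (fun n => \sum_(m < n) w m) B.
  by move=> m; rewrite big_ord_recr /= lerDl.
have [|N H] := pP (e / 2); first lra.
exists N => m Nm; have := H _ Nm; have := H _ (leqW Nm).
rewrite big_ord_recr /=; rewrite !ltr_distl => /andP[_ h1] /andP[h2 _]; lra.
Qed.

(** With [s] the partial sums of the absolute increments, [u + s] and [s] are nondecreasing and
    bounded, and [u] is their difference. *)
Lemma summable_tends u B :
  (forall n, \sum_(m < n) `|u m.+1 - u m| <= B) -> exists p, tends u p.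
Proof.
move=> uB; pose s n := \sum_(m < n) `|u m.+1 - u m|.
have [||p pP] := @nondecreasing_tends (fun n => u n + s n) (u 0%N + B + B).
- move=> m; rewrite /s big_ord_recr /=.
  have := ler_norm (- (u m.+1 - u m)); rewrite normrN; lra.
- move=> m; have : u m <= u 0%N + s m.
    rewrite /s; elim: m => [|m IH]; first by rewrite big_ord0 addr0.
    rewrite big_ord_recr /=; have := ler_norm (u m.+1 - u m); lra.
  have := uB m; rewrite -/(s m); lra.
have [|//|q qP] := @nondecreasing_tends s B.
  by move=> m; rewrite /s big_ord_recr /= lerDl.
exists (p - q) => e e0.
have [|N HN] := pP (e / 2); first lra.
have [|M HM] := qP (e / 2); first lra.
exists (maxn N M) => m; rewrite geq_max => /andP[/HN + /HM].
by rewrite !ltr_distl => /andP[? ?] /andP[? ?]; between.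
Qed.

Lemma bounded_cluster u A B : (forall m, A <= u m <= B) ->
  exists2 p, A <= p <= B & forall e N, 0 < e -> exists2 m, (N <= m)%N & `|u m - p| < e.
Proof.
move=> uAB.
have := @segment_compact R A B; rewrite /compact => /(_ (u @ \oo) _).
case.
  exists 0%N => // m _ /=; rewrite in_itv /=; exact: uAB.
move=> p [pI cl]; exists p; first by move: pI; rewrite /= in_itv.
move=> e N e0.
have := cl [set x | exists2 m, (N <= m)%N & u m = x] (ball p e) _ (nbhsx_ballx _ _ e0).
case.
  by exists N => // m /= Nm; exists m.
move=> _ [[m Nm <-]] pm; exists m => //.
by move: pm; rewrite /ball /= distrC.
Qed.

(** The last minimizer is singled out because strict inequality after it is what excludes repeated
    points in the tiles of [exists_tile]. *)
Lemma argmin_last (D : nat -> R) n : (0 < n)%N ->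
  exists j, [/\ (j < n)%N, forall i, (i < n)%N -> D j <= D i &
    forall i, (j < i)%N -> (i < n)%N -> D j < D i].
Proof.
case: n => // n _; elim: n => [|n [j [jn Dj lj]]].
  by exists 0%N; split=> // [[]|[]].
have [le|lt] := lerP (D n.+1) (D j).
  exists n.+1; split=> // i; rewrite ltnS.
    by rewrite leq_eqVlt => /predU1P[->//|/Dj]; exact: le_trans.
  by move=> ni /(leq_trans ni); rewrite ltnn.
exists j; split=> [|i|i ji]; first by rewrite ltnW.
  by rewrite ltnS leq_eqVlt => /predU1P[->|/Dj//]; exact: ltW.
by rewrite ltnS leq_eqVlt => /predU1P[->//|]; exact: lj.
Qed.

Lemma argmax (D : nat -> R) n : (0 < n)%N ->
  exists2 j, (j < n)%N & forall i, (i < n)%N -> D i <= D j.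
Proof.
move=> n0; have [j [jn Dj _]] := argmin_last (fun i => - D i) n0.
by exists j => // i /Dj; rewrite lerN2.
Qed.

(** A general commutative law is taken because both the sum of the charges and the product of the
    slopes around a cycle have to be shifted. *)
Lemma periodic_shift_big (T : Type) (idx : T) (op : Monoid.com_law idx)
    (h : nat -> T) (n u : nat) : (forall t, h (t + n)%N = h t) ->
  \big[op/idx]_(t < n) h (u + t)%N = \big[op/idx]_(t < n) h t.
Proof.
move=> hn; elim: u => [|u IH]; first by under eq_bigr do rewrite add0n.
rewrite -IH; case: n hn {IH} => [|n] hn; first by rewrite !big_ord0.
rewrite big_ord_recr big_ord_recl /= Monoid.mulmC addn0.
congr (op _ _); first by rewrite addSnnS hn.
by apply: eq_bigr => i _; rewrite addSnnS.
Qed.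

End Tools.

(** * Maps with controlled distortion *)

Definition turn_free {R : realType} (T : set R) (u v : R) := forall t, T t -> ~ (u < t < v).

(* [Phi] plays the role of the variation of ln|DF|.  Beyond [a, b] the map is isometric, so that
   intervals around points of [a, b] need not be truncated. *)
Record denjoy_map {R : realType} (a b : R) (F : R -> R) (T : set R) (C V : R)
    (Phi : R -> R) : Prop := DenjoyMap {
  dm_ab : a < b;
  dm_C : 1 <= C;
  dm_cont : continuous F;
  dm_box : forall c x, 0 <= c -> a - c <= x <= b + c -> a - c <= F x <= b + c;
  dm_left : forall x y, x <= a -> y <= a -> `|F x - F y| = `|x - y|;
  dm_right : forall x y, b <= x -> b <= y -> `|F x - F y| = `|x - y|;
  dm_mono : forall u v, turn_free T u v ->
    (forall y z, u <= y -> y < z -> z <= v -> F y < F z) \/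
    (forall y z, u <= y -> y < z -> z <= v -> F z < F y);
  dm_lip : forall u v y z, turn_free T u v -> u <= y -> y <= z -> z <= v ->
    C^-1 * (z - y) <= `|F z - F y| <= C * (z - y);
  dm_dist : forall u v y z y' z', turn_free T u v ->
    u <= y -> y <= z -> z <= v -> u <= y' -> y' <= z' -> z' <= v ->
    `|F z - F y| * (z' - y') <= expR (Phi v - Phi u) * `|F z' - F y'| * (z - y);
  dm_nd : {homo Phi : x y / x <= y};
  dm_bnd : forall x, 0 <= Phi x <= V }.

(** * One-sided neighbourhoods: sides, lengths of images and pullbacks along an orbit *)

Section Local.
Context {R : realType} (a b : R) (F : R -> R) (T : set R) (C V : R) (Phi : R -> R).
Context (DM : denjoy_map a b F T C V Phi).
Implicit Types (x y z r h u v : R) (s : bool).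

Let C0 : 0 < C := lt_le_trans ltr01 (dm_C DM).

Lemma turn_free_sub u v u' v' : turn_free T u v -> u <= u' -> v' <= v -> turn_free T u' v'.
Proof. by move=> H uu vv t /H tH /andP[? ?]; apply: tH; between. Qed.

Lemma lipN u v y z : turn_free T u v -> u <= y <= v -> u <= z <= v ->
  C^-1 * `|z - y| <= `|F z - F y| <= C * `|z - y|.
Proof.
move=> fr /andP[? ?] /andP[? ?]; have [yz|zy] := lerP y z.
  exact: (dm_lip DM fr).
by rewrite distrC (dm_lip DM fr) // ltW.
Qed.

Lemma distN u v y z y' z' : turn_free T u v ->
  u <= y <= v -> u <= z <= v -> u <= y' <= v -> u <= z' <= v ->
  `|F z - F y| * `|z' - y'| <= expR (Phi v - Phi u) * `|F z' - F y'| * `|z - y|.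
Proof.
move=> fr; wlog yz : y z / y <= z.
  move=> H yv zv; case/orP: (le_total y z) => [yz|zy]; first exact: H.
  by rewrite (distrC (F z)) (distrC z y); exact: H.
wlog yz' : y' z' / y' <= z'.
  move=> H yv zv yv' zv'; case/orP: (le_total y' z') => [yz'|zy']; first exact: H.
  by rewrite (distrC (F z')) (distrC z' y'); exact: H.
move=> /andP[? ?] /andP[? ?] /andP[? ?] /andP[? ?].
rewrite (ger0_norm (_ : 0 <= z - y)) ?subr_ge0 //.
by rewrite (ger0_norm (_ : 0 <= z' - y')) ?subr_ge0 // (dm_dist DM fr).
Qed.

Lemma iter_cont t : continuous (iter t F).
Proof.
elim: t => [x|t IH x]; first exact: cvg_id.
by apply: (@continuous_comp _ _ _ (iter t F) F); [exact: IH|exact: (dm_cont DM)].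
Qed.

Lemma iter_near t x r : 0 < r -> exists2 d, 0 < d &
  forall y, `|y - x| < d -> `|iter t F y - iter t F x| < r.
Proof.
move=> r0; have /cvgrPdist_lt/(_ r r0) := @iter_cont t x.
move=> /nbhs_ballP[d /= d0 H]; exists d => // y yx.
by rewrite distrC; apply: H; rewrite /ball /= distrC.
Qed.

Lemma iter_box t c x : 0 <= c -> a - c <= x <= b + c -> a - c <= iter t F x <= b + c.
Proof. by move=> c0 xc; elim: t => //= t; exact: (dm_box DM). Qed.

Lemma iter_itv t x : a <= x <= b -> a <= iter t F x <= b.
Proof. by have := @iter_box t 0 x (lexx 0); rewrite subr0 addr0. Qed.

(** The one-step estimates [distN] are chained and the exponents add up. The product form keeps the
    estimate meaningful for intervals of length zero. *)
Lemma tube_dist (lo hi : nat -> R) M y z y' z' :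
  (forall t, (t < M)%N -> turn_free T (lo t) (hi t)) ->
  (forall t, (t < M)%N -> [/\ lo t <= iter t F y <= hi t, lo t <= iter t F z <= hi t,
     lo t <= iter t F y' <= hi t & lo t <= iter t F z' <= hi t]) ->
  `|iter M F z - iter M F y| * `|z' - y'| <=
  expR (\sum_(t < M) (Phi (hi t) - Phi (lo t))) *
    `|iter M F z' - iter M F y'| * `|z - y|.
Proof.
elim: M => [|M IH] fr H; first by rewrite big_ord0 expR0 mul1r /= mulrC.
have {}IH := IH (fun t tM => fr t (ltnW tM)) (fun t tM => H t (ltnW tM)).
have [yM zM yM' zM'] := H M (ltnSn M).
have S := distN (fr M (ltnSn M)) yM zM yM' zM'.
rewrite big_ord_recr /= expRD.
set e := expR _ in IH *; set e' := expR _ in S *.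
have AA' : `|iter M F z - iter M F y| = 0 -> `|F (iter M F z) - F (iter M F y)| = 0.
  by move/eqP; rewrite normr_eq0 subr_eq0 => /eqP ->; rewrite subrr normr0.
move: AA' IH S (normr_ge0 (z' - y')) (normr_ge0 (z - y)).
move: (normr_ge0 (iter M F z - iter M F y)) (normr_ge0 (iter M F z' - iter M F y'))
  (normr_ge0 (F (iter M F z) - F (iter M F y)))
  (normr_ge0 (F (iter M F z') - F (iter M F y'))).
have e0 : 0 < e := expR_gt0 _; have e'0 : 0 < e' := expR_gt0 _.
move: `|z' - y'| `|z - y| `|iter M F z - iter M F y| `|iter M F z' - iter M F y'|
  `|F (iter M F z) - F (iter M F y)| `|F (iter M F z') - F (iter M F y')|.
move=> q p A B A' B' A0 B0 A'0 B'0 AA' IH S q0 p0.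
have rhs0 : 0 <= e * e' * B' * p by rewrite !mulr_ge0 // ltW.
(* A vanishing [B] cannot be cancelled; the induction hypothesis then forces [q = 0] or [A = 0], and
   either makes the left side vanish. *)
have [Bz|Bn] := eqVneq B 0.
  have [qz|qn] := eqVneq q 0; first by rewrite qz mulr0.
  have Az : A = 0.
    apply/eqP; rewrite eq_le A0 andbT.
    by move: IH; rewrite Bz mulr0 mul0r pmulr_lle0 // lt_def qn.
  by rewrite AA' // mul0r.
have Bp : 0 < B by rewrite lt_def Bn.
rewrite -(ler_pM2r Bp) mulrAC.
apply: (@le_trans _ _ (e' * B' * A * q)); first by rewrite ler_wpM2r.
have -> : e' * B' * A * q = (e' * B') * (A * q) by ring.
have -> : e * e' * B' * p * B = (e' * B') * (e * B * p) by ring.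
by apply: ler_wpM2l; rewrite // mulr_ge0 // ltW.
Qed.

(* A boolean [s] is a side of a point, the left one if [s] is [true]; [reverses x] tells whether
   [F] exchanges the sides at [x]. *)
Definition pt x s h := if s then x - h else x + h.
Definition reverses x := `[< exists2 r, 0 < r & forall h, 0 < h < r -> F (x + h) < F x >].
Definition psi x s h := `|F (pt x s h) - F x|.

Lemma dist_pt x s h : 0 <= h -> `|pt x s h - x| = h.
Proof.
move=> h0; rewrite /pt; case: s; last by rewrite addrC addKr ger0_norm.
by rewrite addrC addrA addNr add0r normrN ger0_norm.
Qed.

Lemma reversesP x r y z : 0 < r -> turn_free T (x - r) (x + r) ->
  x - r <= y -> y < z -> z <= x + r ->
  if reverses x then F z < F y else F y < F z.
Proof.
move=> r0 fr xy yz zx.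
have [inc|dec] := dm_mono DM fr; rewrite /reverses; case: asboolP => //.
- move=> [r' r'0 H]; have m0 : 0 < Num.min r r' / 2.
    by rewrite divr_gt0 // lt_min r0 r'0.
  have mr : Num.min r r' <= r by rewrite ge_min lexx.
  have mr' : Num.min r r' <= r' by rewrite ge_min lexx orbT.
  have h1 : F (x + Num.min r r' / 2) < F x by apply: H; between.
  have h2 : F x < F (x + Num.min r r' / 2) by apply: inc; lra.
  by have := lt_trans h1 h2; rewrite ltxx.
- by move=> _; exact: inc.
- by move=> _; exact: dec.
- by case; exists r => // h /andP[? ?]; apply: dec; lra.
Qed.

Lemma F_pt x s h r : 0 <= h -> h <= r -> 0 < r -> turn_free T (x - r) (x + r) ->
  F (pt x s h) = pt (F x) (s (+) reverses x) (psi x s h).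
Proof.
move=> h0 hr r0 fr; have [->|hn0] := eqVneq h 0.
  by rewrite /psi /pt; case: s; rewrite ?subr0 ?addr0 subrr normr0; case: (reverses x);
     rewrite /= ?subr0 ?addr0.
have hp : 0 < h by rewrite lt_def hn0.
rewrite /psi /pt; case: s => /=.
  have := @reversesP x r (x - h) x r0 fr; case: (reverses x) => /= H.
    rewrite gtr0_norm ?subr_gt0; last by apply: H; lra.
    by lra.
  rewrite ltr0_norm ?subr_lt0; last by apply: H; lra.
  by lra.
have := @reversesP x r x (x + h) r0 fr; case: (reverses x) => /= H.
  rewrite ltr0_norm ?subr_lt0; last by apply: H; lra.
  by lra.
rewrite gtr0_norm ?subr_gt0; last by apply: H; lra.
by lra.
Qed.

Lemma pt_itv x s h r : 0 <= h -> h <= r -> x - r <= pt x s h <= x + r.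
Proof. by move=> ? ?; rewrite /pt; case: s; between. Qed.

Lemma psi_lip x s h r : 0 <= h -> h <= r -> turn_free T (x - r) (x + r) ->
  C^-1 * h <= psi x s h <= C * h.
Proof.
move=> h0 hr fr; have := @lipN _ _ x (pt x s h) fr.
by rewrite dist_pt //; apply; [between|exact: pt_itv].
Qed.

Lemma psi_lt x s h h' r : 0 <= h -> h < h' -> h' <= r -> turn_free T (x - r) (x + r) ->
  psi x s h < psi x s h'.
Proof.
move=> h0 hh hr fr; have r0 : 0 < r by lra.
have := F_pt s h0 (ltW (lt_le_trans hh hr)) r0 fr.
have := F_pt s (le_trans h0 (ltW hh)) hr r0 fr.
rewrite {1 3}/pt; case: s.
  have := @reversesP x r (x - h') (x - h) r0 fr; case: (reverses x) => /= H E E'.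
    have := H _ _ _; rewrite E E' /pt; lra.
  have := H _ _ _; rewrite E E' /pt; lra.
have := @reversesP x r (x + h) (x + h') r0 fr; case: (reverses x) => /= H E E'.
  have := H _ _ _; rewrite E E' /pt; lra.
have := H _ _ _; rewrite E E' /pt; lra.
Qed.

Lemma psi_cont x s : continuous (psi x s).
Proof.
move=> h; rewrite /psi.
apply: (@continuous_comp _ _ _ (fun h => F (pt x s h) - F x) (fun y => `|y|));
  last exact: norm_continuous.
apply: cvgB; last exact: cvg_cst.
apply: (@continuous_comp _ _ _ (pt x s) F); last exact: (dm_cont DM).
rewrite /pt; case: s; last by apply: cvgD; [exact: cvg_cst|exact: cvg_id].
by apply: cvgB; [exact: cvg_cst|exact: cvg_id].
Qed.

Lemma psi0 x s : psi x s 0 = 0.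
Proof. by rewrite /psi /pt; case: s; rewrite ?subr0 ?addr0 subrr normr0. Qed.

Lemma pull x s (g : R) h' : 0 < g -> 0 < h' ->
  exists h, [/\ 0 < h <= g, psi x s h <= h' & h = g \/ psi x s h = h'].
Proof.
move=> g0 h'0; have [le|lt] := lerP (psi x s g) h'.
  by exists g; rewrite g0 lexx; split => //; left.
have [||c cI ch] := @IVT _ (psi x s) 0 g h' (ltW g0).
- apply: continuous_subspaceT; exact: psi_cont.
- rewrite psi0 ge_min (ltW h'0) /= le_max (ltW lt) orbT //.
exists c; move: cI; rewrite in_itv /= => /andP[c0 cg].
rewrite ch lexx cg andbT; split; [|by []|by right].
rewrite lt_def c0 andbT; apply: contraTneq h'0 => c00.
by rewrite -ch c00 psi0 ltxx.
Qed.

(** The lengths are chosen backwards from [hM]: the whole [g t] is taken if its image fits into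
    [h t.+1], and otherwise the intermediate value theorem supplies an exact fit. *)
Lemma pullback (x : nat -> R) (s : nat -> bool) (g : nat -> R) M (hM : R) :
  0 < hM -> (forall t, (t < M)%N -> 0 < g t) ->
  exists h : nat -> R, [/\ h M = hM, forall t, (t <= M)%N -> 0 < h t,
    forall t, (t < M)%N -> h t <= g t /\ psi (x t) (s t) (h t) <= h t.+1 &
    forall t, (t < M)%N -> h t = g t \/ psi (x t) (s t) (h t) = h t.+1].
Proof.
move=> hM0; elim: M x s g => [|M IH] x s g g0.
  by exists (fun=> hM); split.
have [|h [hM' h0 hg hd]] := IH (x \o succn) (s \o succn) (g \o succn).
  by move=> t tM; exact: g0.
have [k [/andP[k0 kg] kh kd]] := @pull (x 0%N) (s 0%N) (g 0%N) (h 0%N) (g0 0%N isT) (h0 0%N isT).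
exists (fun t => if t is t'.+1 then h t' else k); split => //.
- by move=> [|t] //; exact: h0.
- by move=> [|t] //; exact: hg.
- by move=> [|t] //; exact: hd.
Qed.

(* The side of [F^t x] on which [F^t] maps the side [s] of [x]. *)
Fixpoint germ x s t := if t is t'.+1 then germ x s t' (+) reverses (iter t' F x) else s.

(* The signed offset of [y] from [x], positive on the side [s]. *)
Definition co s x y := if s then x - y else y - x.

Lemma co_pt s x h : co s x (pt x s h) = h.
Proof. by rewrite /co /pt; case: s; lra. Qed.

Lemma pt_co s x y : pt x s (co s x y) = y.
Proof. by rewrite /co /pt; case: s; lra. Qed.

Lemma coxx s x : co s x x = 0.
Proof. by rewrite /co; case: s; rewrite subrr. Qed.

Lemma coD s x y z : co s x z = co s x y + co s y z.
Proof. by rewrite /co; case: s; lra. Qed.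

Lemma coN s x y : co s y x = - co s x y.
Proof. by rewrite /co; case: s; lra. Qed.

Lemma co_normE s x y : 0 <= co s x y -> co s x y = `|y - x|.
Proof. by rewrite /co; case: s => h; [rewrite distrC|]; rewrite ger0_norm. Qed.

Lemma co_norm_le s x y r : - r <= co s x y <= r -> `|y - x| <= r.
Proof. by rewrite /co ler_norml; case: s => /andP[? ?]; between. Qed.

Lemma co_step s x r y z : 0 < r -> turn_free T (x - r) (x + r) ->
  - r <= co s x y -> co s x y < co s x z -> co s x z <= r ->
  co (s (+) reverses x) (F x) (F y) < co (s (+) reverses x) (F x) (F z).
Proof.
move=> r0 fr; have := @reversesP x r _ _ r0 fr; rewrite /co; case: s; case: (reverses x) => /= H ? ? ?.
- by have := H z y _ _ _; lra.
- by have := H z y _ _ _; lra.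
- by have := H y z _ _ _; lra.
- by have := H y z _ _ _; lra.
Qed.

(** Both points lie in one interval of monotonicity. In [push_overtakes] this keeps two equal
    orientations equal. *)
Lemma reverses_near x x' r : 0 < r -> turn_free T (x - r) (x + r) -> turn_free T (x' - r) (x' + r) ->
  `|x' - x| <= r -> reverses x = reverses x'.
Proof.
move=> r0 fr fr'; rewrite ler_norml => /andP[? ?].
have := @reversesP x r _ _ r0 fr; have := @reversesP x' r _ _ r0 fr'.
have [xx|xx|->//] := ltgtP x x'.
  move=> /(_ x x') H' /(_ x x') H; move: H H'.
  case: (reverses x); case: (reverses x') => // H H'.
    by have := lt_trans (H _ _ _) (H' _ _ _); rewrite ltxx => -> //; lra.
  by have := lt_trans (H _ _ _) (H' _ _ _); rewrite ltxx => -> //; lra.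
move=> /(_ x' x) H' /(_ x' x) H; move: H H'.
case: (reverses x); case: (reverses x') => // H H'.
  by have := lt_trans (H _ _ _) (H' _ _ _); rewrite ltxx => -> //; lra.
by have := lt_trans (H _ _ _) (H' _ _ _); rewrite ltxx => -> //; lra.
Qed.

End Local.

(** * Denjoy's extension argument *)

(** Following one residue class of times is enough: by continuity its limit is fixed by [iter k F],
    see [asymptotic_fix]. *)
Definition cycle_asymptotic {R : realType} (F : R -> R) (z : R) :=
  exists i k p, (0 < k)%N /\ tends (fun m => iter (i + k * m) F z) p.

Section Asymptotic.
Context {R : realType} (a b : R) (F : R -> R) (T : set R) (C V : R) (Phi : R -> R).
Context (DM : denjoy_map a b F T C V Phi).
Implicit Types (x y z u v r p B : R).

Lemma asymptotic_iter j z : cycle_asymptotic F (iter j F z) -> cycle_asymptotic F z.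
Proof.
move=> [i [k [p [k0 H]]]]; exists (i + j)%N, k, p; split=> // e /H[N HN].
exists N => m /HN; rewrite -iterD.
by have -> : (i + k * m + j = i + j + k * m)%N by lia.
Qed.

Lemma asymptotic_fix i k p z : tends (fun m => iter (i + k * m) F z) p -> iter k F p = p.
Proof.
move=> H; apply/eqP; rewrite -subr_eq0 -normr_eq0; apply: contraT => n0.
have e0 : 0 < `|iter k F p - p| / 2 by rewrite divr_gt0 // lt_def n0 normr_ge0.
have [d d0 Hd] := iter_near DM k p e0.
have [N HN] := H _ d0; have [M HM] := H _ e0.
have := Hd _ (HN (maxn N M) (leq_maxl _ _)).
rewrite -iterD (_ : k + _ = i + k * (maxn N M).+1)%N; last by rewrite mulnS; lia.
have := HM (maxn N M).+1 (leqW (leq_maxr _ _)); set w := iter _ F z => h1 h2.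
have : `|iter k F p - p| <= `|w - p| + `|w - iter k F p|.
  have -> : iter k F p - p = (w - p) - (w - iter k F p) by ring.
  exact: ler_normB.
lra.
Qed.

Lemma asymptotic_summable z i k B : (0 < k)%N ->
  (forall n, \sum_(m < n) `|iter (m + k + i) F z - iter (m + i) F z| <= B) ->
  cycle_asymptotic F z.
Proof.
move=> k0 HB; have [|p pP] := @summable_tends R (fun m => iter (i + k * m) F z) B.
  move=> n; apply: le_trans (HB (k * n)%N).
  elim: n => [|n IH]; first by rewrite !big_ord0 sumr_ge0.
  rewrite big_ord_recr /= mulnSr big_split_ord /= lerD //.
  case: k k0 {HB IH} => // k _; rewrite big_ord_recl /= addn0.
  rewrite (_ : i + (k.+1 * n + k.+1) = k.+1 * n + k.+1 + i)%N; last by lia.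
  rewrite (_ : i + k.+1 * n = k.+1 * n + i)%N; last by lia.
  by rewrite lerDl sumr_ge0.
by exists i, k, p.
Qed.

End Asymptotic.

Section Extension.
Context {R : realType} (a b : R) (F : R -> R) (T : set R) (C V : R) (Phi : R -> R).
Context (DM : denjoy_map a b F T C V Phi).
Context (u v r : R).

(* The images X_t of [u, v] have the endpoints [e t] and [d t], and X_t lies on the side of [e t]
   opposite to [sg t]. *)
Let e t := iter t F v.
Let d t := iter t F u.
Let l t : R := `|d t - e t|.
Let sg := germ F v false.

Context (uv : u < v) (r0 : 0 < r).
Context (fr : forall t, turn_free T (e t - r) (e t + r)).
Context (small : forall t, C * l t < r).
Context (disj : forall (t t' : nat) y, t != t' ->
  ~ ((- l t <= co (sg t) (e t) y <= 0) /\ (- l t' <= co (sg t') (e t') y <= 0))).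
Context (nasym : ~ cycle_asymptotic F u).

Let C0 : 0 < C := lt_le_trans ltr01 (dm_C DM).

Lemma lr t : l t < r.
Proof.
apply: le_lt_trans (small t); rewrite ler_peMl ?normr_ge0 //; exact: (dm_C DM).
Qed.

Lemma co_du t : co (sg t) (e t) (d t) = - l t.
Proof.
elim: t => [|t IH].
  by rewrite /l /d /e /= /co /= ltr0_norm ?opprK // subr_lt0.
have lt0 : 0 <= l t := normr_ge0 _.
have lrt := lr t.
have [l0|ln0] := eqVneq (l t) 0.
  have de : d t = e t by apply/eqP; rewrite -subr_eq0 -normr_eq0; apply/eqP.
  have de' : d t.+1 = e t.+1 by rewrite /d /e !iterS -/(d t) -/(e t) de.
  by rewrite /l de' subrr normr0 oppr0 coxx.
have lp : 0 < l t by rewrite lt_def ln0.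
have := co_step DM (s := sg t) (y := d t) (z := e t) r0 (@fr t).
rewrite coxx IH lerN2 oppr_lt0 => /(_ (ltW lrt) lp (ltW r0)).
rewrite coxx => h.
have {}h : co (sg t.+1) (e t.+1) (d t.+1) < 0 := h.
rewrite (coN (sg t.+1) (d t.+1) (e t.+1)) co_normE; first by rewrite /l distrC.
by rewrite coN oppr_ge0 ltW.
Qed.

Lemma l_gt0 t : 0 < l t.
Proof.
elim: t => [|t lp]; first by rewrite /l /d /e /= normr_gt0 subr_eq0 lt_eqF.
have lrt := lr t.
have := co_step DM (s := sg t) (y := d t) (z := e t) r0 (@fr t).
rewrite coxx co_du lerN2 oppr_lt0 => /(_ (ltW lrt) lp (ltW r0)).
rewrite coxx => h.
have {}h : co (sg t.+1) (e t.+1) (d t.+1) < 0 := h.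
by move: h; rewrite co_du oppr_lt0.
Qed.

Lemma e_neq (t t' : nat) : t != t' -> e t != e t'.
Proof.
move=> tt; apply/eqP => ee; apply: (@disj t t' (e t) tt).
rewrite (_ : co (sg t') (e t') (e t) = 0); last by rewrite ee coxx.
by rewrite coxx lexx !oppr_le0 !ltW ?l_gt0.
Qed.

(** The image [X_t'] is an interval that avoids [e t], because [e t] belongs to [X_t]; so it cannot
    reach across. *)
Lemma X_beyond (t t' : nat) : t != t' -> 0 < co (sg t) (e t) (e t') ->
  0 < co (sg t) (e t) (d t').
Proof.
move=> tt h; rewrite ltNge; apply/negP => h'.
apply: (@disj t t' (e t) tt); rewrite coxx lexx oppr_le0 (ltW (l_gt0 _)); split => //.
move: h h' (co_du t') (l_gt0 t'); rewrite /co /l.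
by case: (sg t); case: (sg t') => h1 h2 h3 h4; between.
Qed.

(** * Pulling back an interval next to X_n at a record time n *)

Section Pulled.
Context (n : nat) (record : forall i, (i < n)%N -> l n < l i) (rho : R) (h : nat -> R).
Let D := expR (3 * V).
Context (rho0 : 0 < rho) (rho1 : rho < 1) (Drho : D * rho <= 1).
Context (hn : h n = rho * l n) (h0 : forall t, (t <= n)%N -> 0 < h t).
Context (hr : forall t, (t < n)%N -> h t <= r /\ psi F (e t) (sg t) (h t) <= h t.+1).
Context (hd : forall t, (t < n)%N -> h t = r \/ psi F (e t) (sg t) (h t) = h t.+1).

Definition inH t y := 0 < co (sg t) (e t) y <= h t.

Lemma co_psi t x : 0 <= x <= r ->
  co (sg t.+1) (e t.+1) (F (pt (e t) (sg t) x)) = psi F (e t) (sg t) x.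
Proof.
by move=> /andP[x0 xr]; rewrite (F_pt DM _ x0 xr r0 (@fr t)) /= co_pt.
Qed.

Lemma psi_le t x y : 0 <= x -> x <= y -> y <= r ->
  psi F (e t) (sg t) x <= psi F (e t) (sg t) y.
Proof.
move=> x0; rewrite le_eqVlt => /predU1P[->//|xy] yr.
by apply/ltW; apply: (psi_lt DM _ _ _ yr).
Qed.

Lemma push t y : (t < n)%N -> inH t y -> inH t.+1 (F y).
Proof.
move=> tn /andP[y0 yh]; have [hr1 hr2] := hr tn.
rewrite /inH -[y](pt_co (sg t) (e t)) co_psi; last by rewrite (ltW y0) (le_trans yh).
apply/andP; split; last by apply: le_trans hr2; apply: psi_le => //; exact: ltW.
rewrite -(psi0 F (e t) (sg t)); apply: (psi_lt DM _ _ _ _ (@fr t)) => //.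
exact: le_trans hr1.
Qed.

Lemma push_iter j t y : (t + j <= n)%N -> inH t y -> inH (t + j) (iter j F y).
Proof.
elim: j => [|j IH] tj yH; first by rewrite addn0.
have tjn : (t + j < n)%N by rewrite -addnS.
by rewrite addnS iterS; apply: push => //; apply: IH => //; exact: ltnW.
Qed.

Lemma iter_e j t : iter j F (e t) = e (j + t)%N.
Proof. by rewrite /e iterD. Qed.

Lemma iter_d j t : iter j F (d t) = d (j + t)%N.
Proof. by rewrite /d iterD. Qed.

Definition overtakes s s' := sg s = sg s' /\ inH s (e s').

(** As the orientations agree, [X_s'] reaches back from [e s'] towards [e s] and lies in the
    interval of length [h s] next to [e s]. After [n - s] steps an image of [[u, v]] at a time
    before [n] lies in an interval of length [rho * l n < l n], against [record]. *)
Lemma not_earlier s s' : (s <= n)%N -> (s' < s)%N -> ~ overtakes s s'.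
Proof.
move=> sn ss [sE es]; have ne : s != s' by rewrite gtn_eqF.
have ds : inH s (d s').
  have /andP[es0 eh] := es; apply/andP; split; first exact: X_beyond.
  by rewrite (coD _ _ (e s')) sE co_du -sE; have := l_gt0 s'; lra.
have nE : (s + (n - s) = n)%N by rewrite subnKC.
have := @push_iter (n - s) s _ _ es; rewrite nE => /(_ (leqnn _)).
have := @push_iter (n - s) s _ _ ds; rewrite nE => /(_ (leqnn _)).
rewrite iter_e iter_d /inH => /andP[dn dn'] /andP[en en'].
have lt : (n - s + s' < n)%N by clear -sn ss; lia.
have := record lt; have := l_gt0 n; rewrite hn in dn' en'.
have : rho * l n < l n by rewrite gtr_pMl ?l_gt0.
move: dn dn' en en'; rewrite /co /l.
case: (sg n) => h1 h2 h3 h4 h5 h6; apply/negP; rewrite -leNgt;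
  by apply: le_trans (ltW h5); rewrite ler_norml; between.
Qed.

Lemma push_overtakes (j s s' : nat) : (s + j <= n)%N -> (s' + j <= n)%N -> s != s' ->
  overtakes s s' -> overtakes (s + j) (s' + j).
Proof.
move=> sn sn' ss ov; elim: j sn sn' => [|j IH] sn sn'; first by rewrite !addn0.
have [sgE yH] : overtakes (s + j) (s' + j).
  by apply: IH; [apply: leq_trans sn|apply: leq_trans sn']; rewrite leq_add2l.
have sjn : (s + j < n)%N by rewrite -addnS.
rewrite !addnS; split; last by apply: push.
rewrite /sg /= -/sg.
rewrite sgE; congr (_ (+) _); apply: (reverses_near DM r0 (@fr _) (@fr _)).
apply: (@co_norm_le _ (sg (s + j))).
have [+ _] := hr sjn; have /andP[] := yH.
by move=> *; between.
Qed.

(** Only overtaking by the final time has to be excluded: any other overtaking after [t] can be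
    pushed forward until the overtaking index is [n], see [no_overtaking]. *)
Definition clear t := forall a, (t < a < n)%N -> ~ overtakes a n.

Lemma no_overtaking t s s' : clear t -> (t <= s < s')%N -> (s' < n)%N -> ~ overtakes s s'.
Proof.
move=> ct /andP[ts ss] sn ov; apply: (ct (s + (n - s'))%N); first by lia.
have {2}-> : (n = s' + (n - s'))%N by lia.
by apply: push_overtakes => //; [lia|lia|rewrite ltn_eqF].
Qed.

Let hlo t := if sg t then e t - h t else e t.
Let hhi t := if sg t then e t else e t + h t.
Let xlo t := if sg t then e t else e t - l t.
Let xhi t := if sg t then e t + l t else e t.
Let jlo t := if sg t then e t - h t else e t - l t.
Let jhi t := if sg t then e t + l t else e t + h t.

Let xsep (t t' : nat) : t != t' -> xhi t <= xlo t' \/ xhi t' <= xlo t.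
Proof.
move=> tt; have [?|h1] := lerP (xhi t) (xlo t'); first by left.
have [?|h2] := lerP (xhi t') (xlo t); first by right.
have pt0 := l_gt0 t; have pt0' := l_gt0 t'.
have [h3|h3] := lerP (xlo t) (xlo t').
  case: (@disj t t' (xlo t') tt); move: h1 h2 h3; rewrite /xhi /xlo /co.
  by case: (sg t); case: (sg t') => h1 h2 h3; split; between.
case: (@disj t t' (xlo t) tt); move: h1 h2 h3; rewrite /xhi /xlo /co.
by case: (sg t); case: (sg t') => h1 h2 h3; split; between.
Qed.

(** For [s < s'] of equal orientation, an overlap would put [e s'] into the interval at [s],
    contrary to [no_overtaking], or [e s] into the interval at [s'], contrary to [not_earlier]. *)
Let hsep (t s s' : nat) : clear t -> (t <= s)%N -> (t <= s')%N -> (s < n)%N -> (s' < n)%N ->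
  sg s = sg s' -> s != s' -> hhi s <= hlo s' \/ hhi s' <= hlo s.
Proof.
move=> ct; wlog ss : s s' / (s < s')%N.
  move=> H ts ts' sn sn' sE; rewrite neq_ltn => /orP[ss|ss].
    by apply: H => //; rewrite ltn_eqF.
  have ne' : s' != s by rewrite ltn_eqF.
  by have [] := H s' s ss ts' ts sn' sn (esym sE) ne'; [right|left].
move=> ts ts' sn sn' sE ne.
have nov : ~ inH s (e s').
  by move=> yH; apply: (@no_overtaking t s s' ct); rewrite ?ts //; split.
have nov' : ~ inH s' (e s).
  by move=> yH; apply: (@not_earlier s' s (ltnW sn') ss); split; rewrite // sE.
have := h0 (ltnW sn); have := h0 (ltnW sn'); have := e_neq ne.
move: nov nov'; rewrite /inH /hhi /hlo /co sE neq_lt => nov nov' /orP[ee|ee] p p'.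
  case: (sg s') nov nov' => nov nov'.
    left; rewrite leNgt; apply/negP => h1; apply: nov'; between.
  left; rewrite leNgt; apply/negP => h1; apply: nov; between.
case: (sg s') nov nov' => nov nov'.
  right; rewrite leNgt; apply/negP => h1; apply: nov; between.
right; rewrite leNgt; apply/negP => h1; apply: nov'; between.
Qed.

Let eqs t := forall s, (t <= s < n)%N -> psi F (e s) (sg s) (h s) = h s.+1.

Let iter_pt t j : eqs t -> (t + j <= n)%N ->
  iter j F (pt (e t) (sg t) (h t)) = pt (e (t + j)) (sg (t + j)) (h (t + j)).
Proof.
move=> et; elim: j => [|j IH] tj; first by rewrite addn0.
have tjn : (t + j < n)%N by rewrite -addnS.
rewrite iterS (IH (ltnW tjn)); have [hrj _] := hr tjn.
rewrite (F_pt DM _ (ltW (h0 (ltnW tjn))) hrj r0 (@fr _)) et ?addnS //.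
by rewrite leq_addr.
Qed.

(** The distortion along the hulls of [X_j] and its neighbour is at most [D]: the [X_j] are
    disjoint, and so are the neighbours of each orientation, which makes three families of variation
    at most [V]. Used in both directions, it carries the ratio [rho] from time [n] back to time
    [t]. *)
Lemma pulled_dist t : clear t -> (t <= n)%N -> eqs t ->
  h t <= D * rho * l t /\ rho * l t <= D * h t.
Proof.
move=> ct tn et; set w := pt (e t) (sg t) (h t).
have Fw j : (t + j <= n)%N -> iter j F w = pt (e (t + j)) (sg (t + j)) (h (t + j)).
  exact: iter_pt.
have Fwn : iter (n - t) F w = pt (e n) (sg n) (h n).
  by rewrite Fw subnKC.
have S3 : \sum_(j < n - t) (Phi (jhi (t + j)) - Phi (jlo (t + j))) <= 3 * V.
  rewrite (eq_bigr (fun j : 'I_(n - t) => (Phi (xhi (t + j)) - Phi (xlo (t + j))) +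
    (Phi (hhi (t + j)) - Phi (hlo (t + j))))); last first.
    by move=> j _; rewrite /jhi /jlo /xhi /xlo /hhi /hlo; case: (sg _); lra.
  rewrite big_split /= [X in _ + X](bigID (fun j : 'I_(n - t) => sg (t + j))) /=.
  have X1 : \sum_(j < n - t) (Phi (xhi (t + j)) - Phi (xlo (t + j))) <= V.
    apply: (@disjoint_sum_ord _ _ xpredT (fun j => xlo (t + j)) (fun j => xhi (t + j)) Phi).
    - exact: (dm_nd DM).
    - exact: (dm_bnd DM).
    - by move=> i _; rewrite /xlo /xhi; have := l_gt0 (t + i); case: ifP; lra.
    - by move=> i i' _ _ _ _ ii; apply: xsep; rewrite eqn_add2l.
  have X2 (P : pred bool) : (forall c c', P c -> P c' -> c = c') ->
      \sum_(j < n - t | P (sg (t + j))) (Phi (hhi (t + j)) - Phi (hlo (t + j))) <= V.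
    move=> Puniq.
    apply: (@disjoint_sum_ord _ _ (fun j => P (sg (t + j))) (fun j => hlo (t + j))
      (fun j => hhi (t + j)) Phi).
    - exact: (dm_nd DM).
    - exact: (dm_bnd DM).
    - move=> i; rewrite ltn_subRL => /ltnW/h0.
      by rewrite /hlo /hhi; case: ifP; lra.
    - move=> i i'; rewrite !ltn_subRL => iM iM' Pi Pi' ii.
      by apply: (hsep ct); rewrite ?leq_addr ?eqn_add2l //; exact: Puniq.
  have := X2 id; have := X2 negb.
  have U1 : forall c c', ~~ c -> ~~ c' -> c = c' by case; case.
  have U2 : forall c c' : bool, c -> c' -> c = c' by case; case.
  by move=> /(_ U1) h1 /(_ U2) h2; move: X1 h1 h2; lra.
have De : expR (\sum_(j < n - t) (Phi (jhi (t + j)) - Phi (jlo (t + j)))) <= D.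
  by rewrite ler_expR.
have frj j : (j < n - t)%N -> turn_free T (jlo (t + j)) (jhi (t + j)).
  rewrite ltn_subRL => tj; have [hrj _] := hr tj; have lrj := lr (t + j).
  by apply: (turn_free_sub (@fr (t + j))); rewrite /jlo /jhi; case: (sg _); lra.
have dn : iter (n - t) F (d t) = d n by rewrite iter_d subnK.
have en : iter (n - t) F (e t) = e n by rewrite iter_e subnK.
have inJ j : (j < n - t)%N ->
    [/\ jlo (t + j) <= iter j F (d t) <= jhi (t + j),
        jlo (t + j) <= iter j F (e t) <= jhi (t + j) &
        jlo (t + j) <= iter j F w <= jhi (t + j)].
  rewrite ltn_subRL => tj; rewrite iter_d iter_e Fw ?(ltnW tj) //.
  have := h0 (ltnW tj); have := co_du (t + j); have := l_gt0 (t + j).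
  rewrite (addnC j) /jlo /jhi /pt /co => p q p'.
  by move: p q p'; case: (sg (t + j)) => p q p'; split; between.
have we : `|w - e t| = h t by rewrite dist_pt // ltW // h0.
have wen : `|pt (e n) (sg n) (h n) - e n| = h n by rewrite dist_pt // ltW // h0.
have edE s : `|e s - d s| = l s by rewrite distrC.
have ln0 := l_gt0 n; have lt0 := l_gt0 t; have ht0 := h0 tn.
have hn0 : 0 <= h n by rewrite hn mulr_ge0 // ltW.
have K1 := tube_dist DM (y := d t) (z := e t) (y' := e t) (z' := w) frj
  (fun j jM => let: And3 A B W := inJ j jM in And4 A B B W).
have K2 := tube_dist DM (y := e t) (z := w) (y' := d t) (z' := e t) frj
  (fun j jM => let: And3 A B W := inJ j jM in And4 B W A B).
rewrite dn en Fwn we wen !edE in K1; rewrite dn en Fwn we wen !edE in K2.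
split.
  rewrite -(ler_pM2l ln0); apply: le_trans K1 _.
  rewrite (_ : l n * (D * rho * l t) = D * h n * l t); last by rewrite hn; ring.
  by apply: ler_wpM2r; [exact: ltW|apply: ler_wpM2r].
rewrite -(ler_pM2l ln0) (_ : l n * (rho * l t) = h n * l t); last by rewrite hn; ring.
apply: le_trans K2 _; rewrite (_ : l n * (D * h t) = D * l n * h t); last by ring.
by apply: ler_wpM2r; [exact: ltW|apply: ler_wpM2r => //; exact: ltW].
Qed.

(** Downward induction. The later times give [h s.+1 <= l s.+1]; a truncation [h s = r] would then
    imply [r <= C * l s.+1], against [small]. *)
Lemma pulled_eqs t : clear t -> eqs t.
Proof.
move=> ct s /andP[ts sn].
have [j] := ubnP (n - s)%N; elim: j s ts sn => // j IH s ts sn nj.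
have es : eqs s.+1.
  move=> s' /andP[ss' sn']; apply: IH => //; first exact: leq_trans ts (ltnW ss').
  by clear -nj ss' sn'; lia.
have cs : clear s.+1.
  by move=> c /andP[sc cn]; apply: ct; rewrite cn andbT; clear -ts sc; lia.
have [h1 _] := pulled_dist cs sn es; have [hrs hps] := hr sn.
have [hsr|//] := hd sn; have ls := small s.+1; have l0 := l_gt0 s.+1.
have := psi_lip DM (sg s) (ltW r0) (lexx r) (@fr s).
rewrite hsr in hps; move=> /andP[h2 _].
have h3 : C^-1 * r <= l s.+1.
  apply: le_trans (le_trans h2 hps) _; apply: le_trans h1 _.
  by rewrite ler_piMl // ltW.
have : r <= C * l s.+1 by rewrite -ler_pdivrMl.
by rewrite leNgt ls.
Qed.

Lemma pulled_bounds t : clear t -> (t <= n)%N ->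
  [/\ h t <= D * rho * l t, rho * l t <= D * h t &
    iter (n - t) F (pt (e t) (sg t) (h t)) = pt (e n) (sg n) (h n)].
Proof.
move=> ct tn; have et := pulled_eqs ct; have [? ?] := pulled_dist ct tn et.
by split=> //; rewrite iter_pt ?subnKC.
Qed.

End Pulled.
Section Trap.
Context (n : nat) (rho : R) (h : nat -> R) (rho1 : rho < 1).
Context (hn : h n = rho * l n) (h0 : forall t, (t <= n)%N -> 0 < h t).
Context (hr : forall t, (t < n)%N -> h t <= r /\ psi F (e t) (sg t) (h t) <= h t.+1).

Let step t y : (t < n)%N -> - l t <= co (sg t) (e t) y <= h t ->
  - l t.+1 <= co (sg t.+1) (e t.+1) (F y) <= h t.+1.
Proof.
move=> tn /andP[ly yh]; have [hr1 hr2] := hr tn; have lrt := lr t.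
have rl : - r <= - l t by lra.
apply/andP; split.
  move: ly; rewrite -co_du le_eqVlt => /predU1P[yE|yd].
    by rewrite -[y](pt_co (sg t) (e t)) -yE pt_co -/(d t.+1) -co_du.
  rewrite -co_du; apply/ltW; apply: (co_step DM r0 (@fr t) _ yd).
    by rewrite co_du.
  exact: le_trans hr1.
apply: le_trans hr2; rewrite -co_psi ?(ltW (h0 _)) ?(ltnW tn) //.
move: yh; rewrite le_eqVlt => /predU1P[yE|yd].
  by rewrite -[y in F y](pt_co (sg t) (e t)) yE.
apply/ltW; apply: (co_step DM r0 (@fr t)); rewrite ?co_pt //.
exact: le_trans ly.
Qed.

Let step_lt t y z : (t < n)%N -> - l t <= co (sg t) (e t) y ->
  co (sg t) (e t) y < co (sg t) (e t) z -> co (sg t) (e t) z <= h t ->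
  co (sg t.+1) (e t.+1) (F y) < co (sg t.+1) (e t.+1) (F z).
Proof.
move=> tn ly yz zh; have [hr1 hr2] := hr tn; have lrt := lr t.
have rl : - r <= - l t by lra.
by apply: (co_step DM r0 (@fr t) _ yz); [exact: le_trans ly|exact: le_trans hr1].
Qed.

Let steps t j y : (t + j <= n)%N -> - l t <= co (sg t) (e t) y <= h t ->
  - l (t + j) <= co (sg (t + j)) (e (t + j)) (iter j F y) <= h (t + j).
Proof.
elim: j => [|j IH] tj H; first by rewrite addn0.
have tjn : (t + j < n)%N by rewrite -addnS.
by rewrite addnS iterS; apply: step => //; apply: IH => //; exact: ltnW.
Qed.

Let steps_lt t j y z : (t + j <= n)%N -> - l t <= co (sg t) (e t) y ->
  co (sg t) (e t) y < co (sg t) (e t) z -> co (sg t) (e t) z <= h t ->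
  co (sg (t + j)) (e (t + j)) (iter j F y) < co (sg (t + j)) (e (t + j)) (iter j F z).
Proof.
move=> tj ly yz zh; elim: j tj => [|j IH] tj; first by rewrite addn0.
have tjn : (t + j < n)%N by rewrite -addnS.
have {}IH := IH (ltnW tjn).
have yh : co (sg t) (e t) y <= h t by apply: le_trans (ltW yz) zh.
have lz : - l t <= co (sg t) (e t) z by apply: le_trans ly (ltW yz).
have /andP[ly' _] : - l (t + j) <= co (sg (t + j)) (e (t + j)) (iter j F y) <= h (t + j).
  by apply: steps; [exact: ltnW|rewrite ly].
have /andP[_ zh'] : - l (t + j) <= co (sg (t + j)) (e (t + j)) (iter j F z) <= h (t + j).
  by apply: steps; [exact: ltnW|rewrite lz].
by rewrite addnS !iterS; apply: step_lt.
Qed.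

(* [F^(n - t)] maps the hull of X_t and H_t into itself, preserving the orientation, so that the
   orbits in it converge to a cycle. *)
Lemma no_trap t : (t < n)%N -> overtakes h t n ->
  2 * co (sg t) (e t) (e n) <= h t -> False.
Proof.
move=> tn [sE /andP[k0 kh]]; set k := co _ _ _ in k0 kh * => k2.
have tne : t != n by rewrite ltn_eqF.
(* [X_n] lies beyond [e t], hence [l n < k]. The hull is therefore mapped between [k - l n > 0] and
   [k + rho * l n < 2 * k <= h t], that is, into itself. *)
have lnk : l n < k.
  have := X_beyond tne k0; rewrite (coD _ _ (e n)) -/k {1}sE co_du; lra.
pose q := (n - t)%N; have tq : (t + q = n)%N by rewrite /q; clear -tn; lia.
have q0 : (0 < q)%N by rewrite subn_gt0.
have lt0 := l_gt0 t; have ln0 := l_gt0 n.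
have rln : rho * l n < l n by rewrite gtr_pMl.
pose c y := co (sg t) (e t) y.
have cG y : c (iter q F y) = k + co (sg n) (e n) (iter q F y).
  by rewrite /c (coD _ _ (e n)) -/k sE.
have inG y : - l t <= c y <= h t -> - l t <= c (iter q F y) <= h t.
  move=> /(@steps t q) => /(_ (eq_leq tq)); rewrite tq cG hn => /andP[? ?].
  by between.
pose z m := iter (t + q * m) F u.
have zS m : z m.+1 = iter q F (z m).
  by rewrite /z mulnS addnCA iterD.
have z0 : z 0%N = d t by rewrite /z muln0 addn0.
have c0 : c (d t) = - l t by rewrite /c co_du.
have zJ m : - l t <= c (z m) <= h t.
  elim: m => [|m IH]; last by rewrite zS; exact: inG.
  rewrite z0 c0 lexx /=.
  by apply: le_trans (ltW (h0 (ltnW tn))); rewrite oppr_le0 ltW.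
have zlt m : c (z m) < c (z m.+1).
  elim: m => [|m IH].
    have := zJ 0%N => /(@steps t q) => /(_ (eq_leq tq)); rewrite tq.
    by rewrite zS cG z0 c0 => /andP[? _]; lra.
  rewrite zS (zS m.+1) !cG ltrD2l -tq; apply: steps_lt; rewrite ?tq //.
  - by have /andP[] := zJ m.
  - by have /andP[] := zJ m.+1.
apply: nasym; exists t, q.
suff [p pP] : exists p, tends z p by exists p.
move: zlt zJ; rewrite /c /co; case: (sg t) => zlt zJ.
  apply: (@nonincreasing_tends _ z (e t - h t)) => m.
    by have := zlt m; lra.
  by have /andP[] := zJ m; lra.
apply: (@nondecreasing_tends _ z (e t + h t)) => m.
  by have := zlt m; lra.
by have /andP[] := zJ m; lra.
Qed.

End Trap.

Lemma pull_mono n (rho rho' : R) (h h' : nat -> R) :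
  rho <= rho' -> h n = rho * l n -> h' n = rho' * l n ->
  (forall t, (t <= n)%N -> 0 < h t) -> (forall t, (t <= n)%N -> 0 < h' t) ->
  (forall t, (t < n)%N -> h t <= r /\ psi F (e t) (sg t) (h t) <= h t.+1) ->
  (forall t, (t < n)%N -> h' t <= r /\ psi F (e t) (sg t) (h' t) <= h' t.+1) ->
  (forall t, (t < n)%N -> h' t = r \/ psi F (e t) (sg t) (h' t) = h' t.+1) ->
  forall t, (t <= n)%N -> h t <= h' t.
Proof.
move=> rr hn hn' h0 h0' hr hr' hd' t tn.
have [j] := ubnP (n - t)%N; elim: j t tn => // j IH t.
rewrite leq_eqVlt => /predU1P[->|tn] nj; first by rewrite hn hn' ler_pM2r // l_gt0.
have [hr1 hr2] := hr _ tn; have [hr1' hr2'] := hr' _ tn.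
have [->//|eq'] := hd' _ tn; rewrite leNgt; apply/negP => lt.
have := psi_lt DM (sg t) (ltW (h0' _ (ltnW tn))) lt hr1 (@fr t).
rewrite eq' ltNge; apply/negP/negPn; apply: le_trans hr2 _.
by apply: IH => //; clear -nj tn; lia.
Qed.

Let D := expR (3 * V).
(** The distortion bound requires [D * rho1 <= 1]. The second scale satisfies
    [2 * (D * rho2) * D = rho1], so that [h2 t <= D * rho2 * l t] and [rho1 * l t <= D * h1 t] give
    [2 * h2 t <= h1 t], as [no_trap] demands. Finally [ext_ratio] comes from
    [rho2 * l 0 <= D * h2 0]. *)
Let rho1 := (2 * D)^-1.
Let rho2 := rho1 / (2 * D ^+ 2).
Definition ext_ratio := rho2 / D.

Let V0 : 0 <= V.
Proof. by have /andP[] := dm_bnd DM 0; exact: le_trans. Qed.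

Let D1 : 1 <= D. Proof. by rewrite /D -expR0 ler_expR mulr_ge0. Qed.
Let D0 : 0 < D. Proof. exact: expR_gt0. Qed.
Let rho1_gt0 : 0 < rho1. Proof. by rewrite invr_gt0 mulr_gt0. Qed.
Let rho2_gt0 : 0 < rho2. Proof. by rewrite divr_gt0 // mulr_gt0 // exprn_gt0. Qed.
Let Drho1 : D * rho1 = 2^-1.
Proof. by rewrite /rho1 invfM mulrCA mulfV ?mulr1 // gt_eqF. Qed.
Let rho12 : 2 * (D * rho2) * D = rho1.
Proof. by rewrite /rho2; field; rewrite gt_eqF. Qed.
Let rho2_le : rho2 <= rho1.
Proof.
rewrite -rho12 (_ : 2 * (D * rho2) * D = 2 * (D * D) * rho2); last by ring.
rewrite ler_peMl ?(ltW rho2_gt0) //.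
have : 1 * 1 <= D * D by rewrite ler_pM.
lra.
Qed.
Let rho1_lt1 : rho1 < 1.
Proof. by have := ler_peMl (ltW rho1_gt0) D1; rewrite Drho1; lra. Qed.

Lemma ext_ratio_gt0 : 0 < ext_ratio. Proof. exact: divr_gt0. Qed.

(* An interval of length [rho * l n] next to X_n is pulled back along the orbit to intervals H_t;
   their distortion is bounded unless H_t contains the endpoint [e n] for some t < n.  This cannot
   happen at both scales [rho1] and [rho2]: if it last happens at the same time, there is a trap,
   and if it happens at different times, then the positions are contradictory. *)
Lemma extend_record n : (forall i, (i < n)%N -> l n < l i) ->
  forall t, (t <= n)%N ->
  0 < co (sg t) (e t) (iter t F (v + ext_ratio * l 0%N)) <= l t.
Proof.
move=> record.
have pl (rho : R) (rho0 : 0 < rho) := @pullback _ _ _ _ _ _ _ _ DM e sg (fun=> r) n (rho * l n)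
  (mulr_gt0 rho0 (l_gt0 n)) (fun _ _ => r0).
have [h1 [hn1 h01 hr1 hd1]] := pl _ rho1_gt0.
have [h2 [hn2 h02 hr2 hd2]] := pl _ rho2_gt0.
have Drho1' : D * rho1 <= 1 by rewrite Drho1; lra.
have Drho2' : D * rho2 <= 1.
  by apply: le_trans Drho1'; rewrite ler_pM2l.
have rho2_lt1 : rho2 < 1 by apply: le_lt_trans rho1_lt1.
have h21 := pull_mono rho2_le hn2 hn1 h02 h01 hr2 hr1 hd1.
have ov21 s s' : (s <= n)%N -> overtakes h2 s s' -> overtakes h1 s s'.
  by move=> sn [? /andP[? H]]; split=> //; apply/andP; split=> //; apply: le_trans (h21 _ sn).
have last_ov (h : nat -> R) c : (c < n)%N -> overtakes h c n ->
    exists t, [/\ (c <= t < n)%N, overtakes h t n & clear n h t].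
  move=> cn oc; pose P t := (t < n)%N && `[< overtakes h t n >].
  have exP : exists t, P t by exists c; rewrite /P cn; apply/asboolP.
  have ubP t : P t -> (t <= n)%N by case/andP => /ltnW.
  case: (ex_maxnP exP ubP) => t /andP[tn /asboolP ot] tmax; exists t; split=> //.
    by rewrite tn andbT; apply: tmax; rewrite /P cn; apply/asboolP.
  move=> x /andP[tx xn] ox.
  have : (x <= t)%N by apply: tmax; rewrite /P xn; apply/asboolP.
  by rewrite leqNgt tx.
have clear2 : clear n h2 0.
  move=> c /andP[_ cn] oc.
  have [t2 [/andP[_ tn2] ot2 ct2]] := last_ov h2 c cn oc.
  have [t1 [/andP[t21 tn1] ot1 ct1]] := last_ov h1 t2 tn2 (ov21 _ _ (ltnW tn2) ot2).
  have [h2D _ _] := pulled_bounds record rho2_gt0 rho2_lt1 Drho2' hn2 h02 hr2 hd2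
    ct2 (ltnW tn2).
  have [_ h1D _] := pulled_bounds record rho1_gt0 rho1_lt1 Drho1' hn1 h01 hr1 hd1
    ct1 (ltnW tn1).
  move: t21; rewrite leq_eqVlt => /predU1P[tE|t21].
    rewrite -tE in ot1 h1D.
    (* Both scales are overtaken last at the same time; then [e n] lies in the small interval, hence
       in the nearer half of the large one. *)
    apply: (no_trap rho1_lt1 hn1 h01 hr1 tn2 ot1).
    have [_ /andP[_ k2]] := ot2.
    have : 2 * co (sg t2) (e t2) (e n) <= 2 * (D * rho2 * l t2).
      by rewrite ler_pM2l //; exact: le_trans h2D.
    move=> /le_trans; apply; rewrite -(ler_pM2l D0).
    by rewrite (_ : D * (2 * (D * rho2 * l t2)) = rho1 * l t2) // -rho12; ring.
  have tne : t2 != t1 by rewrite ltn_eqF.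
  have [sE1 /andP[k1p k1h]] := ot1; have [sE2 /andP[k2p k2h]] := ot2.
  have sE : sg t2 = sg t1 by rewrite sE1.
  have kE : co (sg t2) (e t2) (e n) = co (sg t2) (e t2) (e t1) + co (sg t1) (e t1) (e n).
    by rewrite (coD _ _ (e t1)) sE.
  (* Now [t2 < t1]. If [e t1] is ahead of [e t2], it lies in the small interval at [t2], and pushing
     forward yields an overtaking by [n] later than [t2]. Otherwise [e t2] lies in the large
     interval at [t1], contrary to [not_earlier]. *)
  have [kp|kn] := ltrP 0 (co (sg t2) (e t2) (e t1)).
    have o21 : overtakes h2 t2 t1 by split=> //; apply/andP; split=> //; lra.
    apply: (ct2 (t2 + (n - t1))%N); first by clear -t21 tn1 tn2; lia.
    have {2}-> : (n = t1 + (n - t1))%N by clear -tn1; lia.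
    apply: (push_overtakes hr2) => //.
      by clear -t21 tn1; lia.
    by clear -tn1; lia.
  apply: (not_earlier record rho1_lt1 hn1 hr1 (ltnW tn1) t21).
  split=> //; apply/andP; split; rewrite -sE coN; last by lra.
  rewrite oppr_gt0 lt_def kn andbT eq_sym; apply/eqP => k0.
  have /negP := e_neq tne; apply; apply/eqP; move: k0; rewrite /co.
  by case: (sg t2); lra.
have [h20 h20' _] := pulled_bounds record rho2_gt0 rho2_lt1 Drho2' hn2 h02 hr2 hd2
  clear2 (leq0n n).
have in0 : inH h2 0 (v + ext_ratio * l 0%N).
  rewrite /inH /sg /= /co /e /= addrC addKr.
  rewrite mulr_gt0 ?ext_ratio_gt0 ?l_gt0 //= /ext_ratio mulrAC ler_pdivrMr //.
  by rewrite (mulrC (h2 0%N)).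
move=> t tn; have := @push_iter n h2 hr2 t 0 _ tn in0.
rewrite add0n => /andP[-> /le_trans]; apply.
have ct : clear n h2 t by move=> x /andP[tx xn]; apply: clear2; rewrite xn (leq_ltn_trans _ tx).
have [h2t _ _] := pulled_bounds record rho2_gt0 rho2_lt1 Drho2' hn2 h02 hr2 hd2 ct tn.
by apply: le_trans h2t _; rewrite ler_piMl // ltW // l_gt0.
Qed.

(** With [x] a lower bound of the lengths up to time [t], the first time at which the length falls
    below [x] is a record time beyond [t]. *)
Lemma extend : (forall x, 0 < x -> exists N, forall m, (N <= m)%N -> l m < x) ->
  forall t, 0 < co (sg t) (e t) (iter t F (v + ext_ratio * l 0%N)) <= l t.
Proof.
move=> l_small t.
have [x x0 xl] : exists2 x, 0 < x & forall i, (i <= t)%N -> x <= l i.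
  elim: t => [|t [x x0 xl]].
    by exists (l 0%N); [exact: l_gt0|case].
  exists (Num.min x (l t.+1)); first by rewrite lt_min x0 l_gt0.
  move=> i; rewrite leq_eqVlt => /predU1P[->|it]; first by rewrite ge_min lexx orbT.
  by rewrite ge_min xl.
have exP : exists n, l n < x by have [N HN] := l_small x x0; exists N; apply: HN.
case: (ex_minnP exP) => n ln nmin.
have tn : (t <= n)%N.
  by rewrite leqNgt; apply/negP => /ltnW/xl; rewrite leNgt ln.
apply: (extend_record _ tn) => i im; apply: lt_le_trans ln _.
by rewrite leNgt; apply/negP => /nmin; rewrite leqNgt im.
Qed.

End Extension.

(** * Absence of wandering intervals *)

Section Homtervals.
Context {R : realType} (a b : R) (F : R -> R) (T : set R) (C V : R) (Phi : R -> R).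
Context (DM : denjoy_map a b F T C V Phi).
Implicit Types (x y z u v r d e B : R).

Lemma F_btw x y z : turn_free T (Num.min x z) (Num.max x z) ->
  Num.min x z <= y <= Num.max x z ->
  Num.min (F x) (F z) <= F y <= Num.max (F x) (F z).
Proof.
wlog xz : x z / x <= z.
  move=> H; case/orP: (le_total x z) => [|zx]; first exact: H.
  by rewrite minC maxC (minC (F x)) (maxC (F x)); exact: H.
rewrite (min_idPl xz) (max_idPr xz) => fr /andP[xy yz].
have [inc|dec] := dm_mono DM fr.
  have w p q : x <= p -> p <= q -> q <= z -> F p <= F q.
    move=> xp; rewrite le_eqVlt => /predU1P[->//|pq] qz.
    by apply/ltW; exact: inc.
  by rewrite ge_min le_max (w x y) // (w y z) // orbT.
have w p q : x <= p -> p <= q -> q <= z -> F q <= F p.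
  move=> xp; rewrite le_eqVlt => /predU1P[->//|pq] qz.
  by apply/ltW; exact: dec.
by rewrite ge_min le_max (w x y) // (w y z) // orbT.
Qed.

Lemma btw_dist x y z w : Num.min x z <= y <= Num.max x z ->
  Num.min x z <= w <= Num.max x z -> `|y - w| <= `|x - z|.
Proof.
wlog xz : x z / x <= z.
  move=> H; case/orP: (le_total x z) => [|zx]; first exact: H.
  by rewrite minC maxC (distrC x); exact: H.
rewrite (min_idPl xz) (max_idPr xz) distrC => /andP[? ?] /andP[? ?].
by rewrite (distrC x) (ger0_norm (_ : 0 <= z - x)) ?subr_ge0 // ler_norml; between.
Qed.

Definition homterval u v := u < v /\
  forall t, turn_free T (Num.min (iter t F u) (iter t F v)) (Num.max (iter t F u) (iter t F v)).

Lemma homterval_btw u v y t : homterval u v -> u <= y <= v ->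
  Num.min (iter t F u) (iter t F v) <= iter t F y <= Num.max (iter t F u) (iter t F v).
Proof.
move=> [/ltW uv fr] uyv; elim: t => [|t IH] /=; last exact: F_btw.
by rewrite (min_idPl uv) (max_idPr uv).
Qed.

Lemma homterval_dist u v y z t : homterval u v -> u <= y <= v -> u <= z <= v ->
  `|iter t F y - iter t F z| <= `|iter t F u - iter t F v|.
Proof. by move=> uv uy uz; apply: btw_dist; exact: homterval_btw. Qed.

Lemma asymptotic_close y z :
  (forall e, 0 < e -> exists N, forall m, (N <= m)%N -> `|iter m F y - iter m F z| < e) ->
  cycle_asymptotic F y -> cycle_asymptotic F z.
Proof.
move=> yz [i [k [p [k0 H]]]]; exists i, k, p; split=> // e e0.
have [|N HN] := H (e / 2); first by rewrite divr_gt0.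
have [|M HM] := yz (e / 2); first by rewrite divr_gt0.
exists (maxn N M) => m; rewrite geq_max => /andP[/HN Nm Mm].
have /HM : (M <= i + k * m)%N by rewrite (leq_trans Mm) // (leq_trans (leq_pmull _ k0)) // leq_addl.
move: Nm; rewrite !ltr_distl => /andP[? ?] /andP[? ?]; between.
Qed.

(** * Unbounded growth of a wandering interval *)

Section Wandering.
Context (y1 y2 r B0 : R).
Context (hom12 : homterval y1 y2) (r0 : 0 < r).
Context (fr1 : forall t, turn_free T (iter t F y1 - r) (iter t F y1 + r)).
Context (sum12 : forall n, \sum_(t < n) `|iter t F y1 - iter t F y2| <= B0).
Context (box1 : a - 1 <= y1 <= b + 1) (box2 : a - 1 <= y2 <= b + 1).
Context (nasym : ~ cycle_asymptotic F y1).

Let C0 : 0 < C := lt_le_trans ltr01 (dm_C DM).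

(** These intervals need only contain the orbit point at time [i]; they need not be images of
    [[y1, y2]]. This freedom lets an interval be enlarged repeatedly at one fixed time. *)
Let good i u v := [/\ homterval u v, a - 2 <= u, v <= b + 2, u <= iter i F y1 <= v &
  exists B, forall n, \sum_(t < n) `|iter t F u - iter t F v| <= B].

(** Through a common point the iterates of [y1] starting at times [i] and [j] would be summably
    close, and [y1] would be asymptotic to a cycle. *)
Let good_disj i j u v u' v' : (i < j)%N -> good i u v -> good j u' v' -> v < u' \/ v' < u.
Proof.
move=> ij [h _ _ yi [B HB]] [h' _ _ yj [B' HB']].
have [?|h1] := ltrP v u'; first by left.
have [?|h2] := ltrP v' u; first by right.
have [z /andP[uz zv] uz'] : exists2 z, u <= z <= v & u' <= z <= v'.
  have [[uv _] [uv' _]] := (h, h').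
  have [uu|uu] := lerP u u'; [exists u'|exists u]; between.
case: nasym; apply: (@asymptotic_summable _ _ _ i (j - i)%N (B + B')).
  by rewrite subn_gt0.
move=> n; apply: le_trans (lerD (HB n) (HB' n)); rewrite -big_split /=.
apply: ler_sum => t _.
rewrite (_ : (t + (j - i) + i = t + j)%N); last by rewrite -addnA subnK // ltnW.
rewrite !iterD -[X in X - _](subrK (iter t F z)) -addrA.
apply: le_trans (ler_normD _ _) _; rewrite [leRHS]addrC; apply: lerD.
  exact: homterval_dist.
by apply: homterval_dist => //; rewrite uz.
Qed.

(** Choosing one interval of length at least [e] at each time that admits one gives disjoint
    subintervals of [[a - 2, b + 2]], so there are finitely many such times. *)
Let good_small e : 0 < e -> exists N, forall i, (N <= i)%N -> forall u v, good i u v -> v - u < e.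
Proof.
move=> e0; pose P i := `[< exists p : R * R, good i p.1 p.2 /\ e <= p.2 - p.1 >].
have [X HX] : exists X : nat -> R * R, forall i, P i -> good i (X i).1 (X i).2 /\ e <= (X i).2 - (X i).1.
  suff : forall i, exists p : R * R, P i -> good i p.1 p.2 /\ e <= p.2 - p.1.
    by move=> /choice[X HX]; exists X.
  move=> i; have [/asboolP[p Hp]|nP] := boolP (P i); first by exists p.
  by exists (0, 0).
pose w i := if P i then e else 0.
have w0 i : 0 <= w i by rewrite /w; case: ifP => // _; exact: ltW.
have wB n : \sum_(i < n) w i <= (b + 2) - (a - 2).
  rewrite -big_mkcond /= -(big_mkord P (fun=> e)) /index_iota subn0 -big_filter.
  apply: le_trans (_ : \sum_(i <- [seq i <- iota 0 n | P i]) ((X i).2 - (X i).1) <= _).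
    rewrite big_seq [leRHS]big_seq; apply: ler_sum => i.
    by rewrite mem_filter => /andP[/HX[]].
  apply: (@disjoint_sum _ _ _ (fun i => (X i).1) (fun i => (X i).2) id) => //.
  - by have := dm_ab DM; lra.
  - by rewrite filter_uniq // iota_uniq.
  - move=> i; rewrite mem_filter => /andP[/HX[[[uv _] ? ? _ _] _] _].
    by split=> //; exact: ltW.
  - move=> i j; rewrite !mem_filter => /andP[/HX[gi _] _] /andP[/HX[gj _] _].
    rewrite neq_ltn => /orP[ij|ij].
      by have [/ltW|/ltW] := good_disj ij gi gj; [left|right].
    by have [/ltW|/ltW] := good_disj ij gj gi; [right|left].
have [N HN] := summable_small w0 wB e0.
exists N => i Ni u v guv; rewrite ltNge; apply/negP => le.
have := HN i Ni; rewrite /w ifT ?ltxx //; apply/asboolP; exists (u, v); split => //.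
Qed.

Let good_iter i m u v : good i u v ->
  good (i + m) (Num.min (iter m F u) (iter m F v)) (Num.max (iter m F u) (iter m F v)).
Proof.
move=> [h u2 v2 yi [B HB]]; have [uv fr] := h.
have boxm x : u <= x <= v -> a - 2 <= iter m F x <= b + 2.
  by move=> /andP[? ?]; apply: (iter_box DM); [|apply/andP; split]; lra.
have /andP[au ub] := boxm u ltac:(by rewrite lexx ltW).
have /andP[av vb] := boxm v ltac:(by rewrite lexx ltW).
have yim : Num.min (iter m F u) (iter m F v) <= iter (i + m) F y1 <=
    Num.max (iter m F u) (iter m F v).
  by rewrite addnC iterD; exact: homterval_btw.
have uvm : iter m F u != iter m F v.
  elim: m {boxm au ub av vb yim} => [|m IH]; first by rewrite lt_eqF.
  have := dm_mono DM (fr m); rewrite !iterS.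
  move: IH; rewrite neq_lt => /orP[lt|lt].
    rewrite (min_idPl (ltW lt)) (max_idPr (ltW lt)) => -[H|H].
      by rewrite lt_eqF // H.
    by rewrite gt_eqF // H.
  rewrite (min_idPr (ltW lt)) (max_idPl (ltW lt)) => -[H|H].
    by rewrite gt_eqF // H.
  by rewrite lt_eqF // H.
have HB' n : \sum_(t < n) `|iter (t + m) F u - iter (t + m) F v| <= B.
  apply: le_trans (HB (m + n)%N); rewrite big_split_ord /=.
  rewrite -[leLHS]add0r lerD ?sumr_ge0 //.
  by apply: ler_sum => t _; rewrite addnC.
move: uvm au ub av vb yim; rewrite neq_lt => /orP[lt|lt].
  rewrite (min_idPl (ltW lt)) (max_idPr (ltW lt)) => au ub av vb yim; split => //.
    split=> // t; rewrite -!iterD; exact: fr.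
  by exists B => n; apply: le_trans (HB' n); apply: ler_sum => t _; rewrite !iterD.
rewrite (min_idPr (ltW lt)) (max_idPl (ltW lt)) => au ub av vb yim; split => //.
  by split=> // t; rewrite -!iterD minC maxC; exact: fr.
by exists B => n; apply: le_trans (HB' n); apply: ler_sum => t _; rewrite !iterD distrC.
Qed.

(** At each time the added piece is at most as long as the image of [[u, v]], so the sum of the
    lengths at most doubles. The new interval has length below [2 * d <= 1] and contains a point of
    [[a - 1, b + 1]], hence stays in [[a - 2, b + 2]]. *)
Let good_extend i u v d : 0 < d -> d <= 2^-1 -> C * d <= r / 2 ->
  (forall j, (i <= j)%N -> forall u v, good j u v -> v - u < d) ->
  good i u v -> good i u (v + ext_ratio V * (v - u)).
Proof.
move=> d0 d2 Cd small g; have [h u2 v2 yi [B HB]] := g; have [uv fr] := h.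
pose l t := `|iter t F u - iter t F v|.
have ld t : l t < d.
  have := small (i + t)%N (leq_addr _ _) _ _ (good_iter t g).
  rewrite /l; case/orP: (le_total (iter t F u) (iter t F v)) => le.
    by rewrite (min_idPl le) (max_idPr le) distrC ger0_norm ?subr_ge0.
  by rewrite (min_idPr le) (max_idPl le) ger0_norm ?subr_ge0.
have dr : d <= r / 2 by apply: le_trans Cd; rewrite ler_peMl ?(dm_C DM) ?ltW.
have r20 : 0 < r / 2 by rewrite divr_gt0.
have vv : u <= v <= v by rewrite lexx ltW.
have close t : `|iter t F v - iter (i + t) F y1| < d.
  apply: le_lt_trans (ld t); rewrite addnC iterD; exact: homterval_dist.
have fr2 t : turn_free T (iter t F v - r / 2) (iter t F v + r / 2).
  apply: (turn_free_sub (@fr1 (i + t)%N)); have := close t; rewrite ltr_distl => /andP[]; lra.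
have Cl t : C * l t < r / 2.
  by apply: lt_le_trans Cd; rewrite ltr_pM2l.
have l_small : forall x, 0 < x -> exists N, forall m, (N <= m)%N -> l m < x.
  by apply: (summable_small _ HB) => m; rewrite normr_ge0.
have nasymu : ~ cycle_asymptotic F u.
  move=> asu; apply: nasym; apply: (@asymptotic_iter _ _ i).
  apply: asymptotic_close asu => e /l_small[N HN]; exists N => m /HN; apply: le_lt_trans.
  by apply: homterval_dist => //; rewrite lexx ltW.
have coX t y : - l t <= co (germ F v false t) (iter t F v) y <= 0 ->
    Num.min (iter t F u) (iter t F v) <= y <= Num.max (iter t F u) (iter t F v).
  have := co_du DM uv r20 fr2 Cl t; rewrite /l /co.
  case: (germ F v false t) => E /andP[h1 h2]; rewrite ge_min le_max.
    by apply/andP; split; apply/orP; [right|left]; lra.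
  by apply/andP; split; apply/orP; [left|right]; lra.
have disj (t t' : nat) y : t != t' ->
    ~ (- l t <= co (germ F v false t) (iter t F v) y <= 0 /\
       - l t' <= co (germ F v false t') (iter t' F v) y <= 0).
  move=> tt [/coX/andP[A1 A2] /coX/andP[A3 A4]].
  have := good_iter t g; have := good_iter t' g; move: tt.
  wlog lt : t t' A1 A2 A3 A4 / (t < t')%N.
    move=> H tt g1 g2; move: (tt); rewrite neq_ltn => /orP[lt|lt].
      exact: (H t t').
    by apply: (H t' t) => //; rewrite eq_sym.
  move=> _ g1 g2; have [] := good_disj _ g2 g1; first by rewrite ltn_add2l.
    by move: A2 A3; lra.
  by move: A1 A4; lra.
have ext := extend DM uv r20 fr2 Cl disj nasymu l_small.
set v' := v + _; have l0 : l 0%N = v - u by rewrite /l /= distrC gtr0_norm // subr_gt0.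
have v'E : v' = v + ext_ratio V * l 0%N by rewrite l0.
have /andP[vv' v'l] := ext 0%N; rewrite /= /co in vv' v'l.
have ext' t : Num.min (iter t F u) (iter t F v') >= iter t F v - l t /\
    Num.max (iter t F u) (iter t F v') <= iter t F v + l t.
  have /andP[h1 h2] := ext t; have := co_du DM uv r20 fr2 Cl t.
  move: h1 h2; rewrite -v'E /co; have : 0 <= l t := normr_ge0 _; rewrite -/(l t).
  case: (germ F v false t) => p h1 h2 E; split; rewrite ?le_min ?ge_max; between.
have ld0 := ld 0%N.
have /andP[b1 b2] : a - 1 <= iter i F y1 <= b + 1 by apply: (iter_box DM).
have /andP[yi1 yi2] := yi; rewrite -v'E in vv' v'l.
have {}v'l : v' - v <= v - u by rewrite -l0.
rewrite l0 in ld0; split => //.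
- split; first by lra.
  move=> t; have [e1 e2] := ext' t; have := ld t => ldt.
  by apply: (turn_free_sub (@fr2 t)); move: dr ldt; lra.
- by lra.
- by between.
- exists (B + B) => n; apply: le_trans (lerD (HB n) (HB n)); rewrite -big_split /=.
  apply: ler_sum => t _; have [e1 e2] := ext' t; rewrite -/(l t).
  have := e1; rewrite le_min => /andP[? ?]; have := e2; rewrite ge_max => /andP[? ?].
  by rewrite ler_norml; between.
Qed.

(** By [good_small] all admissible intervals at some time [N] are shorter than [d], but each
    extension at that time adds at least [ext_ratio V * (v - u)]. *)
Lemma wandering_absurd : False.
Proof.
pose d := Num.min 2^-1 (r / 2 / C).
have d0 : 0 < d by rewrite lt_min invr_gt0 ltr0n !divr_gt0.
have d2 : d <= 2^-1 by rewrite ge_min lexx.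
have Cd : C * d <= r / 2 by rewrite mulrC -ler_pdivlMr // ge_min lexx orbT.
have [N small] := good_small d0.
have g12 : good 0 y1 y2.
  have [y12 fr12] := hom12; have /andP[? ?] := box1; have /andP[? ?] := box2.
  split => //=; [lra|lra|by rewrite lexx ltW|by exists B0].
have [u [v guv]] : exists u v, good N u v.
  by have := good_iter N g12; rewrite add0n => ?; do 2 eexists; eassumption.
have [[uv _] _ _ _ _] := guv.
have k0 : 0 < ext_ratio V * (v - u) by rewrite mulr_gt0 ?subr_gt0 // ext_ratio_gt0.
have [k] : exists k : nat, d / (ext_ratio V * (v - u)) < k%:R.
  by exists (Num.bound (d / (ext_ratio V * (v - u)))); exact: archi_boundP (ltW (divr_gt0 d0 k0)).
rewrite ltr_pdivrMr // => kd.
have : forall n : nat, exists2 v', good N u v' &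
    (v - u) + n%:R * (ext_ratio V * (v - u)) <= v' - u.
  elim=> [|n [v' g' H]]; first by exists v; rewrite // mul0r addr0.
  exists (v' + ext_ratio V * (v' - u)); first exact: (good_extend d0 d2 Cd small g').
  have : ext_ratio V * (v - u) <= ext_ratio V * (v' - u).
    rewrite ler_pM2l ?ext_ratio_gt0 //; apply: le_trans H.
    by rewrite lerDl mulr_ge0 // ltW.
  by rewrite -natr1 mulrDl mul1r; lra.
move=> /(_ k)[v' /(small N (leqnn N)) lt le].
by move: kd lt le uv; set K := _ * (_ * _); lra.
Qed.

End Wandering.

Lemma homterval_asymptotic y1 y2 r B : homterval y1 y2 -> 0 < r ->
  (forall t, turn_free T (iter t F y1 - r) (iter t F y1 + r)) ->
  (forall n, \sum_(t < n) `|iter t F y1 - iter t F y2| <= B) ->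
  a - 1 <= y1 <= b + 1 -> a - 1 <= y2 <= b + 1 ->
  cycle_asymptotic F y1.
Proof.
move=> h r0 fr sum box1 box2; apply: contrapT => na.
exact: (wandering_absurd h r0 fr sum box1 box2 na).
Qed.

End Homtervals.

(** * Expansion and tubes of bounded distortion *)

(** A substitute for |DF^n(x)| >= K that makes sense where F^n has no derivative and that multiplies
    along an orbit, see [expands_comp]. Points outside [[a, b]] are disregarded, since only there
    does the extension differ from the given map. *)
Definition expands {R : realType} (a b : R) (F : R -> R) n x K := exists2 r, 0 < r &
  forall y z, a <= y <= b -> a <= z <= b -> `|y - x| < r -> `|z - x| < r ->
    K * `|y - z| <= `|iter n F y - iter n F z|.

Section Expansion.
Context {R : realType} (a b : R) (F : R -> R) (T : set R) (C V : R) (Phi : R -> R).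
Context (DM : denjoy_map a b F T C V Phi).
Implicit Types (x y z K r p q e Om : R) (lo hi : nat -> R).

Let C0 : 0 < C := lt_le_trans ltr01 (dm_C DM).

Lemma expands_le n x K K' : K' <= K -> expands a b F n x K -> expands a b F n x K'.
Proof.
move=> KK [r r0 H]; exists r => // y z ya za yx zx.
by apply: le_trans (H y z ya za yx zx); rewrite ler_wpM2r.
Qed.

Lemma expands_nonpos n x K : K <= 0 -> expands a b F n x K.
Proof.
move=> K0; exists 1 => // y z _ _ _ _; apply: (@le_trans _ _ 0) => //.
by rewrite mulr_le0_ge0.
Qed.

Lemma expands_comp k l x K K' : 0 <= K' -> expands a b F k x K ->
  expands a b F l (iter k F x) K' -> expands a b F (k + l) x (K * K').
Proof.
move=> K'0 [r r0 H] [r' r'0 H']; have [d d0 Hd] := iter_near DM k x r'0.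
exists (Num.min r d); first by rewrite lt_min r0.
move=> y z yab zab; rewrite !lt_min => /andP[yr yd] /andP[zr zd].
rewrite addnC !iterD; apply: (@le_trans _ _ (K' * `|iter k F y - iter k F z|)).
  by rewrite mulrAC mulrC ler_wpM2l // H.
by apply: H'; rewrite ?(iter_itv DM) ?Hd.
Qed.

Lemma expands_orbit n x (k : nat -> R) :
  (forall t, (t < n)%N -> 0 <= k t /\ expands a b F 1 (iter t F x) (k t)) ->
  expands a b F n x (\prod_(t < n) k t).
Proof.
elim: n => [|n IH] H.
  by rewrite big_ord0; exists 1 => // y z _ _ _ _; rewrite mul1r.
rewrite big_ord_recr /= -addn1; have [kn en] := H n (ltnSn n).
by apply: expands_comp => //; apply: IH => t /ltnW; exact: H.
Qed.

Lemma expands_lip x r : 0 < r -> turn_free T (x - r) (x + r) -> expands a b F 1 x C^-1.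
Proof.
move=> r0 fr; exists r => // y z _ _; rewrite !ltr_distl => /andP[? ?] /andP[? ?] /=.
by have /andP[] := lipN DM (y := z) (z := y) fr
  ltac:(between) ltac:(between).
Qed.

Lemma homterval_inj u v y z t : homterval F T u v -> u <= y <= v -> u <= z <= v ->
  y != z -> iter t F y != iter t F z.
Proof.
move=> h uy uz yz; elim: t => // t IH; have [uv fr] := h.
have /andP[+ _] := lipN DM (fr t) (homterval_btw DM t h uz) (homterval_btw DM t h uy).
rewrite !iterS -subr_eq0 -normr_gt0; apply: lt_le_trans.
by rewrite mulr_gt0 ?invr_gt0 // normr_gt0 subr_eq0.
Qed.

Definition tube Om M lo hi := [/\
  forall t, (t < M)%N -> turn_free T (lo t) (hi t),
  forall y t, lo 0%N <= y <= hi 0%N -> (t < M)%N -> lo t <= iter t F y <= hi t,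
  \sum_(t < M) (hi t - lo t) <= Om &
  \sum_(t < M) (Phi (hi t) - Phi (lo t)) <= Om].

Lemma tube_lt Om M lo hi t : tube Om M lo hi -> lo 0%N <= hi 0%N -> (t < M)%N ->
  0 <= hi t - lo t.
Proof.
move=> [_ H _ _] lh tM; have /andP[? ?] := H _ t (introT andP (conj (lexx _) lh)) tM.
lra.
Qed.

Lemma tube_sum Om M lo hi y z n : tube Om M lo hi -> lo 0%N <= hi 0%N ->
  lo 0%N <= y <= hi 0%N -> lo 0%N <= z <= hi 0%N -> (n <= M)%N ->
  \sum_(t < n) `|iter t F y - iter t F z| <= Om.
Proof.
move=> tb lh yJ zJ nM; have [_ H S _] := tb; apply: le_trans S.
rewrite -(subnKC nM) big_split_ord /= -[leLHS]addr0; apply: lerD.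
  apply: ler_sum => t _; have tM := leq_trans (ltn_ord t) nM.
  have := H y t yJ tM; have := H z t zJ tM => /andP[? ?] /andP[? ?].
  by rewrite ler_norml; between.
apply: sumr_ge0 => t _; apply: (tube_lt tb lh).
by rewrite -ltn_subRL.
Qed.

Lemma tube_distort Om M lo hi y z y' z' n : tube Om M lo hi -> lo 0%N <= hi 0%N ->
  (n <= M)%N ->
  lo 0%N <= y <= hi 0%N -> lo 0%N <= z <= hi 0%N ->
  lo 0%N <= y' <= hi 0%N -> lo 0%N <= z' <= hi 0%N ->
  `|iter n F z - iter n F y| * `|z' - y'| <=
  expR Om * `|iter n F z' - iter n F y'| * `|z - y|.
Proof.
move=> tb lh nM yJ zJ y'J z'J; have [fr H _ S] := tb.
have frn t : (t < n)%N -> turn_free T (lo t) (hi t) by move=> tn; apply: fr; exact: leq_trans nM.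
have inn t : (t < n)%N -> [/\ lo t <= iter t F y <= hi t, lo t <= iter t F z <= hi t,
     lo t <= iter t F y' <= hi t & lo t <= iter t F z' <= hi t].
  by move=> tn; have tM := leq_trans tn nM; split; apply: H.
apply: le_trans (tube_dist DM frn inn) _.
rewrite ler_wpM2r // ler_wpM2r // ler_expR; apply: le_trans S.
rewrite -(subnKC nM) big_split_ord /= lerDl; apply: sumr_ge0 => t _.
rewrite subr_ge0; apply: (dm_nd DM); rewrite -subr_ge0; apply: (tube_lt tb lh).
by rewrite -ltn_subRL.
Qed.

(** The midpoints of the first intervals accumulate at some [p]. An interval of length at least [e]
    whose midpoint is within [e / 4] of [p] contains the points [p - e / 4] and [p + e / 4], and
    this occurs for arbitrarily long tubes. *)
Lemma tubes_limit (P : nat -> (nat -> R) -> (nat -> R) -> Prop) e A B : 0 < e ->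
  (forall N, exists M lo hi, [/\ (N <= M)%N, P M lo hi, e <= hi 0%N - lo 0%N,
     A <= lo 0%N & hi 0%N <= B]) ->
  exists y1 y2, y2 = y1 + e / 2 /\ forall N, exists M lo hi,
    [/\ (N <= M)%N, P M lo hi, lo 0%N <= y1, y2 <= hi 0%N & A <= lo 0%N /\ hi 0%N <= B].
Proof.
move=> e0 H.
have /choice[f Hf] : forall N, exists q : nat * (nat -> R) * (nat -> R),
    [/\ (N <= q.1.1)%N, P q.1.1 q.1.2 q.2, e <= q.2 0%N - q.1.2 0%N,
     A <= q.1.2 0%N & q.2 0%N <= B].
  by move=> N; have [M [lo [hi h]]] := H N; exists (M, lo, hi).
pose m N := ((f N).1.2 0%N + (f N).2 0%N) / 2.
have [|p _ clp] := @bounded_cluster R m A B.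
  by move=> N; have [_ _ ? ? ?] := Hf N; rewrite /m; between.
exists (p - e / 4), (p + e / 4); split; first by lra.
move=> N; have [|k Nk pk] := clp (e / 4) N; first by rewrite divr_gt0.
have [kM Pk ek Ak Bk] := Hf k.
exists (f k).1.1, (f k).1.2, (f k).2.
move: pk; rewrite /m ltr_distl => /andP[? ?].
by split => //; [exact: leq_trans kM|lra|lra].
Qed.

Lemma returning_tubes e c Om : 0 < e -> 0 < c -> exists N, forall M lo hi,
  (N <= M)%N -> tube Om M lo hi -> a - 1 <= lo 0%N -> hi 0%N <= b + 1 ->
  c <= `|iter M F (hi 0%N) - iter M F (lo 0%N)| -> hi 0%N - lo 0%N < e.
Proof.
move=> e0 c0; apply: contrapT => nH.
have /(@tubes_limit (fun M lo hi => tube Om M lo hi /\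
    c <= `|iter M F (hi 0%N) - iter M F (lo 0%N)|) e (a - 1) (b + 1) e0) :
    forall N, exists M lo hi, [/\ (N <= M)%N, tube Om M lo hi /\
      c <= `|iter M F (hi 0%N) - iter M F (lo 0%N)|, e <= hi 0%N - lo 0%N,
     a - 1 <= lo 0%N & hi 0%N <= b + 1].
  move=> N; apply: contrapT => nH'; apply: nH; exists N => M lo hi NM tb al hb cM.
  by rewrite ltNge; apply/negP => le; apply: nH'; exists M, lo, hi.
move=> [y1 [y2 [y12 H]]].
have y12' : y1 <= y2 by rewrite y12 lerDl divr_ge0 // ltW.
have sum n : \sum_(t < n) `|iter t F y1 - iter t F y2| <= Om.
  have [M [lo [hi [nM [tb _] l1 l2 _]]]] := H n.
  by apply: (tube_sum tb) => //; [lra|between|between].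
have w0 (m : nat) : 0 <= `|iter m F y1 - iter m F y2| by [].
pose L := b - a + 2; have L0 : 0 < L by have := dm_ab DM; rewrite /L; lra.
(* The least length that bounded distortion allows for the image of [[y1, y2]], if the whole first
   interval, of length at most [L], has an image of length at least [c]. *)
pose x := c * (e / 2) / (expR Om * L).
have x0 : 0 < x by rewrite divr_gt0 ?mulr_gt0 ?expR_gt0 ?divr_gt0.
have [N HN] := summable_small w0 sum x0.
have [M [lo [hi [NM [tb cM] l1 l2 [al hb]]]]] := H N.
have y1J : lo 0%N <= y1 <= hi 0%N by rewrite l1 (le_trans y12').
have y2J : lo 0%N <= y2 <= hi 0%N by rewrite l2 (le_trans l1).
have lh : lo 0%N <= hi 0%N by rewrite (le_trans l1) // (le_trans y12').
have := tube_distort (y := lo 0%N) (z := hi 0%N) tb lh (leqnn M) _ _ y1J y2J.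
rewrite !lexx lh => /(_ isT isT).
have e2 : `|y2 - y1| = e / 2 by rewrite y12 addrAC subrr add0r ger0_norm // divr_ge0 // ltW.
have hL : `|hi 0%N - lo 0%N| <= L by rewrite ger0_norm /L; lra.
rewrite e2 leNgt => /negP; apply.
apply: (@lt_le_trans _ _ (c * (e / 2))); last by rewrite ler_wpM2r // divr_ge0 // ltW.
apply: (@le_lt_trans _ _ (expR Om * `|iter M F y2 - iter M F y1| * L)).
  by rewrite ler_wpM2l // mulr_ge0 // ltW // expR_gt0.
rewrite mulrAC -ltr_pdivlMl ?mulr_gt0 ?expR_gt0 // mulrC distrC.
exact: HN.
Qed.

(** * Long tubes along orbits that accumulate only on repelling cycles *)

Section Shrink.
Context (Y : set R) (r0 : R) (r0_gt0 : 0 < r0).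
Context (Yab : forall x, Y x -> a <= x <= b).
Context (Yfree : forall x, Y x -> turn_free T (x - r0) (x + r0)).
Context (Yrep : forall p k, (0 < k)%N -> a <= p <= b -> iter k F p = p ->
  (forall i e, 0 < e -> exists2 y, Y y & `|y - iter i F p| < e) ->
  exists2 K, 1 < K & expands a b F k p K).

Lemma shrink e Om : 0 < e -> exists N, forall M lo hi x,
  (N <= M)%N -> tube Om M lo hi ->
  (forall t, (t < M)%N -> [/\ Y (iter t F x), lo t <= iter t F x <= hi t,
     hi t - lo t <= r0 / 2 & hi t - lo t <= 1]) ->
  hi 0%N - lo 0%N < e.
Proof.
move=> e0; apply: contrapT => nH.
pose P M lo hi := tube Om M lo hi /\ exists x, (0 < M)%N /\
  forall t, (t < M)%N -> [/\ Y (iter t F x), lo t <= iter t F x <= hi t,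
     hi t - lo t <= r0 / 2 & hi t - lo t <= 1].
have : forall N, exists M lo hi, [/\ (N <= M)%N, P M lo hi, e <= hi 0%N - lo 0%N,
     a - 1 <= lo 0%N & hi 0%N <= b + 1].
  move=> N; apply: contrapT => nH'; apply: nH; exists N.+1 => M lo hi x NM tb xP.
  rewrite ltNge; apply/negP => le; apply: nH'; exists M, lo, hi.
  have M0 : (0 < M)%N by exact: leq_trans NM.
  have [/Yab/andP[/= ? ?] /andP[/= ? ?] _ ?] := xP _ M0.
  by split => //; [exact: ltnW|split => //; exists x|lra|lra].
move=> /(tubes_limit e0) [y1 [y2 [y12 H]]] {nH}.
have e20 : 0 < e / 2 by rewrite divr_gt0.
have y12' : y1 < y2 by rewrite y12 ltrDl.
have I1 lo hi : lo 0%N <= y1 -> y2 <= hi 0%N -> lo 0%N <= y1 <= hi 0%N.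
  by move=> ? ?; between.
have I2 lo hi : lo 0%N <= y1 -> y2 <= hi 0%N -> lo 0%N <= y2 <= hi 0%N.
  by move=> ? ?; between.
have lh lo hi : lo 0%N <= y1 -> y2 <= hi 0%N -> lo 0%N <= hi 0%N by move=> ? ?; lra.
have hom : homterval F T y1 y2.
  split=> // t; have [M [lo [hi [tM [tb _] l1 l2 _]]]] := H t.+1.
  have [fr inJ _ _] := tb; apply: (turn_free_sub (fr t tM)).
    by rewrite le_min; have /andP[-> _] := inJ _ t (I1 _ _ l1 l2) tM;
       have /andP[-> _] := inJ _ t (I2 _ _ l1 l2) tM.
  by rewrite ge_max; have /andP[_ ->] := inJ _ t (I1 _ _ l1 l2) tM;
     have /andP[_ ->] := inJ _ t (I2 _ _ l1 l2) tM.
have sum n : \sum_(t < n) `|iter t F y1 - iter t F y2| <= Om.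
  have [M [lo [hi [nM [tb _] l1 l2 _]]]] := H n.
  exact: (tube_sum tb (lh _ _ l1 l2) (I1 _ _ l1 l2) (I2 _ _ l1 l2)).
have fr2 t : turn_free T (iter t F y1 - r0 / 2) (iter t F y1 + r0 / 2).
  have [M [lo [hi [tM [tb [x [_ xP]]] l1 l2 _]]]] := H t.+1.
  have [fr inJ _ _] := tb; have [/Yfree Yt /andP[? ?] ? _] := xP t tM.
  by have /andP[? ?] := inJ _ t (I1 _ _ l1 l2) tM; apply: (turn_free_sub Yt); lra.
have w0 (m : nat) : 0 <= `|iter m F y1 - iter m F y2| by [].
have w_small := summable_small w0 sum.
have [M0 [lo0 [hi0 [_ _ ? ? [? ?]]]]] := H 0%N.
have r02 : 0 < r0 / 2 by rewrite divr_gt0.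
have := homterval_asymptotic DM hom r02 fr2 sum _ _.
case; [by between|by between|].
move=> i [k [p [k0 py]]].
have pk := asymptotic_fix DM py.
pose K := expR Om / (e / 2).
have K0 : 0 < K by rewrite divr_gt0 // expR_gt0.
(* Distortion compares the distance of the followed orbit from that of [y1] with the image of
   [[y1, y2]]; the initial distance is at most 1 and the initial length is [e / 2], whence [K]. *)
have xclose t M lo hi x : (t < M)%N -> tube Om M lo hi -> lo 0%N <= y1 -> y2 <= hi 0%N ->
    (forall t, (t < M)%N -> [/\ Y (iter t F x), lo t <= iter t F x <= hi t,
     hi t - lo t <= r0 / 2 & hi t - lo t <= 1]) ->
    `|iter t F x - iter t F y1| <= K * `|iter t F y1 - iter t F y2|.
  move=> tM tb l1 l2 xP.
  have [_ x0J _ h1] := xP 0%N (leq_ltn_trans (leq0n t) tM).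
  have := tube_distort tb (lh _ _ l1 l2) (ltnW tM) (I1 _ _ l1 l2) x0J
    (I1 _ _ l1 l2) (I2 _ _ l1 l2).
  have -> : `|y2 - y1| = e / 2 by rewrite y12 addrAC subrr add0r gtr0_norm.
  rewrite -ler_pdivlMr // => /le_trans; apply.
  rewrite /K [leRHS]mulrAC ler_pM2r ?invr_gt0 // distrC -[leRHS]mulr1 ler_wpM2l //.
  by move: x0J => /andP[/= ? ?]; rewrite ler_norml; between.
(* The followed orbits lie in [Y] and come arbitrarily close to that of [y1], so the whole cycle is
   in the closure of [Y], as [Yrep] asks. *)
have pY j d : 0 < d -> exists2 y, Y y & `|y - iter j F p| < d.
  move=> d0; have d20 : 0 < d / 2 by rewrite divr_gt0.
  have [d' d'0 Hd'] := iter_near DM j p d20.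
  have [N HN] := py _ d'0.
  have [N' HN'] := w_small (d / 2 / K) (divr_gt0 d20 K0).
  pose m := maxn N N'; pose t := (j + (i + k * m))%N.
  have [M [lo [hi [tM [tb [x [_ xP]]] l1 l2 _]]]] := H t.+1.
  exists (iter t F x); first by have [] := xP t tM.
  have h1 : `|iter t F y1 - iter j F p| < d / 2.
    by rewrite /t iterD; apply/Hd'/HN; exact: leq_maxl.
  have h2 : K * `|iter t F y1 - iter t F y2| < d / 2.
    rewrite mulrC -ltr_pdivlMr //; apply: HN'; rewrite /t.
    apply: (leq_trans (leq_maxr N N')); rewrite -/m.
    by apply: (leq_trans (leq_pmull m k0)); rewrite addnA leq_addl.
  have := xclose t M lo hi x tM tb l1 l2 xP.
  by move=> /le_lt_trans/(_ h2) h3; exact: dist_lt_half h3 h1.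
have pab : a <= p <= b.
  apply/andP; split; rewrite leNgt; apply/negP => lt.
    have [|y /Yab/andP[? ?]] := pY 0%N (a - p); first by rewrite subr_gt0.
    by rewrite /= ltr_distl => /andP[? ?]; lra.
  have [|y /Yab/andP[? ?]] := pY 0%N (p - b); first by rewrite subr_gt0.
  by rewrite /= ltr_distl => /andP[? ?]; lra.
have [L L1 [r r_gt0 rep]] := Yrep k0 pab pk pY.
(* Expansion at [p] is known inside [[a, b]] only. If no image of [[y1, y2]] met [[a, b]] in two
   points, every step would be isometric and the lengths could not tend to zero. *)
have [l [z [z' [zz /andP[z1 z2] /andP[z1' z2'] zI zI']]]] : exists l z z', [/\ z != z',
    y1 <= z <= y2, y1 <= z' <= y2, a <= iter l F z <= b & a <= iter l F z' <= b].
  apply: contrapT => nz.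
  have wE t : `|iter t F y1 - iter t F y2| = `|y1 - y2|.
    elim: t => // t IH; rewrite !iterS.
    have [/andP[la1 la2]|la] := boolP ((iter t F y1 <= a) && (iter t F y2 <= a)).
      by rewrite (dm_left DM).
    have [/andP[lb1 lb2]|lb] := boolP ((b <= iter t F y1) && (b <= iter t F y2)).
      by rewrite (dm_right DM).
    case: nz; exists t.
    pose q := Num.max a (Num.min (iter t F y1) (iter t F y2)).
    pose q' := Num.min b (Num.max (iter t F y1) (iter t F y2)).
    have ab := dm_ab DM.
    have ne := homterval_inj t hom (introT andP (conj (lexx _) (ltW y12')))
      (introT andP (conj (ltW y12') (lexx _))) (negbT (lt_eqF y12')).
    have qq : q < q'.
      rewrite /q /q' lt_min !gt_max ab /=.
      rewrite gt_min lt_max; move: la lb; rewrite !negb_and -!ltNge => -> ->.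
      rewrite /=; move: ne; rewrite neq_lt => /orP[lt|lt].
        by rewrite (min_idPl (ltW lt)) (max_idPr (ltW lt)).
      by rewrite (min_idPr (ltW lt)) (max_idPl (ltW lt)).
    have onto x : Num.min (iter t F y1) (iter t F y2) <= x <=
        Num.max (iter t F y1) (iter t F y2) -> exists2 z, y1 <= z <= y2 & iter t F z = x.
      move=> xm; have [|z] := @IVT _ (iter t F) y1 y2 x (ltW y12') _ xm.
        exact/continuous_subspaceT/(iter_cont DM).
      by rewrite in_itv /=; exists z.
    have qa : a <= q by rewrite le_max lexx.
    have qb : q' <= b by rewrite ge_min lexx.
    have q1 : Num.min (iter t F y1) (iter t F y2) <= q by rewrite le_max lexx orbT.
    have q2 : q' <= Num.max (iter t F y1) (iter t F y2) by rewrite ge_min lexx orbT.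
    have [|z zy zq] := onto q; first by rewrite q1 (le_trans (ltW qq) q2).
    have [|z' zy' zq'] := onto q'; first by rewrite q2 (le_trans q1 (ltW qq)).
    have zz : z != z' by apply: contraTneq qq => zE; rewrite -zq -zq' zE ltxx.
    exists z, z'; split; [exact: zz|exact: zy|exact: zy'| |].
      by rewrite zq qa (le_trans (ltW qq) qb).
    by rewrite zq' qb (le_trans qa (ltW qq)).
  have [|N HN] := w_small `|y1 - y2|; first by rewrite normr_gt0 subr_eq0 lt_eqF.
  by have := HN N (leqnn N); rewrite wE ltxx.
have lab x m : a <= iter l F x <= b -> (l <= m)%N -> a <= iter m F x <= b.
  by move=> xI lm; rewrite -(subnK lm) iterD (iter_itv DM).
have zclose x : y1 <= x <= y2 -> tends (fun m => iter (i + k * m) F x) p.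
  move=> xJ d d0; have d20 : 0 < d / 2 by rewrite divr_gt0.
  have [N HN] := py _ d20; have [N' HN'] := w_small _ d20.
  exists (maxn N N') => m; rewrite geq_max => /andP[/HN Nm N'm].
  have im : (N' <= i + k * m)%N.
    by apply: (leq_trans N'm); apply: (leq_trans (leq_pmull m k0)); rewrite leq_addl.
  have h := le_lt_trans (homterval_dist DM (i + k * m) hom xJ
    (introT andP (conj (lexx _) (ltW y12')))) (HN' _ im).
  exact: dist_lt_half h Nm.
have zJ : y1 <= z <= y2 by rewrite z1.
have zJ' : y1 <= z' <= y2 by rewrite z1'.
have [N HN] := zclose z zJ r r_gt0; have [N' HN'] := zclose z' zJ' r r_gt0.
pose m0 := maxn l (maxn N N').
(* Near the repelling point these distances do not decrease, although both orbits converge to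
   [p]. *)
pose g m := `|iter (i + k * (m0 + m)) F z - iter (i + k * (m0 + m)) F z'|.
have gS m : g m <= g m.+1.
  have lm : (l <= i + k * (m0 + m))%N.
    apply: (leq_trans (leq_maxl l (maxn N N'))); rewrite -/m0.
    apply: (leq_trans (leq_addr m _)); apply: (leq_trans (leq_pmull _ k0)).
    by rewrite leq_addl.
  have := rep (iter (i + k * (m0 + m)) F z) (iter (i + k * (m0 + m)) F z')
    (lab _ _ zI lm) (lab _ _ zI' lm) (HN _ _) (HN' _ _).
  rewrite -!iterD (_ : k + _ = i + k * (m0 + m.+1))%N; last by rewrite addnS mulnS addnCA.
  have Nm0 : (N <= m0 + m)%N.
    by apply: (leq_trans _ (leq_addr m m0)); rewrite /m0 !leq_max leqnn !orbT.
  have Nm0' : (N' <= m0 + m)%N.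
    by apply: (leq_trans _ (leq_addr m m0)); rewrite /m0 !leq_max leqnn !orbT.
  by move=> /(_ Nm0 Nm0'); apply: le_trans; rewrite /g ler_peMl // ltW.
have g0 m : g 0%N <= g m by elim: m => // m IH; exact: le_trans (gS m).
have gp : 0 < g 0%N by rewrite normr_gt0 subr_eq0 (homterval_inj _ hom).
have gp2 : 0 < g 0%N / 2 by rewrite divr_gt0.
have [N1 HN1] := zclose z zJ _ gp2; have [N2 HN2] := zclose z' zJ' _ gp2.
have := g0 (maxn N1 N2); rewrite leNgt => /negP; apply.
have := HN1 (m0 + maxn N1 N2)%N _; have := HN2 (m0 + maxn N1 N2)%N _.
have h1 : (N1 <= m0 + maxn N1 N2)%N by rewrite (leq_trans (leq_maxl N1 N2)) // leq_addl.
have h2 : (N2 <= m0 + maxn N1 N2)%N by rewrite (leq_trans (leq_maxr N1 N2)) // leq_addl.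
by move=> /(_ h2); rewrite distrC => z'p /(_ h1) zp; exact: dist_lt_half zp z'p.
Qed.

End Shrink.
End Expansion.

(** * Chains of gaps *)

Section Germs.
Context {R : realType} (F : R -> R).
Implicit Types (x y h r : R) (s : bool).

Lemma germ_addb x s t : germ F x s t = s (+) germ F x false t.
Proof. by elim: t => [|t IH] /=; rewrite ?addbF // IH addbA. Qed.

Lemma germ_shift x s k t : germ F x s (k + t) = germ F (iter k F x) (germ F x s k) t.
Proof.
elim: t => [|t IH]; first by rewrite addn0.
by rewrite addnS /= IH -iterD addnC.
Qed.

Definition jlo x s h : R := if s then x - h else x.
Definition jhi x s h : R := if s then x else x + h.

Lemma jlo_hi x s h : jhi x s h - jlo x s h = h.
Proof. by rewrite /jlo /jhi; case: s; lra. Qed.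

Lemma j_co x s h y : (jlo x s h <= y <= jhi x s h) = (0 <= co s x y <= h).
Proof.
by rewrite /jlo /jhi /co; case: s; apply/andP/andP => -[? ?]; split; lra.
Qed.

Lemma co_eq0 s x y : co s x y = 0 -> y = x.
Proof. by rewrite /co; case: s; lra. Qed.

Lemma j_sub x s h r : 0 <= h -> h <= r -> x - r <= jlo x s h /\ jhi x s h <= x + r.
Proof. by rewrite /jlo /jhi; case: s => ? ?; split; lra. Qed.

End Germs.

Section Chain.
Context {R : realType} (a b : R) (F : R -> R) (T : set R) (C V : R) (Phi : R -> R).
Context (DM : denjoy_map a b F T C V Phi).
Context (x : R) (s0 : bool) (g w : nat -> R) (M : nat) (r Om : R).

Let e t := iter t F x.
Let s t := germ F x s0 t.
Let q t : R := psi F (e t) (s t) (g t) / g t.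

Context (r0 : 0 < r) (g0 : forall t, (t <= M)%N -> 0 < g t <= r).
Context (fr : forall t, (t < M)%N -> turn_free T (e t - r) (e t + r)).
Context (gw : forall t, (t < M)%N -> g t <= w t).
Context (Pw : forall t, (t < M)%N ->
  Phi (jhi (e t) (s t) (g t)) - Phi (jlo (e t) (s t) (g t)) <= w t).
Context (step : forall t, (t < M)%N -> expR (- w t) * g t.+1 <= psi F (e t) (s t) (g t)).
Context (sumw : \sum_(t < M) w t <= Om).

Let gp t : (t <= M)%N -> 0 < g t. Proof. by case/g0/andP. Qed.
Let gr t : (t <= M)%N -> g t <= r. Proof. by case/g0/andP. Qed.

Let qg t : (t < M)%N -> q t * g t = psi F (e t) (s t) (g t).
Proof. by move=> /ltnW tM; rewrite /q divfK // gt_eqF // gp. Qed.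

Let q0 t : (t < M)%N -> 0 <= q t.
Proof. by move=> tM; apply: divr_ge0; [exact: normr_ge0|exact/ltW/gp/ltnW]. Qed.

Lemma chain_telescope : expR (- Om) * g M <= (\prod_(t < M) q t) * g 0%N.
Proof.
have H : forall n, (n <= M)%N ->
    expR (- (\sum_(t < n) w t)) * g n <= (\prod_(t < n) q t) * g 0%N.
  elim=> [|n IH] nM; first by rewrite !big_ord0 oppr0 expR0.
  rewrite !big_ord_recr /= opprD expRD.
  rewrite -mulrA; apply: (@le_trans _ _ (expR (- \sum_(t < n) w t) * (q n * g n))).
    by rewrite ler_wpM2l ?(ltW (expR_gt0 _)) // qg // step.
  rewrite mulrCA [leRHS]mulrAC [leRHS]mulrC ler_wpM2l ?q0 //.
  by rewrite IH // ltnW.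
apply: le_trans (H M (leqnn M)); rewrite ler_wpM2r ?(ltW (gp _)) //.
by rewrite ler_expR lerN2.
Qed.

(** [Om] occurs twice: once for the losses in [step], once for the distortion between a gap [g t]
    and its pulled back part [h t]. The third bound turns a short [h 0] into large slopes; the
    fourth is the returning length for [returning_tubes]. *)
Lemma chain_pull : exists h, [/\
  forall t, (t <= M)%N -> 0 < h t <= g t,
  tube F T Phi Om M (fun t => jlo (e t) (s t) (h t)) (fun t => jhi (e t) (s t) (h t)),
  expR (- (Om + Om)) * g M <= (\prod_(t < M) q t) * h 0%N &
  expR (- (Om + Om)) * g M <= `|iter M F (pt x s0 (h 0%N)) - iter M F x| ].
Proof.
have [h [hM h0 hg hd]] := pullback DM e s (gp (leqnn M)) (fun t tM => gp (ltnW tM)).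
have hgM t : (t <= M)%N -> h t <= g t.
  rewrite leq_eqVlt => /predU1P[->|/hg[]//]; by rewrite hM.
have hr t : (t < M)%N -> h t <= r.
  by move=> tM; apply: le_trans (gr (ltnW tM)); apply: hgM; exact: ltnW.
(* A truncated step has [h t = g t], so the loss of the gap itself applies; in the other case the
   image fits exactly. *)
have hstep t : (t < M)%N -> expR (- w t) * h t.+1 <= psi F (e t) (s t) (h t).
  move=> tM; have wt0 : 0 <= w t := le_trans (ltW (gp (ltnW tM))) (gw tM).
  have [E|->] := hd t tM; last first.
    by rewrite ler_piMl ?(ltW (h0 _ _)) // -expR0 ler_expR oppr_le0.
  rewrite E; apply: le_trans (step tM).
  by rewrite ler_wpM2l ?(ltW (expR_gt0 _)) // hgM.
have Fco t y : (t < M)%N -> 0 <= co (s t) (e t) y <= h t ->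
    0 <= co (s t.+1) (e t.+1) (F y) <= h t.+1.
  move=> tM /andP[y0 yh]; have [_ ps] := hg t tM.
  have yr := le_trans yh (hr t tM).
  rewrite -[y](pt_co (s t) (e t)) (F_pt DM _ y0 yr r0 (fr tM)).
  rewrite -[_ (+) _]/(s t.+1) -[F (e t)]/(e t.+1) co_pt normr_ge0 /=.
  apply: le_trans ps; move: yh; rewrite le_eqVlt => /predU1P[->//|yh].
  by apply/ltW; apply: (psi_lt DM _ y0 yh (hr t tM) (fr tM)).
have Fiter y t : 0 <= co s0 x y <= h 0%N -> (t <= M)%N ->
    0 <= co (s t) (e t) (iter t F y) <= h t.
  move=> yJ; elim: t => // t IH tM; rewrite iterS; apply: Fco => //.
  by apply: IH; exact: ltnW.
have dist t y : (t < M)%N -> 0 <= co (s t) (e t) y <= h t ->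
    psi F (e t) (s t) (h t) * co (s t) (e t) y <=
      expR (w t) * `|F y - F (e t)| * h t.
  move=> tM /andP[y0 yh].
  have := Pw tM; set lo := jlo _ _ _; set hi := jhi _ _ _ => Pt.
  have frt : turn_free T lo hi.
    have [l1 l2] := j_sub (e t) (s t) (ltW (gp (ltnW tM))) (gr (ltnW tM)).
    exact: (turn_free_sub (fr tM)).
  have gt0 := ltW (gp (ltnW tM)); have ht := hgM t (ltnW tM).
  have inJ k : 0 <= k <= g t -> lo <= pt (e t) (s t) k <= hi by rewrite j_co co_pt.
  have := distN DM frt (y := e t) (z := pt (e t) (s t) (h t)) (y' := e t) (z' := y).
  have -> : lo <= e t <= hi by rewrite j_co coxx lexx.
  have -> : lo <= y <= hi by rewrite j_co y0 (le_trans yh).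
  rewrite inJ ?(ltW (h0 _ (ltnW tM))) // -/(psi _ _ _ _) => /(_ isT isT isT isT).
  rewrite -(co_normE y0) dist_pt ?(ltW (h0 _ (ltnW tM))) //.
  move/le_trans; apply; rewrite ler_wpM2r ?(ltW (h0 _ (ltnW tM))) //.
  by rewrite ler_wpM2r // ler_expR.
have qh t : (t < M)%N -> expR (- (w t + w t)) * h t.+1 <= q t * h t.
  move=> tM; have htp := h0 t (ltnW tM); have gtp := gp (ltnW tM).
  have := Pw tM; set lo := jlo _ _ _; set hi := jhi _ _ _ => Pt.
  have frt : turn_free T lo hi.
    have [l1 l2] := j_sub (e t) (s t) (ltW (gp (ltnW tM))) (gr (ltnW tM)).
    exact: (turn_free_sub (fr tM)).
  have inJ k : 0 <= k <= g t -> lo <= pt (e t) (s t) k <= hi by rewrite j_co co_pt.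
  have := distN DM frt (y := e t) (z := pt (e t) (s t) (h t)) (y' := e t)
    (z' := pt (e t) (s t) (g t)).
  have -> : lo <= e t <= hi by rewrite j_co coxx lexx ltW.
  rewrite !inJ ?(ltW htp) ?(ltW gtp) ?lexx ?hgM ?(ltnW tM) // -!/(psi _ _ _ _).
  move=> /(_ isT isT isT isT); rewrite !dist_pt ?(ltW htp) ?(ltW gtp) // => D.
  rewrite opprD expRD -mulrA; apply: (@le_trans _ _ (expR (- w t) * psi F (e t) (s t) (h t))).
    by rewrite ler_wpM2l ?(ltW (expR_gt0 _)) // hstep.
  rewrite -(ler_pM2r gtp) [leRHS]mulrAC qg // -[leLHS]mulrA expRN ler_pdivrMl ?expR_gt0 //.
  rewrite mulrA.
  apply: le_trans D _; apply: ler_wpM2r; first exact: ltW.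
  by apply: ler_wpM2r; [exact: normr_ge0|rewrite ler_expR].
exists h; split.
- by move=> t tM; rewrite h0 // hgM.
- split.
  + move=> t tM; have [l1 l2] := j_sub (e t) (s t) (ltW (h0 t (ltnW tM))) (hr t tM).
    exact: (turn_free_sub (fr tM)).
  + by move=> y t; rewrite !j_co => yJ tM; apply: Fiter => //; exact: ltnW.
  + under eq_bigr do rewrite jlo_hi; apply: le_trans sumw.
    by apply: ler_sum => t _; apply: le_trans (gw (ltn_ord t)); apply/hgM/ltnW.
  + apply: le_trans sumw; apply: ler_sum => t _; apply: le_trans (Pw (ltn_ord t)).
    have ht := hgM t (ltnW (ltn_ord t)).
    by apply: lerB; apply: (dm_nd DM); rewrite /jlo /jhi; case: (s t); lra.
- have H : forall n, (n <= M)%N ->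
      expR (- (\sum_(t < n) w t + \sum_(t < n) w t)) * h n <= (\prod_(t < n) q t) * h 0%N.
    elim=> [|n IH] nM; first by rewrite !big_ord0 addr0 oppr0 expR0.
    rewrite !big_ord_recr /= [X in - X](_ : _ =
      (\sum_(t < n) w t + \sum_(t < n) w t) + (w n + w n)); last by ring.
    rewrite opprD expRD -mulrA.
    apply: (@le_trans _ _ (expR (- (\sum_(t < n) w t + \sum_(t < n) w t)) * (q n * h n))).
      by rewrite ler_wpM2l ?(ltW (expR_gt0 _)) // qh.
    rewrite mulrCA [leRHS]mulrAC [leRHS]mulrC ler_wpM2l ?q0 //.
    by rewrite IH // ltnW.
  rewrite -hM; apply: le_trans (H M (leqnn M)); rewrite ler_wpM2r ?(ltW (h0 _ _)) //.
  by rewrite ler_expR lerN2 lerD.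
- pose z := pt x s0 (h 0%N).
  have zJ : 0 <= co s0 x z <= h 0%N by rewrite co_pt (ltW (h0 _ _)) /=.
  pose k t := co (s t) (e t) (iter t F z).
  have kE t : (t <= M)%N -> k t = `|iter t F z - e t|.
    by move=> tM; apply: co_normE; have /andP[] := Fiter z t zJ tM.
  have H : forall n, (n <= M)%N ->
      expR (- (\sum_(t < n) w t + \sum_(t < n) w t)) * h n <= k n.
    elim=> [|n IH] nM.
      by rewrite !big_ord0 addr0 oppr0 expR0 mul1r /k /= co_pt.
    have hnp := h0 n (ltnW nM); have IH' := IH (ltnW nM).
    rewrite (kE _ nM) iterS -[e n.+1]/(F (e n)).
    rewrite !big_ord_recr /= [X in - X](_ : _ =
      (\sum_(t < n) w t + \sum_(t < n) w t) + (w n + w n)); last by ring.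
    rewrite opprD opprD !expRD -(ler_pM2r hnp).
    have D := dist n _ nM (Fiter z n zJ (ltnW nM)); rewrite -/(k n) in D.
    apply: (@le_trans _ _ (expR (- w n) * (psi F (e n) (s n) (h n) * k n))).
      rewrite [leLHS](_ : _ = expR (- w n) * ((expR (- w n) * h n.+1) *
        (expR (- (\sum_(t < n) w t + \sum_(t < n) w t)) * h n))); last by rewrite ?opprD ?expRD; ring.
      apply: ler_wpM2l; first exact/ltW/expR_gt0.
      apply: ler_pM (hstep n nM) IH'; apply: mulr_ge0; rewrite ?(ltW (expR_gt0 _)) //.
        exact/ltW/h0.
      exact: ltW.
    by rewrite expRN ler_pdivrMl ?expR_gt0 // mulrA.
  rewrite -[iter M F x]/(e M) -kE // -hM; apply: le_trans (H M (leqnn M)).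
  apply: ler_wpM2r; first exact/ltW/h0.
  by rewrite ler_expR lerN2 lerD.
Qed.

End Chain.

(** * Gaps of a finite orbit and what they are charged *)

Section Gaps.
Context {R : realType} (a b : R) (F : R -> R) (T : set R) (C V : R) (Phi : R -> R).
Context (DM : denjoy_map a b F T C V Phi).
Context (x : R) (n : nat) (r : R) (r0 : 0 < r) (r1 : r <= 1).
Implicit Types (y z : R) (s : bool).

Let C0 : 0 < C := lt_le_trans ltr01 (dm_C DM).

Lemma ex_gap m s y : exists g, [/\ 0 < g <= r,
  forall i, (i < m)%N -> 0 < co s y (iter i F x) -> g <= co s y (iter i F x) &
  g = r \/ exists2 i, (i < m)%N & g = co s y (iter i F x)].
Proof.
elim: m => [|m [g [/andP[g0 gr] gle gor]]].
  by exists r; rewrite r0 lexx; split=> //; left.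
have [lt|ge] := boolP (0 < co s y (iter m F x) < g); last first.
  exists g; rewrite g0 gr; split=> //.
    move=> i; rewrite ltnS leq_eqVlt => /predU1P[->|/gle//] h.
    by move: ge; rewrite h /= -leNgt.
  by case: gor => [|[i im ->]]; [left|right; exists i => //; exact: ltnW].
have /andP[lt1 lt2] := lt; exists (co s y (iter m F x)); rewrite lt1 /=.
rewrite (le_trans (ltW lt2)) //; split=> //; last by right; exists m.
move=> i; rewrite ltnS leq_eqVlt => /predU1P[->//|im] h.
exact: le_trans (ltW lt2) (gle _ im h).
Qed.

Definition gap s y := projT1 (cid (ex_gap n s y)).

Lemma gapP s y : [/\ 0 < gap s y <= r,
  forall i, (i < n)%N -> 0 < co s y (iter i F x) -> gap s y <= co s y (iter i F x) &
  gap s y = r \/ exists2 i, (i < n)%N & gap s y = co s y (iter i F x)].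
Proof. exact: (projT2 (cid (ex_gap n s y))). Qed.

Lemma gap_gt0 s y : 0 < gap s y. Proof. by have [/andP[]] := gapP s y. Qed.
Lemma gap_le_r s y : gap s y <= r. Proof. by have [/andP[]] := gapP s y. Qed.

(** The factor [expR (- E) = (2 * C)^-1] absorbs the least slope [C^-1] of a gap cut at [r] as well
    as the factor 2 lost at [p]. With [A] as chosen, a gap of length [r] is charged at least [E]. *)
Let E := ln (2 * C).
Let A := 1 + E / r.
Let p := iter n.-1 F x.
Let clip z := Num.min (Num.max z (a - 1)) (b + 1) - (a - 1).

(* Besides the distortion and the length, a gap is charged for being long and for having an
   endpoint at [p]: those are the gaps whose image may fail to cover the next gap. *)
Definition charge z := Phi z + A * clip z + E * ((p <= z)%R%:R + (p < z)%R%:R).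
Definition gap_charge s y :=
  charge (jhi y s (gap s y)) - charge (jlo y s (gap s y)).
Definition point_charge y := gap_charge false y + gap_charge true y.
Definition charge_bound := V + A * (b - a + 2) + E * 2.

Let E0 : 0 < E.
Proof. by apply: ln_gt0; have := dm_C DM; lra. Qed.

Let A1 : 1 <= A. Proof. by rewrite lerDl divr_ge0 // ltW. Qed.
Let A0 : 0 < A. Proof. exact: lt_le_trans A1. Qed.

Let clip_nd : {homo clip : y z / y <= z}.
Proof.
move=> y z yz; apply: lerB => //.
rewrite le_min [X in _ && X]ge_min lexx orbT andbT ge_min ge_max.
by rewrite !le_max yz lexx !orbT.
Qed.

Let step_nd : {homo (fun z => (p <= z)%R%:R + (p < z)%R%:R : R) : y z / y <= z}.
Proof.
move=> y z yz; apply: lerD; rewrite ler_nat.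
  by case: (lerP p y) => // /le_trans/(_ yz) ->.
by case: (ltrP p y) => // /lt_le_trans/(_ yz) ->.
Qed.

Let charge_nd : {homo charge : y z / y <= z}.
Proof.
move=> y z yz; rewrite /charge; apply: lerD; first apply: lerD.
- exact: (dm_nd DM).
- by rewrite ler_pM2l // clip_nd.
- by rewrite ler_pM2l // step_nd.
Qed.

Let ab : a < b. Proof. exact: (dm_ab DM). Qed.

Let charge_bnd z : 0 <= charge z <= charge_bound.
Proof.
have /andP[P0 PV] := dm_bnd DM z.
have c0 : 0 <= clip z.
  by rewrite /clip subr_ge0 le_min le_max lexx orbT /=; move: ab; lra.
have c1 : clip z <= b - a + 2.
  by rewrite /clip lerBlDr ge_min; apply/orP; right; move: ab; lra.
have s0 : 0 <= (p <= z)%R%:R + (p < z)%R%:R :> R by rewrite addr_ge0.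
have s1 : (p <= z)%R%:R + (p < z)%R%:R <= 2 :> R.
  by have := ler01; case: (p <= z); case: (p < z) => /=; lra.
rewrite /charge /charge_bound !addr_ge0 ?mulr_ge0 ?(ltW A0) ?(ltW E0) //=.
by rewrite !lerD // ler_pM2l.
Qed.

Lemma charge_bound_ge0 : 0 <= charge_bound.
Proof. by have /andP[] := charge_bnd 0; exact: le_trans. Qed.

Let jj s y : jlo y s (gap s y) < jhi y s (gap s y).
Proof. by rewrite -subr_gt0 jlo_hi gap_gt0. Qed.

Let jn s y := ltW (jj s y).

Lemma gap_charge_ge0 s y : 0 <= gap_charge s y.
Proof. by rewrite subr_ge0 charge_nd. Qed.

Lemma gap_charge_le s y : gap_charge s y <= point_charge y.
Proof.
by rewrite /point_charge; have := gap_charge_ge0 false y; have := gap_charge_ge0 true y;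
  case: s; lra.
Qed.

Let dE s y : gap_charge s y =
  (Phi (jhi y s (gap s y)) - Phi (jlo y s (gap s y))) +
  A * (clip (jhi y s (gap s y)) - clip (jlo y s (gap s y))) +
  E * (((p <= jhi y s (gap s y))%R%:R + (p < jhi y s (gap s y))%R%:R) -
       ((p <= jlo y s (gap s y))%R%:R + (p < jlo y s (gap s y))%R%:R)).
Proof. by rewrite /gap_charge /charge; ring. Qed.

Let d1 s y : 0 <= Phi (jhi y s (gap s y)) - Phi (jlo y s (gap s y)).
Proof. by rewrite subr_ge0 (dm_nd DM). Qed.
Let d2 s y : 0 <= A * (clip (jhi y s (gap s y)) - clip (jlo y s (gap s y))).
Proof. by rewrite mulr_ge0 ?(ltW A0) // subr_ge0 clip_nd. Qed.
Let d3 s y : 0 <= E * (((p <= jhi y s (gap s y))%R%:R + (p < jhi y s (gap s y))%R%:R) -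
       ((p <= jlo y s (gap s y))%R%:R + (p < jlo y s (gap s y))%R%:R)).
Proof. by rewrite mulr_ge0 ?(ltW E0) // subr_ge0 step_nd. Qed.

Lemma gap_charge_Phi s y :
  Phi (jhi y s (gap s y)) - Phi (jlo y s (gap s y)) <= gap_charge s y.
Proof. by rewrite dE; have := d2 s y; have := d3 s y; lra. Qed.

Let gap_charge_A s y : a <= y <= b -> A * gap s y <= gap_charge s y.
Proof.
move=> /andP[ay yb]; rewrite dE; have := d1 s y; have := d3 s y.
have -> : clip (jhi y s (gap s y)) - clip (jlo y s (gap s y)) = gap s y; last by lra.
have [l1 l2] := j_sub y s (ltW (gap_gt0 s y)) (gap_le_r s y).
have cE z : a - 1 <= z -> z <= b + 1 -> clip z = z - (a - 1).
  by move=> z1 z2; rewrite /clip (max_idPl z1) (min_idPl z2).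
have h : jlo y s (gap s y) <= jhi y s (gap s y) by apply: jn.
move: h l1 l2 (jlo_hi y s (gap s y)).
move: (jlo _ _ _) (jhi _ _ _) => lo hi h l1 l2 E1.
have -> : clip hi = hi - (a - 1) by move: r1 => r1'; apply: cE; lra.
have -> : clip lo = lo - (a - 1) by move: r1 => r1'; apply: cE; lra.
lra.
Qed.

Lemma gap_charge_len s y : a <= y <= b -> gap s y <= gap_charge s y.
Proof.
by move=> /(gap_charge_A s); apply: le_trans; rewrite ler_peMl ?(ltW (gap_gt0 _ _)).
Qed.

Let gap_charge_long s y : a <= y <= b -> gap s y = r -> E <= gap_charge s y.
Proof.
move=> yab g; apply: le_trans (gap_charge_A s yab); rewrite g.
by rewrite /A mulrDl mul1r divfK ?gt_eqF // lerDr ltW.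
Qed.

(** Of the two indicator functions in [charge], one jumps on an interval whose right end is [p], the
    other on an interval whose left end is [p]. *)
Let gap_charge_p s y : y = p \/ pt y s (gap s y) = p -> E <= gap_charge s y.
Proof.
move=> h; rewrite dE; have := d1 s y; have := d2 s y.
suff : 1 <= ((p <= jhi y s (gap s y))%R%:R + (p < jhi y s (gap s y))%R%:R) -
       ((p <= jlo y s (gap s y))%R%:R + (p < jlo y s (gap s y))%R%:R) :> R.
  by rewrite -(ler_pM2l E0) mulr1; lra.
have := jj s y; have : p = jlo y s (gap s y) \/ p = jhi y s (gap s y).
  by move: h; rewrite /pt /jlo /jhi; case: s => -[->|->]; [right|left|left|right].
case=> <- lt.
  by rewrite lexx ltxx lt (ltW lt) /=; lra.
by rewrite lexx ltxx (lt_geF lt) (lt_gtF lt) /=; lra.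
Qed.

Context (xab : forall i, (i < n)%N -> a <= iter i F x <= b).
Context (fr : forall i, (i < n)%N -> turn_free T (iter i F x - r) (iter i F x + r)).
Context (inj : forall i j, (i < j)%N -> (j < n)%N -> iter i F x != iter j F x).

Let inj' i j : (i < n)%N -> (j < n)%N -> i != j -> iter i F x != iter j F x.
Proof.
move=> im jm; rewrite neq_ltn => /orP[ij|ij]; first exact: inj.
by rewrite eq_sym; exact: inj.
Qed.

Lemma sum_gap_charge s : \sum_(i < n) gap_charge s (iter i F x) <= charge_bound.
Proof.
apply: (@disjoint_sum_ord _ _ xpredT
  (fun i => jlo (iter i F x) s (gap s (iter i F x)))
  (fun i => jhi (iter i F x) s (gap s (iter i F x))) charge).
- exact: charge_nd.
- exact: charge_bnd.
- by move=> i _; exact: jn.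
- move=> i j im jm _ _ ij.
  wlog lt : i j im jm ij / iter i F x < iter j F x.
    move=> H; have := inj' im jm ij; rewrite neq_lt => /orP[lt|lt]; first exact: H.
    have ji : j != i by rewrite eq_sym.
    by case: (H j i jm im ji lt); [right|left].
  have [_ Gi _] := gapP s (iter i F x); have [_ Gj _] := gapP s (iter j F x).
  have := Gi j jm; have := Gj i im; rewrite /jlo /jhi /co; case: s {Gi Gj} => h1 h2.
    by left; have := h1 _; lra.
  by left; have := h2 _; lra.
Qed.

Lemma sum_point_charge : \sum_(i < n) point_charge (iter i F x) <= charge_bound + charge_bound.
Proof. by rewrite big_split /= lerD // sum_gap_charge. Qed.

Definition slope s y := psi F y s (gap s y) / gap s y.

Lemma slope_ge0 s y : 0 <= slope s y.
Proof. by rewrite divr_ge0 ?(ltW (gap_gt0 _ _)) // normr_ge0. Qed.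

Definition max_slope y := Num.max (slope false y) (slope true y).

Lemma slope_le_max s y : slope s y <= max_slope y.
Proof. by rewrite le_max; case: s; rewrite lexx ?orbT. Qed.

Lemma slope_ge s i : (i < n)%N -> C^-1 <= slope s (iter i F x).
Proof.
move=> im; have g0 := gap_gt0 s (iter i F x).
have /andP[+ _] := psi_lip DM s (ltW g0) (gap_le_r _ _) (fr im).
by rewrite ler_pdivlMr.
Qed.

(** Near [y] the map has, up to the variation over both gaps, the slope of either gap. Hence the
    larger slope may be taken, and one bound serves chains on both sides. *)
Lemma expands_point i : (i < n)%N ->
  expands a b F 1 (iter i F x) (expR (- point_charge (iter i F x)) * max_slope (iter i F x)).
Proof.
move=> im; set y := iter i F x.
have gt := gap_gt0 true y; have gf := gap_gt0 false y.
have gtr := gap_le_r true y; have gfr := gap_le_r false y.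
have fry : turn_free T (y - gap true y) (y + gap false y).
  by apply: (turn_free_sub (fr im)); rewrite -/y; lra.
have Pc : Phi (y + gap false y) - Phi (y - gap true y) <= point_charge y.
  have := gap_charge_Phi false y; have := gap_charge_Phi true y.
  by rewrite /point_charge /jlo /jhi; lra.
exists (Num.min (gap true y) (gap false y)); first by rewrite lt_min gt.
move=> z z' _ _; rewrite !lt_min !ltr_distl => /andP[/andP[? ?] /andP[? ?]].
move=> /andP[/andP[? ?] /andP[? ?]] /=.
have K s : expR (- point_charge y) * slope s y * `|z - z'| <= `|F z - F z'|.
  have pg : y - gap true y <= pt y s (gap s y) <= y + gap false y.
    by rewrite /pt; case: s; between.
  have := distN DM (y := y) (z := pt y s (gap s y)) (y' := z') (z' := z) fry
    ltac:(between) pg ltac:(between)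
    ltac:(between).
  rewrite -/(psi F y s (gap s y)) dist_pt ?(ltW (gap_gt0 _ _)) // => D.
  rewrite -mulrA expRN ler_pdivrMl ?expR_gt0 // /slope mulrAC ler_pdivrMr ?gap_gt0 //.
  apply: le_trans D _; apply: ler_wpM2r; first exact/ltW/gap_gt0.
  by apply: ler_wpM2r => //; rewrite ler_expR.
by rewrite /max_slope; case: (lerP (slope false y) (slope true y)) => _; exact: K.
Qed.

Lemma expands_max_slope :
  expands a b F n x (expR (- (charge_bound + charge_bound)) *
    \prod_(i < n) max_slope (iter i F x)).
Proof.
have m0 y : 0 <= max_slope y by apply: le_trans (slope_ge0 false y) (slope_le_max _ _).
apply: (@expands_le _ _ _ _ _ _ (\prod_(i < n)
    (expR (- point_charge (iter i F x)) * max_slope (iter i F x)))).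
  rewrite big_split /= ler_wpM2r ?prodr_ge0 //.
  rewrite -expR_sum sumrN ler_expR lerN2; exact: sum_point_charge.
apply: (expands_orbit DM (k := fun i =>
  expR (- point_charge (iter i F x)) * max_slope (iter i F x))) => t tn.
split; last exact: expands_point.
by rewrite mulr_ge0 // ltW // expR_gt0.
Qed.

Let half (G psi_ W : R) : 0 <= G -> G <= 2 * psi_ -> E <= W -> expR (- W) * G <= psi_.
Proof.
move=> G0 G2 EW; have C1 := dm_C DM.
have eW : expR (- W) <= 2^-1.
  apply: (@le_trans _ _ (expR (- E))); first by rewrite ler_expR lerN2.
  rewrite expRN lnK ?posrE; last by rewrite mulr_gt0.
  by rewrite lef_pV2 ?posrE ?mulr_gt0 // ler_peMr.
apply: (@le_trans _ _ (2^-1 * G)); first by rewrite ler_wpM2r.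
by lra.
Qed.

Let whole (G psi_ W : R) : 0 <= G -> G <= psi_ -> 0 <= W -> expR (- W) * G <= psi_.
Proof.
move=> G0 G2 W0; apply: le_trans G2; rewrite ler_piMl //.
by rewrite -expR0 ler_expR oppr_le0.
Qed.

Let point_charge_ge0 y : 0 <= point_charge y.
Proof. by rewrite addr_ge0 // gap_charge_ge0. Qed.

Let long_step s i (G : R) : (i < n)%N -> 0 <= G -> G <= r -> gap s (iter i F x) = r ->
  expR (- point_charge (iter i F x)) * G <= psi F (iter i F x) s (gap s (iter i F x)).
Proof.
move=> im G0 Gr g; have EW : E <= point_charge (iter i F x).
  by apply: le_trans (gap_charge_le s _); apply: gap_charge_long => //; exact: xab.
have /andP[psr _] := psi_lip DM s (ltW r0) (lexx r) (fr im).
rewrite g; apply: le_trans psr.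
have eW : expR (- point_charge (iter i F x)) <= (2 * C)^-1.
  apply: (@le_trans _ _ (expR (- E))); first by rewrite ler_expR lerN2.
  by rewrite expRN lnK ?posrE // mulr_gt0.
apply: ler_pM => //; apply: le_trans eW _.
by rewrite lef_pV2 ?posrE ?mulr_gt0 // ler_peMl ?ler1n // ltW.
Qed.

Let F_next s i j : (i < n)%N -> gap s (iter i F x) = co s (iter i F x) (iter j F x) ->
  let ps := psi F (iter i F x) s (gap s (iter i F x)) in
  0 < ps /\ co (s (+) reverses F (iter i F x)) (iter i.+1 F x) (iter j.+1 F x) = ps.
Proof.
move=> im gE /=; have g0 := gap_gt0 s (iter i F x).
split.
  have /andP[+ _] := psi_lip DM s (ltW g0) (gap_le_r _ _) (fr im).
  by apply: lt_le_trans; rewrite mulr_gt0 // invr_gt0.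
rewrite -[iter j F x](pt_co s (iter i F x)) -gE.
by rewrite (F_pt DM s (ltW g0) (gap_le_r _ _) r0 (fr im)) co_pt.
Qed.

(** On a cycle the far end of a gap is mapped to a point of the cycle, so only a gap cut at [r] can
    fail to cover the next one. *)
Lemma gap_step_periodic s i : iter n F x = x -> (i < n)%N ->
  expR (- point_charge (iter i F x)) * gap (s (+) reverses F (iter i F x)) (iter i.+1 F x)
    <= psi F (iter i F x) s (gap s (iter i F x)).
Proof.
move=> per im; set s' := s (+) _.
have [_ _ [g|[j jm gE]]] := gapP s (iter i F x).
  by apply: long_step => //; [exact/ltW/gap_gt0|exact: gap_le_r].
have [ps0 psE] := F_next im gE; rewrite -/s' in psE.
apply: whole => //; first exact/ltW/gap_gt0.
have [j' jm' jE] : exists2 j', (j' < n)%N & iter j.+1 F x = iter j' F x.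
  have := jm; rewrite -ltnS ltnS leq_eqVlt => /predU1P[jn'|lt]; last by exists j.+1.
  by exists 0%N; [exact: leq_ltn_trans jm|rewrite jn' per].
have [_ G _] := gapP s' (iter i.+1 F x).
by rewrite -psE jE; apply: G => //; rewrite -jE psE.
Qed.

Lemma gap_step_near s i : (i < n)%N ->
  (forall j, (j < n)%N -> `|iter n F x - x| <= `|iter n F x - iter j F x|) ->
  expR (- point_charge (iter i F x)) *
      gap (s (+) reverses F (iter i F x)) (if (i.+1 < n)%N then iter i.+1 F x else x)
    <= psi F (iter i F x) s (gap s (iter i F x)).
Proof.
move=> im near; set s' := s (+) _.
have n0 : (0 < n)%N by exact: leq_ltn_trans im.
have [_ _ [g|[j jm gE]]] := gapP s (iter i F x).
  by apply: long_step => //; [exact/ltW/gap_gt0|exact: gap_le_r].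
have [ps0 psE] := F_next im gE; rewrite -/s' in psE; set ps := psi _ _ _ _ in ps0 psE *.
have ij : i != j.
  by apply/eqP => ij; have := gap_gt0 s (iter i F x); rewrite gE ij coxx ltxx.
have EW : iter i F x = p \/ iter j F x = p -> E <= point_charge (iter i F x).
  move=> h; apply: le_trans (gap_charge_le s _); apply: gap_charge_p.
  by case: h => [|h]; [left|right; rewrite gE pt_co].
case: ifP => [im1|/negbT]; last rewrite -leqNgt => ni.
  have [_ G _] := gapP s' (iter i.+1 F x).
  have := jm; rewrite -ltnS ltnS leq_eqVlt => /predU1P[jn'|jm1].
    have ipE : iter j F x = p by rewrite /p -jn'.
    apply: half; [exact/ltW/gap_gt0| |by apply: EW; right].
    (* The gap ends at [p], whose image is [iter n F x]. Since [x] is at least as near to that image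
       as [iter i.+1 F x] is, it lies on the side [s'] of [iter i.+1 F x], at distance at most
       [2 * ps]. *)
    have d1' := near _ im1; rewrite -jn' in d1'.
    have d2' : `|iter j.+1 F x - iter i.+1 F x| = ps.
      by rewrite -(@co_normE _ s') psE // ltW.
    have cE : co s' (iter i.+1 F x) x = ps + co s' (iter j.+1 F x) x.
      by rewrite (coD _ _ (iter j.+1 F x)) psE.
    have cb : - ps <= co s' (iter j.+1 F x) x <= ps.
      move: d1'; rewrite d2' distrC ler_norml /co => /andP[? ?].
      by case: (s'); between.
    have /andP[cb1 cb2] := cb.
    have cn0 : co s' (iter i.+1 F x) x != 0.
      apply/eqP => c0; have : iter i.+1 F x != iter 0 F x by apply: inj'.
      by move/eqP; apply; exact: (esym (co_eq0 c0)).
    have cp : 0 < co s' (iter i.+1 F x) x by rewrite lt_def cn0 cE; lra.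
    by apply: le_trans (G 0%N n0 cp) _; rewrite /= cE; lra.
  apply: whole => //; first exact/ltW/gap_gt0.
  by rewrite -psE; apply: G => //; rewrite psE.
have iE : i.+1 = n by apply/eqP; rewrite eqn_leq im ni.
have ipE : iter i F x = p by rewrite /p -iE.
have jm1 : (j.+1 < n)%N.
  by rewrite ltn_neqAle jm andbT; apply: contra ij; rewrite -iE eqSS eq_sym.
have [_ G _] := gapP s' x.
apply: half; [exact/ltW/gap_gt0| |by apply: EW; left].
(* The gap starts at [p], so its image is based at [iter n F x], but the next gap is based at [x].
   The point [iter j.+1 F x] is at distance [ps] from the former and, by nearness, at most [2 * ps]
   from [x], on the side [s']. *)
have d1' := near _ jm1; rewrite -iE in d1'.
have d2' : `|iter i.+1 F x - iter j.+1 F x| = ps.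
  by rewrite distrC -(@co_normE _ s') psE // ltW.
have cE : co s' x (iter j.+1 F x) = co s' x (iter i.+1 F x) + ps.
  by rewrite (coD _ _ (iter i.+1 F x)) psE.
have cb : - ps <= co s' x (iter i.+1 F x) <= ps.
  move: d1'; rewrite d2' ler_norml /co => /andP[? ?].
  by case: (s'); between.
have /andP[cb1 cb2] := cb.
have cn0 : co s' x (iter j.+1 F x) != 0.
  apply/eqP => c0; have : iter j.+1 F x != iter 0 F x by apply: inj'.
  by move/eqP; apply; exact: (co_eq0 c0).
have cp : 0 < co s' x (iter j.+1 F x) by rewrite lt_def cn0 cE; lra.
by apply: le_trans (G _ jm1 cp) _; rewrite cE; lra.
Qed.

End Gaps.

(** * Periodic orbits and tiles *)

Section Expanding.
Context {R : realType} (a b : R) (F : R -> R) (T : set R) (C V : R) (Phi : R -> R).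
Context (DM : denjoy_map a b F T C V Phi).
Context (r : R) (r0 : 0 < r) (r1 : r <= 1).
Implicit Types (x y p K : R) (n : nat).

Let W := charge_bound a b C V r.
Let Om := W + W.

Let C0 : 0 < C := lt_le_trans ltr01 (dm_C DM).

Lemma max_slope_ge0 x n y : 0 <= max_slope F x n r0 y.
Proof. by apply: le_trans (slope_ge0 F x n r0 false y) (slope_le_max _ _ _ _ _ _). Qed.

Lemma point_charge_ge0 x n y : 0 <= point_charge a b F C Phi x n r0 y.
Proof. by rewrite addr_ge0 // (gap_charge_ge0 DM). Qed.

Lemma point_charge_Phi x n s y :
  Phi (jhi y s (gap F x n r0 s y)) - Phi (jlo y s (gap F x n r0 s y)) <=
    point_charge a b F C Phi x n r0 y.
Proof. by apply: le_trans (gap_charge_le DM _ _ _ s _); exact: (gap_charge_Phi DM). Qed.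

Lemma point_charge_len x n s y : a <= y <= b ->
  gap F x n r0 s y <= point_charge a b F C Phi x n r0 y.
Proof.
by move=> yab; apply: le_trans (gap_charge_le DM _ _ _ s _); exact: (gap_charge_len DM).
Qed.

Lemma rightmost_gap x n y : (forall i, (i < n)%N -> iter i F x <= y) ->
  gap F x n r0 false y = r.
Proof.
move=> ymax; have [/andP[g0 _] _ [//|[i im E]]] := gapP F x n r0 false y.
by move: (ymax i im) g0; rewrite E /co; lra.
Qed.

Lemma periodic_expands K : exists N, forall n p, (N <= n)%N -> (0 < n)%N ->
  a <= p <= b -> iter n F p = p ->
  (forall i, (i < n)%N -> turn_free T (iter i F p - r) (iter i F p + r)) ->
  (forall i j, (i < j)%N -> (j < n)%N -> iter i F p != iter j F p) ->
  expands a b F n p K.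
Proof.
pose K' := Num.max K 1; have K'1 : 1 <= K' by rewrite le_max lexx orbT.
have K'0 : 0 < K' by exact: lt_le_trans K'1.
pose c := expR (- (Om + Om + (Om + Om))) * r.
have c0 : 0 < c by rewrite mulr_gt0 ?expR_gt0.
(* Chosen so that [h 0 < e] and [c <= Q ^+ 2 * h 0] give [Q >= expR Om * K']; the factor [expR Om]
   is lost in passing from slopes to local expansion. *)
pose e := c / (expR Om * K') ^+ 2.
have e0 : 0 < e by rewrite divr_gt0 ?exprn_gt0 ?mulr_gt0 ?expR_gt0.
have [N HN] := returning_tubes DM (Om + Om) e0 c0.
exists N => n p Nn n0 pab per fr inj.
have iab i : a <= iter i F p <= b by exact: iter_itv DM _ _ _.
have shift i : iter (i + n) F p = iter i F p by rewrite iterD per.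
have imod i : iter i F p = iter (i %% n) F p.
  by rewrite {1}(divn_eq i n) addnC; elim: (i %/ n)%N => [|q IH];
    rewrite ?mul0n ?addn0 // mulSn addnCA addnC shift.
have fr' i : turn_free T (iter i F p - r) (iter i F p + r).
  by rewrite imod; apply: fr; rewrite ltn_mod.
(* The rightmost point of the cycle has a gap of full length [r] on its right. *)
have [u un umax] := argmax (fun i => iter i F p) n0.
set y := iter u F p in umax.
pose s t := germ F y false t.
pose g t := gap F p n r0 (s t) (iter (t + u) F p).
pose w t := point_charge a b F C Phi p n r0 (iter (t + u) F p).
have eE t : iter t F y = iter (t + u) F p by rewrite iterD.
(* One turn around the cycle may exchange the two sides of [y]; two turns restore them and lead back
   to the long gap. *)
have sM : s (n + n)%N = false.
  have yn : iter n F y = y by rewrite eE addnC shift.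
  by rewrite /s germ_shift yn germ_addb addbb.
have gM : g (n + n)%N = r.
  by rewrite /g sM addnC addnA !shift; exact: rightmost_gap.
have shift_big idx (op : Monoid.com_law idx) (G : R -> R) k :
    \big[op/idx]_(t < n) G (iter (k + t + u) F p) = \big[op/idx]_(t < n) G (iter t F p).
  rewrite -(@periodic_shift_big _ _ op (fun t => G (iter t F p)) n (k + u)).
    by apply: eq_bigr => t _; rewrite addnAC.
  by move=> t; rewrite shift.
have step s' i : expR (- point_charge a b F C Phi p n r0 (iter i F p)) *
    gap F p n r0 (s' (+) reverses F (iter i F p)) (iter i.+1 F p) <=
    psi F (iter i F p) s' (gap F p n r0 s' (iter i F p)).
  rewrite iterS (imod i) -iterS.
  by apply: (gap_step_periodic DM r0 r1) => //; rewrite ltn_mod.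
have [||||||h [hg tb prod ret]] := @chain_pull _ a b F T C V Phi DM y false g w (n + n) r (Om + Om) r0.
- by move=> t _; rewrite gap_gt0 gap_le_r.
- by move=> t _; rewrite /= eE.
- by move=> t _; exact: point_charge_len.
- by move=> t _ /=; rewrite eE; exact: point_charge_Phi.
- move=> t _; have sS : s t.+1 = s t (+) reverses F (iter (t + u) F p) by rewrite -eE.
  by rewrite eE /g sS addSn; exact: step.
- rewrite big_split_ord /=.
  by rewrite (shift_big 0 +%R (fun z => point_charge a b F C Phi p n r0 z) 0)
    (shift_big 0 +%R (fun z => point_charge a b F C Phi p n r0 z) n) ?addnn // lerD //
    (sum_point_charge DM).
have [hp hgr] := andP (hg 0%N (leq0n _)).
have hr : h 0%N <= r by exact: le_trans hgr (gap_le_r _ _ _ _ _ _).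
have he : h 0%N < e.
  have := HN (n + n)%N _ _ (leq_trans Nn (leq_addr n n)) tb.
  rewrite jlo_hi /jlo /jhi /=; apply; first by have := iab u; rewrite -/y => /andP[]; lra.
    by have := iab u; rewrite -/y => /andP[]; move: r1 => ?; lra.
  by move: ret; rewrite gM.
pose Q := \prod_(i < n) max_slope F p n r0 (iter i F p).
have Q0 : 0 <= Q by apply: prodr_ge0 => i _; exact: max_slope_ge0.
have QQ : c <= Q ^+ 2 * h 0%N.
  rewrite /c -gM; apply: le_trans prod _; rewrite ler_pM2r //.
  apply: (@le_trans _ _ (\prod_(t < n + n) max_slope F p n r0 (iter (t + u) F p))).
    apply: ler_prod => t _ /=; rewrite -/(s t) /g eE.
    by rewrite (slope_ge0 _ _ _ _ (s t)) (slope_le_max _ _ _ _ (s t)).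
  rewrite big_split_ord /= (shift_big 1 *%R (max_slope F p n r0) 0)
    (shift_big 1 *%R (max_slope F p n r0) n).
  by rewrite expr2.
apply: expands_le (expands_max_slope DM r0 fr inj); rewrite -/W -/Om -/Q.
apply: (@le_trans _ _ K'); first by rewrite le_max lexx.
rewrite expRN -ler_pdivrMl ?invr_gt0 ?expR_gt0 // invrK.
rewrite -(@ler_pXn2r _ 2) ?nnegrE ?mulr_ge0 ?(ltW (expR_gt0 _)) ?(ltW K'0) //.
rewrite -(ler_pM2r hp); apply: le_trans QQ.
by move/ltW: he; rewrite /e ler_pdivlMr ?exprn_gt0 ?mulr_gt0 ?expR_gt0 // mulrC.
Qed.

Definition tile (Y : set R) x n := [/\ (0 < n)%N, forall i, (i <= n)%N -> Y (iter i F x),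
  forall i j, (i < j)%N -> (j < n)%N -> iter i F x != iter j F x &
  forall i, (i < n)%N -> `|iter n F x - x| <= `|iter n F x - iter i F x|].

Section Tiles.
Context (Y : set R) (Yab : forall x, Y x -> a <= x <= b).
Context (Yfree : forall x, Y x -> turn_free T (x - r) (x + r)).

(** At time [n] the base point is [x] instead of [iter n F x], in accordance with
    [gap_step_near]. *)
Definition chain_gap x n s0 t :=
  gap F x n r0 (germ F x s0 t) (if (t < n)%N then iter t F x else x).
Definition chain_slopes x n s0 u M :=
  \prod_(t < M) slope F x n r0 (germ F x s0 (u + t)) (iter (u + t) F x).

Lemma tile_chain x n u M s0 : tile Y x n -> (u + M <= n)%N ->
  expR (- Om) * chain_gap x n s0 (u + M) <= chain_slopes x n s0 u M * chain_gap x n s0 u /\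
  exists lo hi, [/\ tube F T Phi Om M lo hi,
    forall t, (t < M)%N -> [/\ Y (iter t F (iter u F x)), lo t <= iter t F (iter u F x) <= hi t &
      hi t - lo t <= r] &
    expR (- (Om + Om)) * chain_gap x n s0 (u + M) <= chain_slopes x n s0 u M * (hi 0%N - lo 0%N)].
Proof.
move=> [n0 Yx inj near] uM.
pose w t := point_charge a b F C Phi x n r0 (iter (u + t) F x).
pose g t := chain_gap x n s0 (u + t); pose s1 := germ F x s0 u.
have lt t : (t < M)%N -> (u + t < n)%N by move=> tM; rewrite (leq_trans _ uM) // ltn_add2l.
have eE t : iter t F (iter u F x) = iter (u + t) F x by rewrite addnC iterD.
have sE t : germ F (iter u F x) s1 t = germ F x s0 (u + t) by rewrite germ_shift.
have gE t : (t < M)%N -> g t = gap F x n r0 (germ F x s0 (u + t)) (iter (u + t) F x).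
  by move=> /lt ut; rewrite /g /chain_gap ut.
have iab i : (i < n)%N -> a <= iter i F x <= b by move=> /ltnW/Yx/Yab.
have fr i : (i < n)%N -> turn_free T (iter i F x - r) (iter i F x + r).
  by move=> /ltnW/Yx/Yfree.
have g0 t : (t <= M)%N -> 0 < g t <= r by rewrite gap_gt0 gap_le_r.
have step t : (t < M)%N -> expR (- w t) * g t.+1 <=
    psi F (iter t F (iter u F x)) (germ F (iter u F x) s1 t) (g t).
  move=> tM; have := gap_step_near DM r0 r1 iab fr inj (germ F x s0 (u + t)) (lt t tM) near.
  by rewrite sE eE (gE t tM) /g /chain_gap addnS.
have sumw : \sum_(t < M) w t <= Om.
  apply: le_trans (sum_point_charge DM r0 inj).
  rewrite /w; have := point_charge_ge0 x n; move: (point_charge _ _ _ _ _ _ _ _) => P P0.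
  rewrite -(subnKC uM) !big_split_ord /= -addrA addrCA -[leLHS]addr0 lerD //.
  by apply: addr_ge0; apply: sumr_ge0.
have QE : \prod_(t < M) (psi F (iter t F (iter u F x)) (germ F (iter u F x) s1 t) (g t) / g t) =
    chain_slopes x n s0 u M.
  by apply: eq_bigr => t _; rewrite sE eE gE.
have /= := chain_telescope g0 step sumw; rewrite QE /g addn0 => tel; split=> {tel}//.
have [|||h [hg tb prod _]] := @chain_pull _ a b F T C V Phi DM (iter u F x) s1 g w M r Om r0 g0
   _ _ _ step sumw.
- by move=> t tM /=; rewrite eE; exact/fr/lt.
- by move=> t tM; rewrite gE //; apply/point_charge_len/iab/lt.
- by move=> t tM /=; rewrite sE eE gE //; exact: point_charge_Phi.
do 2 eexists; split; [exact: tb| |by rewrite jlo_hi; move: prod => /=; rewrite QE].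
move=> t tM /=; have /andP[h0 hgt] := hg t (ltnW tM); rewrite jlo_hi; split.
- by rewrite eE; apply: Yx; exact/ltnW/lt.
- by rewrite j_co coxx lexx ltW.
- by apply: le_trans hgt _; exact: gap_le_r.
Qed.

Lemma chain_slopes_le x n s0 u M (m := fun i => max_slope F x n r0 (iter i F x)) :
  0 <= chain_slopes x n s0 u M <= \prod_(t < M) m (u + t)%N.
Proof.
rewrite prodr_ge0 /=; last by move=> t _; exact: slope_ge0.
by apply: ler_prod => t _; rewrite slope_ge0 slope_le_max.
Qed.

Lemma chain_gap_end x n s0 : chain_gap x n s0 n = chain_gap x n (germ F x s0 n) 0.
Proof. by rewrite /chain_gap ltnn /=; case: ifP. Qed.

(* Following the chain of gaps once around the tile, on either side, returns to a gap at [x]: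
   the product of the slopes along one chain, or along both, is then bounded below. *)
Lemma tile_slopes x n (Q := \prod_(i < n) max_slope F x n r0 (iter i F x)) s0 (e : R) :
  tile Y x n -> 0 < e ->
  expR (- Om) * chain_gap x n s0 n <= chain_slopes x n s0 0 n * (chain_gap x n s0 0 * e) ->
  expR (- (Om + Om)) <= Q ^+ 2 * e.
Proof.
move=> tl e0 H.
(* The chain on the other side satisfies the same inequality without the gain [e]. *)
have [G _] := @tile_chain x n 0 n (~~ s0) tl (leqnn n).
have /andP[P0 P1] := chain_slopes_le x n s0 0 n.
have /andP[P0' P1'] := chain_slopes_le x n (~~ s0) 0 n.
rewrite -/Q in P1 P1'; have g0 s : 0 < chain_gap x n s 0 by exact: gap_gt0.
move: H G; rewrite add0n !chain_gap_end (germ_addb F x s0 n) (germ_addb F x (~~ s0) n) => H G.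
have Q0 : 0 <= Q := le_trans P0 P1.
have alg (E P P' g g' : R) : 0 < E -> 0 < g -> 0 < g' -> 0 <= P <= Q -> 0 <= P' <= Q ->
    E * g' <= P * (g * e) -> E * g <= P' * g' -> E * E <= Q * Q * e.
  move=> E0 gp gp' /andP[p0 pQ] /andP[p0' pQ'] h1 h2.
  rewrite -(ler_pM2r gp) -(ler_pM2r gp').
  rewrite [leLHS](_ : _ = E * g' * (E * g)); last by ring.
  apply: le_trans (ler_pM (ltW (mulr_gt0 E0 gp')) (ltW (mulr_gt0 E0 gp)) h1 h2) _.
  rewrite [leLHS](_ : _ = (P * P') * (g * e * g')); last by ring.
  rewrite [leRHS](_ : _ = (Q * Q) * (g * e * g')); last by ring.
  by rewrite ler_wpM2r ?ler_pM // !mulr_ge0 // ltW.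
rewrite opprD expRD expr2.
have eO := expR_gt0 (- Om).
(* If the tile reverses orientation, each chain ends at the gap where the other one starts, and the
   inequalities are multiplied before cancelling. Otherwise each chain closes up by itself. *)
move: H G; case: (germ F x false n); rewrite ?addbT ?addbF ?negbK => H G.
- by apply: (@alg _ _ _ (chain_gap x n s0 0) (chain_gap x n (~~ s0) 0)) H G; rewrite ?P0 ?P0'.
- rewrite ler_pM2r // in G.
  apply: (@le_trans _ _ ((Q * e) * Q)); last by rewrite mulrAC.
  apply: ler_pM; rewrite ?(ltW eO) //; last exact: le_trans P1'.
  apply: (@le_trans _ _ (chain_slopes x n s0 0 n * e)); last by rewrite ler_wpM2r // ltW.
  by rewrite -(ler_pM2r (g0 s0)) -mulrA (mulrC e).
Qed.

Lemma tile_slopes_ge x n : tile Y x n ->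
  expR (- Om) <= \prod_(i < n) max_slope F x n r0 (iter i F x).
Proof.
move=> tl; have [G _] := @tile_chain x n 0 n false tl (leqnn n).
have := @tile_slopes x n false 1 tl ltr01; rewrite mulr1 => /(_ G).
rewrite opprD expRD mulr1 -expr2 ler_pXn2r ?nnegrE ?expR_ge0 //.
by apply: prodr_ge0 => i _; exact: max_slope_ge0.
Qed.

Lemma tile_expands x n K : tile Y x n ->
  expR Om * K <= \prod_(i < n) max_slope F x n r0 (iter i F x) -> expands a b F n x K.
Proof.
move=> [n0 Yx inj _] HK.
have fr i : (i < n)%N -> turn_free T (iter i F x - r) (iter i F x + r).
  by move=> /ltnW/Yx/Yfree.
apply: expands_le (expands_max_slope DM r0 fr inj).
by rewrite expRN -ler_pdivrMl ?invr_gt0 ?expR_gt0 // invrK.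
Qed.

Lemma tile_lower x n : tile Y x n -> expands a b F n x (expR (- (Om + Om))).
Proof.
move=> tl; apply: tile_expands => //; apply: le_trans (tile_slopes_ge tl).
by rewrite -expRD ler_expR; lra.
Qed.

Context (Yfree2 : forall x, Y x -> turn_free T (x - (r + r)) (x + (r + r))).
Context (Yrep : forall p k, (0 < k)%N -> a <= p <= b -> iter k F p = p ->
  (forall i e, 0 < e -> exists2 y, Y y & `|y - iter i F p| < e) ->
  exists2 K, 1 < K & expands a b F k p K).

(** The rightmost point, at time [u], has a gap of length [r]. If many steps follow it, the final
    gap pulls back to a short part of this long gap, which is a gain in [tile_slopes]. If not, many
    steps precede it: the long gap pulls back to a short interval at [x], the slopes before [u] are
    large, and the remaining steps cost at most [C ^+ N1]. *)
Lemma tile_large K : exists N, forall x n, (N <= n)%N -> tile Y x n -> expands a b F n x K.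
Proof.
pose L := expR Om * Num.max K 1.
have L0 : 0 < L by rewrite mulr_gt0 ?expR_gt0 // lt_max ltr01 orbT.
have LQ x n : tile Y x n -> L <= \prod_(i < n) max_slope F x n r0 (iter i F x) ->
    expands a b F n x K.
  move=> tl LQ; apply: tile_expands => //; apply: le_trans LQ.
  by rewrite ler_pM2l ?expR_gt0 // le_max lexx.
have rr0 : 0 < r + r by rewrite addr_gt0.
have sh (e : R) : 0 < e -> exists N, forall M lo hi x, (N <= M)%N -> tube F T Phi Om M lo hi ->
    (forall t, (t < M)%N -> [/\ Y (iter t F x), lo t <= iter t F x <= hi t & hi t - lo t <= r]) ->
    hi 0%N - lo 0%N < e.
  move=> e0; have [N HN] := shrink DM rr0 Yab Yfree2 Yrep Om e0.
  exists N => M lo hi x NM tb H; apply: (HN M lo hi x NM tb) => t tM; have [? ? lr] := H t tM.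
  split=> //; last exact: le_trans lr r1.
  by rewrite (_ : (r + r) / 2 = r) //; lra.
(* The gain becomes [e1 * expR (Om + Om) / r = expR (- (Om + Om)) / L ^+ 2], for which [tile_slopes]
   says [L <= Q]. *)
pose e1 := expR (- (Om + Om + (Om + Om))) * r / L ^+ 2.
have e10 : 0 < e1 by apply: divr_gt0; [apply: mulr_gt0 => //; exact: expR_gt0|exact: exprn_gt0].
have [N1 HN1] := sh _ e10.
pose e2 := expR (- (Om + Om)) * r * C ^- N1 / L.
have e20 : 0 < e2 
  by rewrite /e2; do !apply: mulr_gt0 => //; rewrite ?expR_gt0 ?invr_gt0 ?exprn_gt0.
have [N2 HN2] := sh _ e20.
exists (N1 + N2)%N => x n Nn tl; apply: (LQ x n tl).
have [n0 Yx inj near] := tl.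
have fr i : (i < n)%N -> turn_free T (iter i F x - r) (iter i F x + r).
  by move=> /ltnW/Yx/Yfree.
set Q := \prod_(i < n) _.
have [u un umax] := argmax (fun i => iter i F x) n0.
(* The side of [x] that is carried to the right side of the rightmost point. *)
pose s0 := germ F x false u.
have gu : chain_gap x n s0 u = r.
  rewrite /chain_gap un germ_addb addbb; exact: rightmost_gap.
have un' : (u + (n - u))%N = n by rewrite subnKC // ltnW.
have [tA [lo [hi [tbA inA pA]]]] := @tile_chain x n 0 u s0 tl (ltnW un).
have [_ [lo' [hi' [tbB inB pB]]]] := @tile_chain x n u (n - u) s0 tl (eq_leq un').
have prodE (H : nat -> R) : \prod_(i < n) H i =
    (\prod_(t < u) H t) * \prod_(t < n - u) H (u + t)%N.
  by move: (n - u)%N un' => v <-; rewrite big_split_ord.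
have QE := prodE (fun t => max_slope F x n r0 (iter t F x)); rewrite /= -/Q in QE.
have /andP[PA0 PA] := chain_slopes_le x n s0 0 u.
have /andP[PB0 PB] := chain_slopes_le x n s0 u (n - u).
have Q0 : 0 <= Q by apply: prodr_ge0 => i _; exact: max_slope_ge0.
have bound (E1 G0 Gn SA SB e E2 : R) : 0 <= E1 -> 0 <= G0 -> 0 <= SA -> 0 <= SB -> 0 <= e ->
    0 <= E2 -> E1 * r <= SA * G0 -> Gn <= E2 * (SB * e) ->
    E1 * Gn <= SA * SB * (G0 * (e * E2 / r)).
  move=> E10 G00 SA0 SB0 e0 E20 A B.
  rewrite (_ : _ * (G0 * _) = SA * G0 * (E2 * (SB * e)) / r); last by ring.
  rewrite ler_pdivlMr //; apply: (@le_trans _ _ (E1 * r * (E2 * (SB * e)))).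
    by rewrite mulrAC ler_wpM2l // mulr_ge0 // ltW.
  by rewrite ler_wpM2r // !mulr_ge0.
have [le|lt] := leqP N1 (n - u).
  have h1 := HN1 _ _ _ _ le tbB inB.
  have SE : chain_slopes x n s0 0 n = chain_slopes x n s0 0 u * chain_slopes x n s0 u (n - u).
    exact: prodE (fun t => slope F x n r0 (germ F x s0 t) (iter t F x)).
  have e10' : 0 < e1 * expR (Om + Om) / r by apply: divr_gt0 => //; rewrite mulr_gt0 ?expR_gt0.
  have := @tile_slopes x n s0 _ tl e10'; rewrite SE -/Q.
  have g0 : 0 <= chain_gap x n s0 0 by exact/ltW/gap_gt0.
  have H : expR (- Om) * chain_gap x n s0 n <=
      chain_slopes x n s0 0 u * chain_slopes x n s0 u (n - u) *
      (chain_gap x n s0 0 * (e1 * expR (Om + Om) / r)).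
    move: tA pB; rewrite add0n gu un'.
    move: (chain_gap x n s0 0) (chain_gap x n s0 n) g0 => G0 Gn G00.
    move: (chain_slopes x n s0 0 u) (chain_slopes x n s0 u _) PA0 PB0 => SA SB SA0 SB0 tA.
    rewrite expRN ler_pdivrMl ?expR_gt0 // => pB.
    have pB' : Gn <= expR (Om + Om) * (SB * e1).
      apply: le_trans pB _; rewrite ler_pM2l ?expR_gt0 //.
      by rewrite ler_wpM2l // ltW.
    exact: (bound _ _ _ _ _ _ _ (expR_ge0 _) G00 SA0 SB0 (ltW e10) (expR_ge0 _) tA pB').
  move=> /(_ H) H2; rewrite -(@ler_pXn2r _ 2) ?nnegrE ?(ltW L0) //; move: H2.
  have E2 : expR (- (Om + Om + (Om + Om))) = expR (- (Om + Om)) / expR (Om + Om).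
    by rewrite -expRN -expRD opprD.
  have -> : e1 * expR (Om + Om) / r = expR (- (Om + Om)) / L ^+ 2.
    by rewrite /e1 E2; field; rewrite ?gt_eqF ?expR_gt0.
  by rewrite mulrCA -[leLHS]mulr1 ler_pM2l ?expR_gt0 // ler_pdivlMr ?exprn_gt0 // mul1r.
have un2 : (N2 <= u)%N by move: Nn un lt; clear; lia.
have h2 := HN2 u lo hi x un2 tbA inA.
rewrite QE; apply: (@le_trans _ _ (chain_slopes x n s0 0 u * C ^- N1)).
  move: pA; rewrite add0n gu => pA.
  have := le_trans pA (ler_wpM2l PA0 (ltW h2)); rewrite /e2.
  rewrite (_ : _ * (_ / L) = expR (- (Om + Om)) * r *
    (chain_slopes x n s0 0 u * C ^- N1 / L)); last by ring.
  by rewrite -[leLHS]mulr1 ler_pM2l ?mulr_gt0 ?expR_gt0 // ler_pdivlMr // mul1r.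
apply: ler_pM => //; first by rewrite invr_ge0 exprn_ge0 // ltW.
apply: (@le_trans _ _ (C ^- (n - u))).
  rewrite lef_pV2 ?posrE ?exprn_gt0 //; apply: ler_weXn2l (ltnW lt); exact: dm_C DM.
rewrite -exprVn -[X in _ ^+ X]card_ord -prodr_const; apply: ler_prod => t _.
rewrite invr_ge0 (ltW C0) /=.
apply: le_trans (slope_le_max _ _ _ _ false _); apply: (slope_ge DM r0 fr).
by rewrite -{2}un' ltn_add2l.
Qed.
End Tiles.
End Expanding.

(** * Uniform expansion *)

Section Uniform.
Context {R : realType} (a b : R) (F : R -> R) (T : set R) (C V : R) (Phi : R -> R).
Context (DM : denjoy_map a b F T C V Phi).
Context (r : R) (r0 : 0 < r) (r1 : r <= 1).
Context (Y : set R) (Yab : forall x, Y x -> a <= x <= b).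
Context (Yfree : forall x, Y x -> turn_free T (x - (r + r)) (x + (r + r))).
Context (Yrep : forall p k, (0 < k)%N -> a <= p <= b -> iter k F p = p ->
  (forall i e, 0 < e -> exists2 y, Y y & `|y - iter i F p| < e) ->
  exists2 K, 1 < K & expands a b F k p K).
Implicit Types (x y p K e : R) (n : nat).

Let C0 : 0 < C := lt_le_trans ltr01 (dm_C DM).

(** Compactness: counterexamples with constants tending to 0 and 1 accumulate at a point fixed by
    [iter k F] in the closure of [Y]. The expansion there holds on a neighbourhood, hence at nearby
    counterexamples too. *)
Lemma near_periodic k : (0 < k)%N -> exists eta lam : R, [/\ 0 < eta, 1 < lam &
  forall x, (forall i, (i <= k)%N -> Y (iter i F x)) -> `|iter k F x - x| < eta ->
    expands a b F k x lam].
Proof.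
move=> k0; apply: contrapT => nH.
have /choice[f Hf] : forall N : nat, exists x, [/\ forall i, (i <= k)%N -> Y (iter i F x),
    `|iter k F x - x| < N.+1%:R^-1 & ~ expands a b F k x (1 + N.+1%:R^-1)].
  move=> N; apply: contrapT => nx; apply: nH; exists N.+1%:R^-1, (1 + N.+1%:R^-1).
  split; rewrite ?ltrDl ?invr_gt0 // => x xY xk; apply: contrapT => nE.
  by apply: nx; exists x.
have [|p pab clp] := @bounded_cluster R f a b.
  by move=> N; have [/(_ 0%N (leq0n _))/Yab] := Hf N.
have small e : 0 < e -> exists N, forall m, (N <= m)%N -> m.+1%:R^-1 < e.
  by move=> e0; have [N _ HN] := near_infty_natSinv_lt (PosNum e0); exists N.
have per : iter k F p = p.
  suff H e : 0 < e -> `|iter k F p - p| <= e.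
    apply/eqP; rewrite -subr_eq0 -normr_le0; apply/ler_addgt0Pr => e e0.
    by rewrite add0r; exact: H.
  move=> e0.
  have e3 : 0 < e / 3 by rewrite divr_gt0.
  have [d d0 Hd] := iter_near DM k p e3.
  have [N HN] := small _ e3.
  have [|m Nm mp] := clp (Num.min d (e / 3)) N; first by rewrite lt_min d0.
  have [_ mk _] := Hf m; have m1 := HN m Nm.
  move: mp; rewrite lt_min => /andP[/Hd h1 h2].
  move: m1 h1 h2 mk; move: (m.+1%:R^-1 : R) (iter k F (f m)) => q z m1.
  rewrite !ltr_distl ler_distl => /andP[? ?] /andP[? ?] /andP[? ?].
  by between.
have [|K K1 [s s0 Hs]] := Yrep k0 pab per.
  move=> i e e0; have -> : iter i F p = iter (i %% k) F p.
    rewrite {1}(divn_eq i k) addnC iterD; congr (iter _ F _).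
    by elim: (i %/ k)%N => // q IH; rewrite mulSn iterD IH.
  have [d d0 Hd] := iter_near DM (i %% k) p e0.
  have [m _ mp] := clp d 0%N d0; exists (iter (i %% k) F (f m)); last exact: Hd.
  by have [+ _ _] := Hf m; apply; rewrite ltnW // ltn_mod.
have s2 : 0 < s / 2 by rewrite divr_gt0.
have K10 : 0 < K - 1 by rewrite subr_gt0.
have [N HN] := small _ K10; have [m Nm mp] := clp _ N s2.
have [_ _] := Hf m; apply; apply: (@expands_le _ _ _ _ _ _ K).
  by have := HN m Nm; move: (m.+1%:R^-1 : R) => q; lra.
exists (s / 2) => // y z yab zab ym zm; apply: Hs => //.
  by move: mp ym; rewrite !ltr_distl => /andP[? ?] /andP[? ?]; between.
by move: mp zm; rewrite !ltr_distl => /andP[? ?] /andP[? ?]; between.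
Qed.

Lemma exists_tile x n : (0 < n)%N -> (forall i, (i <= n)%N -> Y (iter i F x)) ->
  exists2 j, (j < n)%N & tile F Y (iter j F x) (n - j) /\
    forall i, (i < n)%N -> `|iter n F x - iter j F x| <= `|iter n F x - iter i F x|.
Proof.
move=> n0 Yx; have [j [jn near last]] := argmin_last (fun i => `|iter n F x - iter i F x|) n0.
have jn' : (n - j + j = n)%N by rewrite subnK // ltnW.
exists j => //; split=> //; split.
- by rewrite subn_gt0.
- by move=> i ij; rewrite -iterD; apply: Yx; rewrite -[leqRHS]jn' leq_add2r.
- move=> i i' ii i'n; rewrite -!iterD; apply/eqP => E.
  have i'jn : (i' + j < n)%N by rewrite -[ltnRHS]jn' ltn_add2r.
  pose d := (i' - i)%N; have d0 : (0 < d)%N by rewrite subn_gt0.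
  have dn : (i + j < n - d)%N.
    by rewrite /d; move: ii i'jn; clear; lia.
  (* A repetition would bring the orbit back to its end point at a time after [j], at distance zero,
     while [j] is the last minimizer. *)
  have E' : iter (n - d) F x = iter n F x.
    have -> : n = ((n - (i' + j)) + (i' + j))%N by rewrite subnK // ltnW.
    rewrite [in RHS]iterD -E -iterD; congr (iter _ F x).
    by rewrite /d; move: ii i'jn; clear; lia.
  have jd : (j < n - d)%N by apply: leq_ltn_trans dn; rewrite leq_addl.
  have dn' : (n - d < n)%N by rewrite ltn_subrL d0.
  by have := last _ jd dn'; rewrite E' subrr normr0 normr_lt0.
- move=> i ij; rewrite -!iterD jn'; apply: near.
  by rewrite -[ltnRHS]jn' ltn_add2r.
Qed.

Let Yfree1 x : Y x -> turn_free T (x - r) (x + r).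
Proof. by move=> /Yfree; move: (r0) => ? h; apply: (turn_free_sub h); lra. Qed.

(** Tiles of at least [N] steps double distances by [tile_large]; the finitely many smaller lengths
    are covered by [near_periodic], with the minimum of their constants. *)
Lemma tile_growth : exists c lam eta : R, [/\ 0 < c <= 1, 1 < lam, 0 < eta &
  forall x n, tile F Y x n -> expands a b F n x c /\
    (`|iter n F x - x| < eta -> expands a b F n x lam)].
Proof.
have [N HN] := tile_large DM r0 r1 Yab Yfree1 Yfree Yrep 2.
have [eta [lam [eta0 lam1 H]]] : exists eta lam : R, [/\ 0 < eta, 1 < lam &
    forall k x, (0 < k < N)%N -> (forall i, (i <= k)%N -> Y (iter i F x)) ->
      `|iter k F x - x| < eta -> expands a b F k x lam].
  elim: {HN}N => [|N [eta [lam [eta0 lam1 IH]]]].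
    by exists 1, 2; split=> //; [lra|move=> k x; rewrite ltn0 andbF].
  have [N0|/near_periodic[eta' [lam' [eta0' lam1' H]]]] := posnP N.
    exists 1, 2; split=> //; first by lra.
    by move=> k x; rewrite N0 ltnS => /andP[k0]; rewrite leqNgt k0.
  exists (Num.min eta eta'), (Num.min lam lam'); split; rewrite ?lt_min ?eta0 ?lam1 //.
  move=> k x /andP[k0]; rewrite ltnS leq_eqVlt => /predU1P[kN|kN] Yx; rewrite lt_min => /andP[e1 e2].
    apply: (@expands_le _ _ _ _ _ _ lam'); first by rewrite ge_min lexx orbT.
    by rewrite kN; apply: H => //; rewrite -?kN.
  apply: (@expands_le _ _ _ _ _ _ lam); first by rewrite ge_min lexx.
  by apply: IH => //; rewrite k0.
have cO := tile_lower DM r0 r1 Yab Yfree1.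
(* Here [Om] is the bound for one side, half of the constant in [tile_lower]; hence four copies in
   the exponent below. *)
pose Om := charge_bound a b C V r.
have W0 : 0 <= Om := charge_bound_ge0 DM 0 0%N r0.
exists (expR (- (Om + Om + (Om + Om)))), (Num.min 2 lam), eta; split => //.
- by rewrite expR_gt0 -expR0 ler_expR; lra.
- by rewrite lt_min lam1 andbT; lra.
move=> x n tl; split; first exact: cO.
move=> near; have [n0 Yx _ _] := tl.
have [le|lt] := leqP N n.
  by apply: (@expands_le _ _ _ _ _ _ 2); [rewrite ge_min lexx|exact: HN].
apply: (@expands_le _ _ _ _ _ _ lam); first by rewrite ge_min lexx orbT.
by apply: H => //; rewrite n0.
Qed.

(** * Counting the tiles that may fail to expand *)

Section Chain.
Context (c lam eta : R) (c01 : 0 < c <= 1) (lam1 : 1 < lam) (eta0 : 0 < eta).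
Context (growth : forall x n, tile F Y x n -> expands a b F n x c /\
    (`|iter n F x - x| < eta -> expands a b F n x lam)).

(** At a time that is not isolated some earlier point is within [eta], so the nearest one is as
    well, and the tile from it expands by [lam]. *)
Let isolated x i := `[< forall j, (j < i)%N -> eta <= `|iter i F x - iter j F x| >].
Let count x n := (\sum_(i < n.+1) isolated x i)%N.

Let c0 : 0 < c. Proof. by case/andP: c01. Qed.
Let c1 : c <= 1. Proof. by case/andP: c01. Qed.
Let lam0 : 0 < lam. Proof. exact: lt_trans lam1. Qed.

Let count_mono x j n : (j <= n)%N -> (count x j <= count x n)%N.
Proof.
move=> jn; rewrite /count -(subnKC jn) -addSn big_split_ord /=; exact: leq_addr.
Qed.

Let count_isolated x j n : (j < n)%N -> isolated x n -> (count x j < count x n)%N.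
Proof.
case: n => // n jn ex; rewrite {2}/count big_ord_recr /= ex addn1 ltnS.
exact: count_mono.
Qed.

(** The intervals of length [eta] to the right of the points at isolated times are disjoint and stay
    in [[a, b + eta]]. *)
Let count_bounded : exists E, forall x n,
  (forall i, (i <= n)%N -> Y (iter i F x)) -> (count x n <= E)%N.
Proof.
pose Psi z := Num.min (Num.max z a) (b + eta) - a.
pose B := b - a + eta.
have ab := dm_ab DM.
have B0 : 0 < B by rewrite /B; move: (eta0) => ?; lra.
exists (Num.bound (B / eta)) => x n Yx; rewrite -(ler_nat R).
apply: le_trans (ltW (archi_boundP _)); last by rewrite divr_ge0 // ltW.
rewrite ler_pdivlMr // natr_sum mulr_suml.
have Pnd : {homo Psi : y z / y <= z}.
  move=> y z yz; apply: lerB => //.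
  rewrite le_min [X in _ && X]ge_min lexx orbT andbT ge_min ge_max.
  by rewrite !le_max yz lexx !orbT.
have PB z : 0 <= Psi z <= B.
  rewrite /Psi subr_ge0 lerBlDr ge_min le_min le_max lexx orbT /=.
  by rewrite (_ : B + a = b + eta) ?lexx ?orbT ?andbT /B; move: (eta0) => ?; lra.
have := @disjoint_sum_ord _ n.+1 (isolated x) (fun i => iter i F x)
  (fun i => iter i F x + eta) Psi B Pnd PB.
have h1 i : (i < n.+1)%N -> iter i F x <= iter i F x + eta by move=> _; rewrite lerDl ltW.
have h2 i j : (i < n.+1)%N -> (j < n.+1)%N -> isolated x i -> isolated x j -> i != j ->
    iter i F x + eta <= iter j F x \/ iter j F x + eta <= iter i F x.
  move=> im jm ei ej; rewrite neq_ltn => ij.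
  have : eta <= `|iter i F x - iter j F x|.
    by case/orP: ij => ij; [rewrite distrC; move/asboolP: ej|move/asboolP: ei]; apply.
  by rewrite ler_normr => /orP[] ?; [right|left]; lra.
move=> /(_ h1 h2); rewrite big_mkcond /=; apply: le_trans.
apply: ler_sum => i _; case: (isolated x i); rewrite ?mul0r // mul1r.
have /Yab/andP[xa xb] := Yx i (ltnSE (ltn_ord i)).
have PsiE z : a <= z -> z <= b + eta -> Psi z = z - a.
  by move=> z1 z2; rewrite /Psi (max_idPl z1) (min_idPl z2).
by move: (eta0) => ?; rewrite !PsiE; lra.
Qed.

(** Induction removes the last tile. A tile of fewer than [N] steps raises [d] or the count, which
    preserves the linear bound on [n]; a single long tile already supplies all [D0] factors. *)
Let chain N D0 : (forall x n, (N <= n)%N -> tile F Y x n -> expands a b F n x (lam ^+ D0)) ->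
  forall n x, (forall i, (i <= n)%N -> Y (iter i F x)) ->
  exists2 d, expands a b F n x (c ^+ count x n * lam ^+ d) &
    ((n <= N * (d + count x n)) || (D0 <= d))%N.
Proof.
move=> long; elim/ltn_ind=> n IH x Yx.
have lamX d : 0 <= lam ^+ d by rewrite exprn_ge0 // ltW.
have cX k l d : (k <= l)%N -> c ^+ l * lam ^+ d <= c ^+ k * lam ^+ d.
  by move=> kl; rewrite ler_wpM2r // ler_wiXn2l // ltW.
have [n0|n0] := posnP n.
  exists 0%N; last by rewrite n0.
  rewrite n0; apply: (@expands_le _ _ _ _ _ _ 1).
    by rewrite expr0 mulr1 exprn_ile1 // ltW.
  by exists 1 => // y z _ _ _ _; rewrite mul1r.
have [j jn [tl near]] := exists_tile n0 Yx.
have Yj i : (i <= j)%N -> Y (iter i F x) by move=> ij; apply: Yx; exact: leq_trans ij (ltnW jn).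
have [d exd hd] := IH j jn x Yj.
have jn' : (j + (n - j) = n)%N by rewrite subnKC // ltnW.
have iE : iter (n - j) F (iter j F x) = iter n F x by rewrite -iterD subnK // ltnW.
have comp K : 0 <= K -> expands a b F (n - j) (iter j F x) K ->
    expands a b F n x (c ^+ count x j * lam ^+ d * K).
  by move=> K0 exK; rewrite -jn'; exact: (expands_comp DM).
have [le|lt] := leqP N (n - j).
  exists (d + D0)%N; last by rewrite leq_addl orbT.
  apply: expands_le (comp _ (lamX D0) (long _ _ le tl)).
  by rewrite -mulrA -exprD; apply/cX/count_mono/ltnW.
have nN m k : (m < k)%N -> (j <= N * m)%N -> (n <= N * k)%N.
  move=> mk jm; rewrite -jn'; apply: (@leq_trans (N * m.+1)%N); last by rewrite leq_mul2l mk orbT.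
  by rewrite mulnS addnC leq_add // ltnW.
have [ex|nex] := boolP (isolated x n).
  exists d.
    have [exc _] := growth tl; apply: expands_le (comp _ (ltW c0) exc).
    rewrite mulrAC -exprSr; apply: cX; exact: count_isolated.
  case/orP: hd => hd; last by rewrite hd orbT.
  apply/orP; left; apply: nN hd; rewrite ltn_add2l; exact: count_isolated.
exists d.+1.
  have [_] := growth tl; rewrite iE => exl.
  have /exl el : `|iter n F x - iter j F x| < eta.
    move/asboolPn: nex => /existsNP[i /not_implyP[ij /negP]]; rewrite -ltNge.
    by apply: le_lt_trans; exact: near.
  apply: expands_le (comp _ (ltW lam0) el).
  by rewrite -mulrA -exprSr; apply/cX/count_mono/ltnW.
case/orP: hd => hd; last by rewrite (leq_trans hd) ?orbT.
apply/orP; left; apply: nN hd.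
by rewrite addSn ltnS leq_add2l; apply/count_mono/ltnW.
Qed.

Let block : exists2 m, (0 < m)%N &
  forall x, (forall i, (i <= m)%N -> Y (iter i F x)) -> expands a b F m x (expR 1).
Proof.
have [E HE] := count_bounded.
have [D0 hD0] : exists D0, expR 1 <= c ^+ E * lam ^+ D0.
  pose h := lam - 1; have h0 : 0 < h by rewrite subr_gt0.
  have bern k : 1 + k%:R * h <= lam ^+ k.
    elim: k => [|k IHk]; first by rewrite mul0r addr0 expr0.
    rewrite exprS; apply: (@le_trans _ _ (lam * (1 + k%:R * h))); last by rewrite ler_pM2l.
    have : 0 <= k%:R * h * h by rewrite !mulr_ge0 // ltW.
    by rewrite (_ : lam = 1 + h) /h ?mulrSr; [nra|ring].
  exists (Num.bound (expR 1 / (c ^+ E * h))).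
  rewrite mulrC -ler_pdivrMr ?exprn_gt0 //; apply: le_trans (bern _).
  apply: (@le_trans _ _ (expR 1 / (c ^+ E * h) * h)).
    by rewrite invfM mulrA divfK ?gt_eqF.
  apply: (@le_trans _ _ ((Num.bound (expR 1 / (c ^+ E * h)))%:R * h)); last by rewrite lerDr.
  rewrite ler_pM2r //; apply/ltW/archi_boundP.
  by rewrite divr_ge0 ?expR_ge0 // mulr_ge0 ?exprn_ge0 // ltW.
have [N HN] := tile_large DM r0 r1 Yab Yfree1 Yfree Yrep (lam ^+ D0).
(* For this length and a count of at most [E], the linear alternative in [chain] is compatible only
   with [D0 <= d]. *)
exists (N * (D0 + E)).+1 => // x Yx.
have [d ex hd] := chain HN Yx.
have cE := HE x _ Yx; apply: expands_le ex; apply: le_trans hD0 _.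
have dD : (D0 <= d)%N.
  case/orP: hd => // hd; rewrite leqNgt; apply/negP => lt.
  by move: hd; rewrite ltnNge leq_mul2l (leq_add (ltnW lt) cE) orbT.
apply: ler_pM; rewrite ?exprn_ge0 ?(ltW c0) ?(ltW lam0) //.
  by rewrite ler_wiXn2l // ltW.
by rewrite ler_weXn2l // ltW.
Qed.

Lemma tiles_uniform : exists c' lam' : R, [/\ 0 < c', 1 < lam' & forall n x,
  (forall i, (i <= n)%N -> Y (iter i F x)) -> expands a b F n x (c' * lam' ^+ n)].
Proof.
have [m m0 Hm] := block.
(* Each full block of [m] steps gives [expR 1]; the incomplete last block loses at most [C ^+ m] and
   one factor [expR 1]. *)
exists (expR (- 1) * C ^- m), (expR (m%:R^-1)); split.
- by rewrite mulr_gt0 ?expR_gt0 // invr_gt0 exprn_gt0.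
- by rewrite expR_gt1 invr_gt0 ltr0n.
move=> n x Yx; have nE := divn_eq n m; have sm : (n %% m < m)%N by rewrite ltn_mod.
move: (n %/ m)%N (n %% m)%N nE sm => q s nE sm.
have exq : expands a b F (q * m) x (expR 1 ^+ q).
  have : (q * m <= n)%N by rewrite nE leq_addr.
  elim: q {nE} => [|q IH] qn.
    by exists 1 => // y z _ _ _ _; rewrite mul0n expr0 mul1r.
  rewrite mulSn addnC exprSr; apply: (expands_comp DM); first exact: expR_ge0.
    by apply: IH; apply: leq_trans qn; rewrite mulSn leq_addl.
  apply: Hm => i im; rewrite -iterD; apply: Yx.
  by apply: leq_trans qn; rewrite mulSn leq_add2r.
have exs : expands a b F s (iter (q * m) F x) (C ^- s).
  rewrite -exprVn -[X in _ ^+ X]card_ord -prodr_const.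
  apply: (expands_orbit DM (k := fun=> C^-1)) => t ts; split; first by rewrite invr_ge0 ltW.
  apply: (expands_lip DM r0); apply: Yfree1; rewrite -iterD; apply: Yx.
  by rewrite nE addnC leq_add2l ltnW.
have Cs0 : 0 <= C ^- s by rewrite invr_ge0 exprn_ge0 // ltW.
rewrite {1}nE; apply: expands_le (expands_comp DM Cs0 exq exs).
rewrite mulrAC; apply: ler_pM; rewrite ?mulr_ge0 ?expR_ge0 ?exprn_ge0 ?expR_ge0 //.
  by rewrite invr_ge0 exprn_ge0 // ltW.
- rewrite -!expRM_natl -expRD ler_expR mulr1 addrC lerBlDr natr1.
  rewrite ler_pdivrMr ?ltr0n // -natrM ler_nat nE mulSn addnC leq_add2r.
  exact: ltnW.
- rewrite lef_pV2 ?posrE ?exprn_gt0 //.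
  by apply: ler_weXn2l (ltnW sm); exact: dm_C DM.
Qed.

End Chain.

Lemma uniform_expansion : exists c lam : R, [/\ 0 < c, 1 < lam & forall n x,
  (forall i, (i <= n)%N -> Y (iter i F x)) -> expands a b F n x (c * lam ^+ n)].
Proof.
have [c [lam [eta [c01 lam1 eta0 H]]]] := tile_growth.
exact: (tiles_uniform c01 lam1 eta0 H).
Qed.

End Uniform.

(** * The extension of an interval map *)

Section Calculus.
Context {R : realType}.
Implicit Types (x y z c e r : R) (F G : R -> R).

Lemma finite_isolated (E : set R) x : finite_set E ->
  exists2 r, 0 < r & forall e, E e -> e != x -> r <= `|e - x|.
Proof.
move=> /finite_seqP[s ->]; elim: s => [|e s [r r0 IH]]; first by exists 1.
have [->|ex] := eqVneq e x.
  by exists r => // e'; rewrite /= inE => /predU1P[->|/IH//]; rewrite eqxx.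
exists (Num.min r `|e - x|); first by rewrite lt_min r0 normr_gt0 subr_eq0.
move=> e'; rewrite /= inE ge_min => /predU1P[->|/IH h /h ->//].
by rewrite lexx orbT.
Qed.

Lemma max_lip x y z : `|Num.max x z - Num.max y z| <= `|x - y|.
Proof.
wlog xy : x y / x <= y.
  by move=> W; case/orP: (le_total x y) => /W //; rewrite distrC (distrC y).
have mxy : Num.max x z <= Num.max y z by rewrite ge_max !le_max xy lexx orbT.
rewrite !ler0_norm ?subr_le0 //; move: mxy.
by case: (leP x z); case: (leP y z) => *; lra.
Qed.

Lemma min_lip x y z : `|Num.min x z - Num.min y z| <= `|x - y|.
Proof.
have := max_lip (- x) (- y) (- z); rewrite -!oppr_min -!opprD !normrN; exact.
Qed.
Lemma near_distP (P : R -> Prop) c :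
  (\forall y \near c, P y) <-> exists2 r, 0 < r & forall y, `|y - c| < r -> P y.
Proof.
split=> [/nbhs_ballP[r /= r0 H]|[r r0 H]].
  by exists r => // y yc; apply: H; rewrite /ball /= distrC.
by apply/nbhs_ballP; exists r => // y; rewrite /ball /= distrC; exact: H.
Qed.

Lemma derive_quotient F x d e : is_derive x 1 F d -> 0 < e -> exists2 r, 0 < r &
  forall h, h != 0 -> `|h| < r -> `|(F (x + h) - F x) / h - d| < e.
Proof.
move=> [dx <-] e0.
have : h^-1 *: (F (h *: (1 : R) + x) - F x) @[h --> (0 : R)^'] --> 'D_1 F x := dx.
move=> /cvgrPdist_lt/(_ e e0); rewrite near_withinE => /near_distP[r r0 H].
exists r => // h h0 hr; have := H h; rewrite subr0 => /(_ hr h0).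
by rewrite distrC /GRing.scale /= mulr1 mulrC (addrC h).
Qed.

(** When the interval is cut at an exceptional point, the larger of the two derivatives found
    dominates the mean slope; this is why an inequality replaces the equality. *)
Lemma mvt_except (E : seq R) F (dF : R -> R) y z : y < z -> continuous F ->
  (forall x, y < x < z -> x \notin E -> is_derive x 1 F (dF x)) ->
  exists x, [/\ y < x < z, x \notin E & F z - F y <= dF x * (z - y)].
Proof.
move=> yz cF; elim: E y z yz => [|e E IH] y z yz H.
  have [x|x xyz FE] := @MVT _ F dF y z yz _ (continuous_subspaceT cF).
    by rewrite in_itv /= => xyz; apply: H.
  by exists x; rewrite FE lexx; split=> //; move: xyz; rewrite in_itv.
have [/andP[ye ez]|out] := boolP (y < e < z).
  have H1 x : y < x < e -> x \notin E -> is_derive x 1 F (dF x).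
    move=> /andP[yx xe] xE; apply: H; first by rewrite yx (lt_trans xe).
    by rewrite inE negb_or xE lt_eqF.
  have H2 x : e < x < z -> x \notin E -> is_derive x 1 F (dF x).
    move=> /andP[ex xz] xE; apply: H; first by rewrite xz (lt_trans ye).
    by rewrite inE negb_or xE gt_eqF.
  have [x1 [/andP[h1 h1'] n1 F1]] := IH y e ye H1.
  have [x2 [/andP[h2 h2'] n2 F2]] := IH e z ez H2.
  have -> : F z - F y = (F e - F y) + (F z - F e) by ring.
  have [le|lt] := lerP (dF x1) (dF x2).
    exists x2; rewrite h2' (lt_trans ye) // inE negb_or n2 gt_eqF //; split=> //.
    apply: le_trans (lerD F1 F2) _.
    have -> : z - y = (e - y) + (z - e) by ring.
    by rewrite [leRHS]mulrDr lerD2r ler_wpM2r // subr_ge0 ltW.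
  exists x1; rewrite h1 (lt_trans h1') // inE negb_or n1 lt_eqF //; split=> //.
  apply: le_trans (lerD F1 F2) _.
  have -> : z - y = (e - y) + (z - e) by ring.
  by rewrite [leRHS]mulrDr lerD2l ler_wpM2r ?ltW // subr_gt0.
have ne x : y < x < z -> x != e by apply: contraTneq => ->.
have [x [xyz xE FE]] : exists x, [/\ y < x < z, x \notin E & F z - F y <= dF x * (z - y)].
  by apply: IH => // x xyz xE; apply: H; rewrite // inE negb_or xE ne.
by exists x; rewrite inE negb_or xE ne.
Qed.

Definition extremal F c := (exists2 r, 0 < r & forall y, `|y - c| < r -> F y <= F c) \/
  (exists2 r, 0 < r & forall y, `|y - c| < r -> F c <= F y).

Lemma no_extremum_neq F y z : y < z -> continuous F ->
  (forall c, y < c < z -> ~ extremal F c) -> F y != F z.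
Proof.
move=> yz cF ext; apply/eqP => FE.
have near c : y < c < z -> exists2 r, 0 < r & forall x, `|x - c| < r -> y <= x <= z.
  move=> /andP[yc cz]; exists (Num.min (c - y) (z - c)); first by rewrite lt_min !subr_gt0 yc.
  move=> x; rewrite lt_min !ltr_distl => /andP[/andP[? ?] /andP[? ?]].
  by between.
have [c cyz cmax] := EVT_max (ltW yz) (continuous_subspaceT cF).
have [c' cyz' cmin] := EVT_min (ltW yz) (continuous_subspaceT cF).
rewrite !in_itv /= in cyz cyz'.
have [cy|cy] := boolP (y < c < z).
  have [r r0 Hr] := near c cy; apply: (ext c cy); left; exists r => // x /Hr xyz.
  by apply: cmax; rewrite in_itv.
have [cy'|cy'] := boolP (y < c' < z).
  have [r r0 Hr] := near c' cy'; apply: (ext c' cy'); right; exists r => // x /Hr xyz.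
  by apply: cmin; rewrite in_itv.
have end_ d : y <= d <= z -> ~~ (y < d < z) -> F d = F y.
  move=> /andP[]; rewrite le_eqVlt => /predU1P[<-//|yd].
  by rewrite le_eqVlt yd => /predU1P[->//|->].
have const x : y <= x <= z -> F x = F y.
  move=> xyz; apply/eqP; rewrite eq_le.
  rewrite -{1}(end_ c cyz cy) cmax ?in_itv //=.
  by rewrite -(end_ c' cyz' cy') cmin ?in_itv.
have m : y < (y + z) / 2 < z by between.
have [r r0 Hr] := near _ m; apply: (ext _ m); left; exists r => // x /Hr/const ->.
by rewrite const //; move/andP: m => [? ?]; between.
Qed.

End Calculus.

Section Extend.
Context {R : realType} (a b : R) (ab : a < b) (f : R -> R) (E : seq R) (C : R).
Context (cf : {within `[a, b], continuous f}) (fab : forall x, a <= x <= b -> a <= f x <= b).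
Context (Ed : forall x, a < x < b -> x \notin E -> derivable f x 1).
Context (C1 : 1 <= C).
Context (Eb : forall x, a < x < b -> x \notin E -> C^-1 <= `|derive1 f x| <= C).
Context (bv : bounded_variation a b (fun x => ln `|derive1 f x|)).
Implicit Types (x y z c e r u v : R).

Let T := turning_points a b f.

Let C0 : 0 < C := lt_le_trans ltr01 C1.

Let clip x := Num.max a (Num.min x b).
(* The slope of the extension beyond an endpoint is chosen so that the endpoint does not become
   a turning point. *)
Let sa : R := if `[< exists2 r, 0 < r & forall x, a < x < a + r -> f a < f x >] then 1 else -1.
Let sb : R := if `[< exists2 r, 0 < r & forall x, b - r < x < b -> f x < f b >] then 1 else -1.

Definition extension x := f (clip x) + sa * Num.min (x - a) 0 + sb * Num.max (x - b) 0.
Let F := extension.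

Let clip_itv x : a <= clip x <= b.
Proof. by rewrite /clip le_max lexx ge_max (ltW ab) ge_min lexx orbT. Qed.

Let clipE x : a <= x <= b -> clip x = x.
Proof. by move=> /andP[ax xb]; rewrite /clip (min_idPl xb) (max_idPr ax). Qed.

Let clip_nd : {homo clip : x y / x <= y}.
Proof.
move=> x y xy; rewrite /clip ge_max le_max lexx /= le_max; apply/orP; right.
by rewrite le_min !ge_min xy lexx orbT.
Qed.

Let clip_lip x y : `|clip x - clip y| <= `|x - y|.
Proof.
wlog xy : x y / x <= y.
  move=> H; case/orP: (le_total x y) => [/H//|/H]; by rewrite distrC (distrC y).
rewrite distrC (distrC x) !ger0_norm ?subr_ge0 ?clip_nd // /clip.
case: (lerP x b); case: (lerP y b) => h1 h2; rewrite ?(max_idPr (ltW ab)) //;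
  rewrite /Num.max; do ?case: ifP; move: (ab) => ?; lra.
Qed.

Lemma extensionE x : a <= x <= b -> F x = f x.
Proof.
move=> xab; have /andP[ax xb] := xab; rewrite /F /extension clipE //.
by rewrite (min_idPr _) ?subr_ge0 // (max_idPr _) ?subr_le0 // !mulr0 !addr0.
Qed.

Let F_left x : x <= a -> F x = f a + sa * (x - a).
Proof.
move=> xa; have xb := le_trans xa (ltW ab); rewrite /F /extension /clip (min_idPl xb) (max_idPl xa).
by rewrite (min_idPl _) ?subr_le0 // (max_idPr _) ?subr_le0 // mulr0 addr0.
Qed.

Let F_right x : b <= x -> F x = f b + sb * (x - b).
Proof.
move=> bx; have ax := le_trans (ltW ab) bx; rewrite /F /extension /clip (min_idPr bx) (max_idPr (ltW ab)).
by rewrite (min_idPr _) ?subr_ge0 // (max_idPl _) ?subr_ge0 // mulr0 addr0.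
Qed.

Let sa1 : `|sa| = 1. Proof. by rewrite /sa; case: ifP; rewrite ?normrN1 ?normr1. Qed.
Let sb1 : `|sb| = 1. Proof. by rewrite /sb; case: ifP; rewrite ?normrN1 ?normr1. Qed.

Let f_near x e : a <= x <= b -> 0 < e -> exists2 d, 0 < d & forall y, a <= y <= b -> `|y - x| < d ->
  `|f y - f x| < e.
Proof.
move=> xab e0; have xI : [set` `[a, b]] x by rewrite /= in_itv.
have /subspace_continuousP/(_ x xI)/cvgrPdist_lt/(_ e e0) := cf.
rewrite near_withinE => /nbhs_ballP[d /= d0 Hd]; exists d => // y yab yx.
by rewrite distrC; apply: Hd; rewrite /ball /= ?in_itv //= distrC.
Qed.

Let F_cont : continuous F.
Proof.
move=> x; apply/cvgrPdist_lt => e e0.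
have e3 : 0 < e / 3 by rewrite divr_gt0.
have [d d0 Hd] := f_near (clip_itv x) e3.
apply/nbhs_ballP; exists (Num.min d (e / 3)); first by rewrite /= lt_min d0.
move=> y; rewrite /ball /= lt_min => /andP[yd ye].
have h1 : `|f (clip y) - f (clip x)| < e / 3.
  by apply: Hd => //; rewrite distrC; apply: le_lt_trans (clip_lip _ _) _.
have h2 : `|sa * Num.min (x - a) 0 - sa * Num.min (y - a) 0| < e / 3.
  rewrite -mulrBr normrM sa1 mul1r; apply: le_lt_trans ye.
  by apply: le_trans (min_lip _ _ _) _; rewrite (_ : x - a - (y - a) = x - y) //; ring.
have h3 : `|sb * Num.max (x - b) 0 - sb * Num.max (y - b) 0| < e / 3.
  rewrite -mulrBr normrM sb1 mul1r; apply: le_lt_trans ye.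
  by apply: le_trans (max_lip _ _ _) _; rewrite (_ : x - b - (y - b) = x - y) //; ring.
move: h1 h2 h3; rewrite /F /extension.
move: (sa * _) (sa * _) (sb * _) (sb * _) => p q p' q'.
by rewrite !ltr_norml => /andP[? ?] /andP[? ?] /andP[? ?]; between.
Qed.

Let near_extremal c : a < c < b -> extremal F c -> T c.
Proof.
move=> /[dup] cab /andP[ac cb] ext; split=> //.
have H (r : R) : 0 < r -> \forall y \near c, (a <= y <= b) && (`|y - c| < r).
  move=> r0; apply/near_distP; exists (Num.min r (Num.min (c - a) (b - c))).
    by rewrite /= !lt_min r0 !subr_gt0 ac.
  move=> y; rewrite !lt_min => /andP[yr]; rewrite yr andbT.
  rewrite !ltr_distl => /andP[/andP[? ?] /andP[? ?]].
  by between.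
case: ext => -[r r0 Hr]; [left|right]; near=> y;
  have /andP[yab yr] : (a <= y <= b) && (`|y - c| < r) by near: y; exact: H.
  by have := Hr y yr; rewrite !extensionE // !ltW.
by have := Hr y yr; rewrite !extensionE // !ltW.
Unshelve. all: by end_near.
Qed.

Let not_extremal c :
  (forall r, 0 < r -> exists y z, [/\ `|y - c| < r, `|z - c| < r, F y < F c & F c < F z]) ->
  ~ extremal F c.
Proof.
move=> H [] [r r0 Hr]; have [y [z [yr zr yc cz]]] := H r r0.
  by have := Hr z zr; rewrite leNgt cz.
by have := Hr y yr; rewrite leNgt yc.
Qed.

(** At a turning point outside [E] the derivative would vanish, against the lower bound [C^-1]. *)
Let T_E t : T t -> t \in E.
Proof.
move=> [tab ext]; apply: contraT => tE.
have [r r0 Hr] := finite_isolated t (finite_seq E).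
have /andP[at_ tb] := tab.
have Ht := Eb tab tE.
suff : derive1 f t = 0 by move=> d0; move: Ht; rewrite d0 normr0 leNgt invr_gt0 C0.
rewrite derive1E.
have loc (P : R -> Prop) : (\forall y \near t, P y) -> exists2 d, 0 < d &
    [/\ a <= t - d, t + d <= b, forall y, t - d < y < t + d -> P y & d <= r].
  move=> /near_distP[d d0 Hd]; exists (Num.min d (Num.min r (Num.min (t - a) (b - t)))).
    by rewrite !lt_min d0 r0 !subr_gt0 at_.
  set m := Num.min _ _.
  have [m1 m2 m3 m4] : [/\ m <= d, m <= r, m <= t - a & m <= b - t].
    by rewrite /m !ge_min !lexx !orbT.
  split=> //; [lra|lra|move=> y yt; apply: Hd; rewrite ltr_distl].
  by move/andP: yt => [? ?]; between.
have der d : 0 < d -> d <= r -> a <= t - d -> t + d <= b ->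
    forall y, y \in `]t - d, t + d[ -> derivable f y 1.
  move=> d0 dr ad db y; rewrite in_itv /= => /andP[y1 y2].
  apply: Ed; first by between.
  have [->//|yt] := eqVneq y t.
  apply/negP => yE; have := Hr y yE yt; rewrite leNgt => /negP; apply.
  by rewrite ltr_distl; between.
have mid d : 0 < d -> t \in `]t - d, t + d[ by rewrite in_itv /= => ?; between.
case: ext => /loc[d d0 [ad db Hd dr]].
  have D := derive1_at_max (ltac:(lra) : t - d <= t + d) (der d d0 dr ad db) (mid d d0)
    (fun y yt => Hd y (ltac:(by move: yt; rewrite in_itv))).
  exact: (@derive_val _ _ _ _ _ _ _ D).
have D := derive1_at_min (ltac:(lra) : t - d <= t + d) (der d d0 dr ad db) (mid d d0)
  (fun y yt => Hd y (ltac:(by move: yt; rewrite in_itv))).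
exact: (@derive_val _ _ _ _ _ _ _ D).
Qed.

Lemma turning_points_finite : finite_set T.
Proof. by apply: sub_finite_set (finite_seq E) => t; exact: T_E. Qed.

(** Beyond the endpoints the slope is 1 or -1, and at an endpoint [sa] or [sb] continues the
    direction taken inside. Strictness comes from [inj]: an equal value nearby would enclose another
    turning point. *)
Let extremal_T c : extremal F c -> T c.
Proof.
move=> ext.
have inj c0 r0 : 0 < r0 -> (forall t, T t -> t != c0 -> r0 <= `|t - c0|) ->
    forall x, a <= x <= b -> a <= c0 <= b -> x != c0 -> `|x - c0| < r0 -> f x != f c0.
  move=> r00 H x xab cab xc xr; rewrite -!extensionE //.
  have key y z : a <= y <= b -> a <= z <= b -> y < z -> (forall t, y < t < z -> t != c0 /\ `|t - c0| < r0) ->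
      F y != F z.
    move=> /andP[ay yb] /andP[az zb] yz Hyz; apply: no_extremum_neq => // t tyz ext'.
    have [tc tr] := Hyz t tyz.
    have tT : T t by apply: near_extremal => //; move/andP: tyz => [? ?]; between.
    by have := H t tT tc; rewrite leNgt tr.
  move: xr; rewrite ltr_distl => /andP[? ?].
  move: xc; rewrite neq_lt => /orP[lt|lt].
    apply: key => // t /andP[? ?]; rewrite lt_eqF //; split=> //.
    by rewrite ltr_distl; between.
  rewrite eq_sym; apply: key => // t /andP[? ?]; rewrite gt_eqF //; split=> //.
  by rewrite ltr_distl; between.
have aab : a <= a <= b by rewrite lexx ltW.
have bab : a <= b <= b by rewrite lexx ltW.
have sgn (s d : R) : `|s| = 1 -> 0 < d -> s * d < 0 /\ 0 < s * (- d) \/ s * (- d) < 0 /\ 0 < s * d.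
  by move=> /eqP; rewrite eqr_norml => /andP[/orP[]/eqP-> _] d0; [right|left]; lra.
have half3 (p q w : R) : 0 < p -> 0 < q -> 0 < w -> exists d, [/\ 0 < d, d < p, d < q & d < w].
  move=> p0 q0 w0; exists (Num.min p (Num.min q w) / 2).
  set m := Num.min p _; have m0 : 0 < m by rewrite !lt_min p0 q0.
  have [? ? ?] : [/\ m <= p, m <= q & m <= w] by rewrite /m !ge_min !lexx !orbT.
  by split; lra.
have [ac|ca|ca] := ltrgtP c a.
- exfalso; apply: not_extremal ext => r r0.
  have ac0 : 0 < a - c by rewrite subr_gt0.
  have [d [d0 dr da _]] := half3 _ _ 1 r0 ac0 ltr01.
  have h1 : `|c + d - c| < r by rewrite addrAC subrr add0r gtr0_norm.
  have h2 : `|c - d - c| < r by rewrite addrAC subrr add0r normrN gtr0_norm.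
  have E1 : F (c + d) = F c + sa * d by rewrite !F_left; try lra; ring.
  have E2 : F (c - d) = F c + sa * (- d) by rewrite !F_left; try lra; ring.
  by case: (sgn sa d sa1 d0) => -[s1 s2]; [exists (c + d), (c - d)|exists (c - d), (c + d)];
    rewrite E1 E2; split=> //; lra.
- have [bc|cb|cb] := ltrgtP b c.
  + exfalso; apply: not_extremal ext => r r0.
    have cb0 : 0 < c - b by rewrite subr_gt0.
    have [d [d0 dr dc _]] := half3 _ _ 1 r0 cb0 ltr01.
    have h1 : `|c + d - c| < r by rewrite addrAC subrr add0r gtr0_norm.
    have h2 : `|c - d - c| < r by rewrite addrAC subrr add0r normrN gtr0_norm.
    have E1 : F (c + d) = F c + sb * d by rewrite !F_right; try lra; ring.
    have E2 : F (c - d) = F c + sb * (- d) by rewrite !F_right; try lra; ring.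
    by case: (sgn sb d sb1 d0) => -[s1 s2]; [exists (c + d), (c - d)|exists (c - d), (c + d)];
      rewrite E1 E2; split=> //; lra.
  + by apply: near_extremal => //; rewrite ca.
  + exfalso; rewrite -cb in ext; apply: not_extremal ext => r r0.
    have [r1 r10 Hr1] := finite_isolated b turning_points_finite.
    have ba0 : 0 < b - a by rewrite subr_gt0.
    have [d [d0 dr dr1 dab]] := half3 _ _ _ r0 r10 ba0.
    have h1 : `|b + d - b| < r by rewrite addrAC subrr add0r gtr0_norm.
    have E1 : F (b + d) = F b + sb * d by rewrite !F_right; try lra; ring.
    have Fb : F b = f b by apply: extensionE.
    move: E1; rewrite /sb; case: ifPn => [/asboolP[rho rho0 Hrho]|/asboolPn H] E1.
      have [e [e0 ed erho _]] := half3 _ _ 1 d0 rho0 ltr01.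
      have eab : a <= b - e <= b by between.
      exists (b - e), (b + d); split=> //.
      * by rewrite addrAC subrr add0r normrN gtr0_norm //; lra.
      * by rewrite Fb extensionE //; apply: Hrho; between.
      * by rewrite E1; lra.
    (* Here [sb = -1]: the extension decreases to the right of [b], while larger values occur
       arbitrarily close on the left. *)
    have [x /andP[x1 x2] xb] : exists2 x, b - d < x < b & f b <= f x.
      apply: contrapT => nx; apply: H; exists d => // x xd; rewrite ltNge.
      by apply/negP => le; apply: nx; exists x.
    have xab : a <= x <= b by between.
    exists (b + d), x; split=> //.
    * by rewrite ltr_distl; between.
    * by rewrite E1; lra.
    * rewrite Fb extensionE // lt_def xb andbT.
      apply: (inj b r1) => //; first by rewrite lt_eqF.
      by rewrite ltr_distl; between.
- exfalso; rewrite ca in ext; apply: not_extremal ext => r r0.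
  have [r1 r10 Hr1] := finite_isolated a turning_points_finite.
  have ba0 : 0 < b - a by rewrite subr_gt0.
  have [d [d0 dr dr1 dab]] := half3 _ _ _ r0 r10 ba0.
  have h1 : `|a - d - a| < r by rewrite addrAC subrr add0r normrN gtr0_norm.
  have E1 : F (a - d) = F a - sa * d by rewrite !F_left; try lra; ring.
  have Fa : F a = f a by apply: extensionE.
  move: E1; rewrite /sa; case: ifPn => [/asboolP[rho rho0 Hrho]|/asboolPn H] E1.
    have [e [e0 ed erho _]] := half3 _ _ 1 d0 rho0 ltr01.
    have eab : a <= a + e <= b by between.
    exists (a - d), (a + e); split=> //.
    + by rewrite addrAC subrr add0r gtr0_norm //; lra.
    + by rewrite E1; lra.
    + by rewrite Fa extensionE //; apply: Hrho; between.
  have [x /andP[x1 x2] xb] : exists2 x, a < x < a + d & f x <= f a.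
    apply: contrapT => nx; apply: H; exists d => // x xd; rewrite ltNge.
    by apply/negP => le; apply: nx; exists x.
  have xab : a <= x <= b by between.
  exists x, (a - d); split=> //.
  + by rewrite ltr_distl; between.
  + rewrite Fa extensionE // lt_def xb andbT eq_sym.
    apply: (inj a r1) => //; first by rewrite gt_eqF.
    by rewrite ltr_distl; between.
  + by rewrite E1; lra.
Qed.

Let dF x : R := if a < x < b then derive1 f x else if x <= a then sa else sb.

Let affine_derive (p q s x : R) : is_derive x 1 (fun y => p + s * (y - q)) s.
Proof.
have D := is_deriveD (is_derive_cst p x 1)
  (is_deriveZ s (is_deriveB (is_derive_id x 1) (is_derive_cst q x 1))).
by apply: is_derive_eq D _; rewrite add0r subr0 /GRing.scale /= mulr1.
Qed.

Let F_derive x : x \notin E -> x != a -> x != b -> is_derive x 1 F (dF x).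
Proof.
move=> xE; rewrite /dF; case: (ltrgtP x a) => //= xa _; case: (ltrgtP x b) => //= xb _.
- apply: near_eq_is_derive (affine_derive (f a) a sa x); apply/near_distP; exists (a - x).
    by rewrite subr_gt0.
  by move=> y; rewrite ltr_distl => /andP[? ?]; rewrite F_left //; lra.
- by move: (lt_trans xa (lt_trans ab xb)); rewrite ltxx.
- have D : is_derive x 1 f (derive1 f x).
    by rewrite derive1E; apply: derivableP; apply: Ed; rewrite // xa.
  apply: near_eq_is_derive D; apply/near_distP; exists (Num.min (x - a) (b - x)).
    by rewrite lt_min !subr_gt0 xa.
  move=> y; rewrite lt_min !ltr_distl => /andP[/andP[? ?] /andP[? ?]].
  by rewrite extensionE //; between.
- apply: near_eq_is_derive (affine_derive (f b) b sb x); apply/near_distP; exists (x - b).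
    by rewrite subr_gt0.
  by move=> y; rewrite ltr_distl => /andP[? ?]; rewrite F_right //; lra.
Qed.

Let dF_bound x : x \notin E -> C^-1 <= `|dF x| <= C.
Proof.
move=> xE; rewrite /dF; case: ifPn => [xab|_]; first exact: Eb.
have C1' : C^-1 <= 1 <= C by rewrite invf_le1 // C1.
by case: ifP => _; rewrite ?sa1 ?sb1.
Qed.

Let lnC0 : 0 <= ln C. Proof. exact: ln_ge0. Qed.

Let ln_dF x : x \notin E -> `|ln `|dF x| | <= ln C.
Proof.
move=> /dF_bound/andP[h1 h2]; have d0 : 0 < `|dF x| by apply: lt_le_trans h1; rewrite invr_gt0.
rewrite ler_norml -lnV ?posrE // !ler_ln ?posrE ?invr_gt0 //.
by rewrite h1.
Qed.

Let g x := ln `|derive1 f x|.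
Let tv x := fine (total_variation a x g).

Let tv_fin x : a <= x <= b -> total_variation a x g \is a fin_num.
Proof.
by move=> /andP[ax xb]; apply/(bounded_variationP _ ax); exact: bounded_variationl bv.
Qed.

Let tv_dist x y : a <= x -> x <= y -> y <= b -> `|g y - g x| <= tv y - tv x.
Proof.
move=> ax xy yb; have ay := le_trans ax xy; have xb := le_trans xy yb.
have fx := tv_fin (introT andP (conj ax xb)).
have fxy : total_variation x y g \is a fin_num.
  apply/(bounded_variationP _ xy); apply: (bounded_variationr ax xy).
  exact: (bounded_variationl ay yb bv).
rewrite /tv (total_variationD g ax xy) fineD; [|exact: fx|exact: fxy].
rewrite addrAC subrr add0r -lee_fin fineK; last exact: fxy.
exact: total_variation_ge.
Qed.

Let tv_nd x y : a <= x -> x <= y -> y <= b -> tv x <= tv y.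
Proof. by move=> ax xy yb; rewrite -subr_ge0; apply: le_trans (tv_dist ax xy yb). Qed.

(** Since ln|DF| vanishes beyond the endpoints and is at most [ln C] in absolute value inside, off
    [E], a jump of [ln C] at each endpoint pays for the transition. *)
Let Phi x := tv (clip x) + ln C * ((a <= x)%R%:R + (b <= x)%R%:R).
Let V := tv b + ln C * 2.

Let tva : tv a = 0. Proof. by rewrite /tv total_variationxx. Qed.

Let jump_nd : {homo (fun z => (a <= z)%R%:R + (b <= z)%R%:R : R) : y z / y <= z}.
Proof.
move=> y z yz; apply: lerD; rewrite ler_nat.
  by case: (lerP a y) => // /le_trans/(_ yz) ->.
by case: (lerP b y) => // /le_trans/(_ yz) ->.
Qed.

Let Phi_nd : {homo Phi : x y / x <= y}.
Proof.
move=> x y xy; rewrite /Phi; apply: lerD; last by rewrite ler_wpM2l // jump_nd.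
have /andP[? _] := clip_itv x; have /andP[_ ?] := clip_itv y.
by apply: tv_nd => //; exact: clip_nd.
Qed.

Let Phi_bnd x : 0 <= Phi x <= V.
Proof.
have /andP[c1 c2] := clip_itv x; rewrite /Phi /V; apply/andP; split.
  by rewrite addr_ge0 ?mulr_ge0 ?addr_ge0 // -tva; apply: tv_nd.
apply: lerD; first exact: tv_nd.
by rewrite ler_wpM2l //; case: (a <= x); case: (b <= x) => /=; lra.
Qed.

Let left_part x : x < a -> ln `|dF x| = 0 /\ Phi x = 0.
Proof.
move=> xa; have xb := lt_trans xa ab; rewrite /dF /Phi (lt_gtF xa) /= (ltW xa) sa1 ln1.
rewrite (lt_geF xa) (lt_geF xb) addr0 mulr0 addr0 /clip (min_idPl (ltW xb)) (max_idPl (ltW xa)).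
by rewrite tva.
Qed.

Let middle_part x : a < x < b -> ln `|dF x| = g x /\ Phi x = tv x + ln C.
Proof.
move=> /[dup] xab /andP[ax xb]; rewrite /dF xab /Phi (ltW ax) (lt_geF xb) addr0 mulr1 clipE //.
by rewrite !ltW.
Qed.

Let right_part x : b < x -> ln `|dF x| = 0 /\ Phi x = V.
Proof.
move=> bx; have ax := lt_trans ab bx; rewrite /dF /Phi ax (lt_gtF bx) /= (lt_geF ax) sb1 ln1.
by rewrite (ltW bx) (ltW ax) /clip (min_idPr (ltW bx)) (max_idPr (ltW ab)).
Qed.

Let ln_var x y : x < y -> x \notin E -> y \notin E -> x != a -> x != b -> y != a -> y != b ->
  `|ln `|dF y| - ln `|dF x| | <= Phi y - Phi x.
Proof.
move=> xy xE yE xa xb ya yb.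
have reg z : z != a -> z != b -> [\/ z < a, a < z < b | b < z].
  rewrite neq_lt => /orP[za|az]; first by constructor 1.
  by rewrite neq_lt => /orP[zb|bz]; [constructor 2; rewrite az|constructor 3].
have lx := ln_dF xE; have ly := ln_dF yE; have l0 := lnC0.
have alg (p q l : R) : p + l - (q + l) = p - q by ring.
have alg2 (p q l : R) : p + l * 2 - (q + l) = l + (p - q) by ring.
case: (reg x xa xb) => hx; case: (reg y ya yb) => hy.
- have [-> ->] := left_part hx; have [-> ->] := left_part hy.
  by rewrite subrr normr0.
- have [-> ->] := left_part hx; have [_ ->] := middle_part hy.
  have /andP[ay yb'] := hy; have := tv_nd (lexx a) (ltW ay) (ltW yb'); rewrite tva !subr0.
  by move=> h; apply: le_trans ly _; rewrite lerDr.
- have [-> ->] := left_part hx; have [-> ->] := right_part hy.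
  by rewrite !subr0 normr0; have /andP[h _] := Phi_bnd b; apply: le_trans h (proj2 (andP (Phi_bnd b))).
- by move: hx => /andP[ax _]; have := lt_trans ax (lt_trans xy hy); rewrite ltxx.
- have [-> ->] := middle_part hx; have [-> ->] := middle_part hy.
  have /andP[ax _] := hx; have /andP[_ yb'] := hy.
  by rewrite [leRHS]alg; apply: tv_dist (ltW ax) (ltW xy) (ltW yb').
- have [_ ->] := middle_part hx; have [-> ->] := right_part hy.
  have /andP[ax xb'] := hx; have := tv_nd (ltW ax) (ltW xb') (lexx b).
  rewrite sub0r normrN /V => h; apply: le_trans lx _.
  by rewrite [leRHS]alg2 lerDl subr_ge0.
- by have := lt_trans hx (lt_trans xy hy); rewrite ltNge (ltW ab).
- by move: hy => /andP[_ yb']; have := lt_trans hx (lt_trans xy yb'); rewrite ltxx.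
- have [-> ->] := right_part hx; have [-> ->] := right_part hy.
  by rewrite !subrr normr0.
Qed.

Let E' := a :: b :: E.

Let mvt_upper y z : y < z -> exists x, [/\ y < x < z, x \notin E' &
  `|F z - F y| <= `|dF x| * (z - y)].
Proof.
move=> yz; have D x : x \notin E' -> is_derive x 1 F (dF x).
  by rewrite !inE !negb_or => /and3P[xa xb xE]; apply: F_derive.
have zy0 : 0 <= z - y by rewrite subr_ge0 ltW.
case/orP: (le_total (F y) (F z)) => le.
  have [x [h1 h2 h3]] := @mvt_except _ E' F dF y z yz F_cont (fun x _ => D x).
  exists x; split=> //; rewrite ger0_norm ?subr_ge0 //; apply: le_trans h3 _.
  by rewrite ler_wpM2r // ler_norm.
have cN : continuous (\- F) by move=> x; apply: cvgN; exact: F_cont.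
have DN x : y < x < z -> x \notin E' -> is_derive x 1 (\- F) (- dF x).
  by move=> _ /D Dx; apply: is_deriveN.
have [x [h1 h2 h3]] := mvt_except yz cN DN.
exists x; split=> //; rewrite ler0_norm ?subr_le0 //.
move: h3 => /=; rewrite opprB opprK addrC => h3; apply: le_trans h3 _.
by rewrite ler_wpM2r // -normrN ler_norm.
Qed.

Let mono u v : turn_free T u v ->
  (forall y z, u <= y -> y < z -> z <= v -> F y < F z) \/
  (forall y z, u <= y -> y < z -> z <= v -> F z < F y).
Proof.
move=> fr; have inj : {in `[u, v] &, injective F}.
  move=> y z; rewrite !in_itv /= => /andP[uy yv] /andP[uz zv] FE.
  have key y' z' : u <= y' -> z' <= v -> y' < z' -> F y' != F z'.
    move=> h1 h2 lt; apply: no_extremum_neq => // c /andP[yc cz] /extremal_T /fr; apply.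
    by apply/andP; split; [exact: le_lt_trans yc|exact: lt_le_trans h2].
  case: (ltrgtP y z) => // lt; first by have := key _ _ uy zv lt; rewrite FE eqxx.
  by have := key _ _ uz yv lt; rewrite FE eqxx.
have [h|h] := itv_continuous_inj_mono (continuous_subspaceT F_cont) inj; [left|right];
  move=> y z uy yz zv; apply: h => //; rewrite in_itv /=.
all: by between.
Qed.

(** Monotonicity on a turn-free interval fixes the sign of [dF], so that [mvt_except], applied to
    [F] or its negative, bounds the absolute value. *)
Let mvt_lower u v y z : turn_free T u v -> u <= y -> y < z -> z <= v ->
  exists x, [/\ y < x < z, x \notin E' & `|dF x| * (z - y) <= `|F z - F y|].
Proof.
move=> fr uy yz zv; have D x : x \notin E' -> is_derive x 1 F (dF x).
  by rewrite !inE !negb_or => /and3P[xa xb xE]; apply: F_derive.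
have small x (r : R) : y < x < z -> 0 < r -> exists h, [/\ 0 < h, h < r & x + h <= v].
  move=> /andP[yx xz] r0; exists (Num.min r (z - x) / 2).
  set m := Num.min _ _; have m0 : 0 < m by rewrite lt_min r0 subr_gt0.
  have [? ?] : m <= r /\ m <= z - x by rewrite /m !ge_min !lexx orbT.
  by split; lra.
case: (mono fr) => mon.
- have ge0 x : y < x < z -> x \notin E' -> 0 <= dF x.
    move=> xyz /D Dx; rewrite leNgt; apply/negP => lt0.
    have [r r0 Hr] := derive_quotient Dx (ltac:(by rewrite oppr_gt0) : 0 < - dF x).
    have [h [h0 hr xv]] := small x r xyz r0; have /andP[yx xz] := xyz.
    have := Hr h (ltac:(by rewrite gt_eqF)) (ltac:(by rewrite gtr0_norm)).
    rewrite ltr_norml => /andP[_]; rewrite ltrBlDr addNr ltNge => /negP; apply.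
    apply: divr_ge0; last exact: ltW.
    rewrite subr_ge0 ltW //; apply: mon => //; [exact: le_trans uy (ltW yx)|by rewrite ltrDl].
  have cN : continuous (\- F) by move=> x; apply: cvgN; exact: F_cont.
  have DN x : y < x < z -> x \notin E' -> is_derive x 1 (\- F) (- dF x).
    by move=> _ /D Dx; apply: is_deriveN.
  have [x [h1 h2 h3]] := mvt_except yz cN DN.
  exists x; split=> //; rewrite !ger0_norm ?ge0 ?subr_ge0 ?(ltW (mon _ _ _ _ _)) //.
  by move: h3 => /=; rewrite mulNr -opprD lerN2.
- have le0 x : y < x < z -> x \notin E' -> dF x <= 0.
    move=> xyz /D Dx; rewrite leNgt; apply/negP => lt0.
    have [r r0 Hr] := derive_quotient Dx lt0.
    have [h [h0 hr xv]] := small x r xyz r0; have /andP[yx xz] := xyz.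
    have := Hr h (ltac:(by rewrite gt_eqF)) (ltac:(by rewrite gtr0_norm)).
    rewrite ltr_norml => /andP[+ _]; rewrite ltrBrDr addNr pmulr_lgt0 ?invr_gt0 // subr_gt0.
    apply/negP; rewrite -leNgt ltW //.
    apply: mon => //; [exact: le_trans uy (ltW yx)|by rewrite ltrDl].
  have [x [h1 h2 h3]] := @mvt_except _ E' F dF y z yz F_cont (fun x _ => D x).
  exists x; split=> //; rewrite !ler0_norm ?le0 ?subr_le0 ?(ltW (mon _ _ _ _ _)) //.
  by rewrite mulNr lerN2.
Qed.

Lemma extension_denjoy : denjoy_map a b F T C V Phi.
Proof.
have bound x : x \notin E' -> C^-1 <= `|dF x| <= C.
  by rewrite !inE !negb_or => /and3P[_ _ xE]; exact: dF_bound.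
have ratio u v x x' : u < x < v -> u < x' < v -> x \notin E' -> x' \notin E' ->
    `|dF x| <= expR (Phi v - Phi u) * `|dF x'|.
  move=> /andP[ux xv] /andP[ux' xv'] xE xE'.
  have d0 y : y \notin E' -> 0 < `|dF y|.
    by move=> /bound/andP[+ _]; apply: lt_le_trans; rewrite invr_gt0.
  rewrite -[`|dF x|]lnK ?posrE ?d0 // -[X in _ * X]lnK ?posrE ?d0 // -expRD ler_expR.
  rewrite -lerBlDr.
  move: xE xE'; rewrite !inE !negb_or => /and3P[xa xb xE] /and3P[xa' xb' xE'].
  have P1 := Phi_nd (ltW ux); have P2 := Phi_nd (ltW xv).
  have P1' := Phi_nd (ltW ux'); have P2' := Phi_nd (ltW xv').
  have [xx|xx|->] := ltrgtP x x'; last by rewrite subrr subr_ge0 (le_trans P1').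
    have := ln_var xx xE xE' xa xb xa' xb'; rewrite distrC => /(le_trans (ler_norm _)) /le_trans.
    by apply; apply: lerB.
  have := ln_var xx xE' xE xa' xb' xa xb => /(le_trans (ler_norm _)) /le_trans.
  by apply; apply: lerB.
split.
- exact: ab.
- exact: C1.
- exact: F_cont.
- move=> c x c0 /andP[ax xb].
  have [xa|xa] := leP x a.
    have /andP[fa1 fa2] := fab (introT andP (conj (lexx a) (ltW ab))).
    have : `|sa * (x - a)| <= c by rewrite normrM sa1 mul1r ler_norml; between.
    by rewrite F_left // ler_norml => /andP[? ?]; between.
  have [bx|bx] := leP b x.
    have /andP[fb1 fb2] := fab (introT andP (conj (ltW ab) (lexx b))).
    have : `|sb * (x - b)| <= c by rewrite normrM sb1 mul1r ler_norml; between.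
    by rewrite F_right // ler_norml => /andP[? ?]; between.
  have xab : a <= x <= b by rewrite !ltW.
  rewrite extensionE //; have /andP[? ?] := fab xab; between.
- move=> x y xa ya; rewrite !F_left // opprD addrACA subrr add0r -mulrBr normrM sa1 mul1r.
  by congr `|_|; ring.
- move=> x y xa ya; rewrite !F_right // opprD addrACA subrr add0r -mulrBr normrM sb1 mul1r.
  by congr `|_|; ring.
- exact: mono.
- move=> u v y z fr uy; rewrite le_eqVlt => /predU1P[<-|yz] zv.
    by rewrite !subrr !mulr0 normr0 lexx.
  have zy : 0 <= z - y by rewrite subr_ge0 ltW.
  have [x [_ /bound/andP[_ h1] h2]] := mvt_upper yz.
  have [x' [_ /bound/andP[h1' _] h2']] := mvt_lower fr uy yz zv.
  apply/andP; split.
    by apply: le_trans h2'; rewrite ler_wpM2r.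
  by apply: le_trans h2 _; rewrite ler_wpM2r.
- move=> u v y z y' z' fr uy; rewrite le_eqVlt => /predU1P[<-|yz] zv uy'.
    by rewrite !subrr normr0 mul0r mulr0.
  rewrite le_eqVlt => /predU1P[<-|yz'] zv'; first by rewrite !subrr mulr0 normr0 mulr0 mul0r.
  have zy : 0 <= z - y by rewrite subr_ge0 ltW.
  have zy' : 0 <= z' - y' by rewrite subr_ge0 ltW.
  have [x [/andP[yx xz] xE h]] := mvt_upper yz.
  have [x' [/andP[yx' xz'] xE' h']] := mvt_lower fr uy' yz' zv'.
  have := ratio u v x x' _ _ xE xE'.
  rewrite (le_lt_trans uy yx) (lt_le_trans xz zv) (le_lt_trans uy' yx') (lt_le_trans xz' zv').
  move=> /(_ isT isT) rat.
  apply: (@le_trans _ _ (`|dF x| * (z - y) * (z' - y'))); first by rewrite ler_wpM2r.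
  apply: (@le_trans _ _ (expR (Phi v - Phi u) * `|dF x'| * (z - y) * (z' - y'))).
    by rewrite !ler_wpM2r.
  rewrite mulrAC ler_wpM2r // -mulrA ler_wpM2l // expR_ge0 //.
- exact: Phi_nd.
- exact: Phi_bnd.
Qed.

End Extend.

(** * Derivatives and attracting periodic orbits *)

Section Transfer.
Context {R : realType} (a b : R) (ab : a < b) (f F : R -> R) (T : set R) (C V : R) (Phi : R -> R).
Context (DM : denjoy_map a b F T C V Phi) (Ff : forall x, a <= x <= b -> F x = f x).
Implicit Types (x y z p q K e : R) (n : nat).

Lemma iter_extension n x : a <= x <= b -> iter n F x = iter n f x.
Proof.
move=> xab; elim: n => // n IH; rewrite !iterS -IH Ff //; exact: iter_itv DM _ _ _.
Qed.

Lemma derive1_norm_ge (G : R -> R) y K r : derivable G y 1 -> 0 < r ->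
  (forall h, 0 < h < r -> K * h <= `|G (y + h) - G y|) -> K <= `|derive1 G y|.
Proof.
move=> /derivableP; rewrite -derive1E => D r0 H; apply/ler_addgt0Pr => e e0.
have [r' r'0 Hr'] := derive_quotient D e0.
pose h := Num.min r r' / 2.
have m0 : 0 < Num.min r r' by rewrite lt_min r0.
have [m1 m2] : Num.min r r' <= r /\ Num.min r r' <= r' by rewrite !ge_min !lexx orbT.
have [h0 hr hr'] : [/\ 0 < h, h < r & h < r'] by rewrite /h; split; lra.
have := H h (introT andP (conj h0 hr)); rewrite -ler_pdivlMr // => KQ.
have := Hr' h (ltac:(by rewrite gt_eqF)) (ltac:(by rewrite gtr0_norm)) => /ltW.
have QE : `|G (y + h) - G y| / h = `|(G (y + h) - G y) / h|.
  by rewrite normrM normfV (gtr0_norm h0).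
rewrite QE in KQ; move: ((G _ - G _) / h) KQ => Q KQ Qd.
rewrite -[Q](subrK (derive1 G y)) in KQ; apply: (le_trans KQ); rewrite addrC.
by apply: le_trans (ler_normD _ _) _; rewrite lerD2l.
Qed.

Lemma expands_liminf n x K : a <= x <= b -> expands a b F n x K ->
  (K%:E <= liminf_absD a b f n x)%E.
Proof.
move=> xab [r r0 H]; rewrite /liminf_absD limf_einfE.
pose S := [set y | [/\ `|y - x| < r, a < y < b & derivable (iter n f) y 1]].
apply: (@le_trans _ _ (ereal_inf [set (`|derive1 (iter n f) y|)%:E | y in S])); last first.
  apply: ereal_sup_ubound; exists S => //.
  have : \forall y \near x, `|y - x| < r by apply/near_distP; exists r.
  move=> xr; rewrite /within /=; near=> y => -[yab dy]; split=> //.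
  near: y; exact: cvg_within xr.
apply: le_ereal_inf_tmp => _ [y [yr yab dy] <-]; rewrite lee_fin.
have /andP[ay yb] := yab; have yab' : a <= y <= b by rewrite !ltW.
pose d := Num.min (b - y) (r - `|y - x|).
have d0 : 0 < d by rewrite lt_min !subr_gt0 yb.
apply: (derive1_norm_ge dy d0) => h /andP[h0]; rewrite lt_min => /andP[hb hr].
have hab : a <= y + h <= b by between.
have hyr : `|y + h - x| < r.
  rewrite addrAC; apply: le_lt_trans (ler_normD _ _) _.
  by rewrite (gtr0_norm h0); lra.
have := H (y + h) y hab yab' hyr yr; rewrite !iter_extension //.
by have -> : y + h - y = h; [ring|rewrite gtr0_norm].
Unshelve. all: by end_near.
Qed.


Context (E : seq R) (Ed : forall x, a < x < b -> x \notin E -> derivable f x 1).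
Context (r : R) (r0 : 0 < r).

Let C0 : 0 < C := lt_le_trans ltr01 (dm_C DM).

Section Near.
Context (p : R) (n : nat) (pab : a <= p <= b).
Context (fr : forall i, (i < n)%N -> turn_free T (iter i F p - r) (iter i F p + r)).

Lemma iter_order_near : exists2 d, 0 < d & forall i y z, (i <= n)%N -> `|y - p| < d -> `|z - p| < d ->
  C ^- i * `|y - z| <= `|iter i F y - iter i F z| /\
  (forall w, y <= w -> w <= z ->
    Num.min (iter i F y) (iter i F z) <= iter i F w <= Num.max (iter i F y) (iter i F z)).
Proof.
elim: n fr => [|m IH] fr'.
  exists 1 => // i y z; rewrite leqn0 => /eqP-> _ _ /=; split; first by rewrite expr0 invr1 mul1r.
  move=> w yw wz; have yz := le_trans yw wz.
  by rewrite (min_idPl yz) (max_idPr yz) yw.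
have [d d0 Hd] := IH (fun i im => fr' i (ltnW im)).
have [d' d'0 Hd'] := iter_near DM m p r0.
exists (Num.min d d'); first by rewrite lt_min d0.
move=> i y z; rewrite leq_eqVlt !lt_min => /predU1P[->|im] /andP[yd yd'] /andP[zd zd']; last exact: Hd.
have [h1 h2] := Hd m y z (leqnn _) yd zd.
have frm := fr' m (ltnSn m).
have := Hd' y yd'; have := Hd' z zd'; rewrite !ltr_distl => /andP[z1 z2] /andP[y1 y2].
have fr2 : turn_free T (Num.min (iter m F y) (iter m F z)) (Num.max (iter m F y) (iter m F z)).
  apply: (turn_free_sub frm); first by rewrite le_min !ltW.
  by rewrite ge_max !ltW.
split.
  have /andP[+ _] := lipN DM frm (y := iter m F z) (z := iter m F y)
    (ltac:(by rewrite !ltW)) (ltac:(by rewrite !ltW)).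
  rewrite !iterS; apply: le_trans; rewrite exprS invfM -mulrA.
  by rewrite ler_pM2l ?invr_gt0.
by move=> w yw wz; rewrite !iterS; apply: (F_btw DM fr2); exact: h2.
Qed.

(** The iterates separate [y] from [p] near [p], so the orbit of [y] avoids the finite set
    [a :: b :: E] for [n] steps even if that of [p] meets it; the chain rule then applies. *)
Lemma punctured_derivable : exists2 d, 0 < d & forall y, a < y < b -> y != p -> `|y - p| < d ->
  derivable (iter n f) y 1.
Proof.
have [d d0 Hd] := iter_order_near.
have : exists2 d', 0 < d' & forall i y, (i < n)%N -> a <= y <= b -> y != p -> `|y - p| < d' ->
    a < iter i F y < b /\ iter i F y \notin E.
  have : forall m, (m <= n)%N -> exists2 d', 0 < d' & forall i y, (i < m)%N -> a <= y <= b -> y != p ->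
      `|y - p| < d' -> a < iter i F y < b /\ iter i F y \notin E.
    elim=> [|m IH] mn; first by exists 1.
    have [d1 d10 H1] := IH (ltnW mn).
    have [e e0 He] := finite_isolated (iter m F p) (finite_seq (a :: b :: E)).
    have [d2 d20 H2] := iter_near DM m p e0.
    exists (Num.min d (Num.min d1 d2)); first by rewrite !lt_min d0 d10.
    move=> i y; rewrite ltnS leq_eqVlt !lt_min => /predU1P[->|im] yab yp /and3P[yd y1 y2]; last exact: H1.
    have ne : iter m F y != iter m F p.
      have [+ _] := Hd m y p (ltnW mn) yd (ltac:(by rewrite subrr normr0)).
      rewrite -subr_eq0 -normr_gt0; apply: lt_le_trans.
      by rewrite mulr_gt0 ?invr_gt0 ?exprn_gt0 // normr_gt0 subr_eq0.
    have nE e' : e' \in a :: b :: E -> iter m F y != e'.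
      move=> eE; apply/negP => /eqP ye; have := He e' eE; rewrite -ye ne => /(_ isT).
      by rewrite leNgt H2.
    have /andP[h1 h2] := iter_itv DM m yab.
    rewrite !lt_def h1 h2 !andbT nE ?mem_head // eq_sym nE ?inE ?eqxx ?orbT //; split=> //.
    by apply/negP => yE; have := nE (iter m F y); rewrite !inE yE !orbT eqxx => /(_ isT).
  by move=> /(_ n (leqnn n)).
move=> [d' d'0 H]; exists d' => // y yab yp yd.
have yab' : a <= y <= b by case/andP: yab => ? ?; rewrite !ltW.
have : forall m, (m <= n)%N -> derivable (iter m f) y 1.
  elim=> [|m IH] mn; first exact: derivable_id.
  have [h1 h2] := H m y mn yab' yp yd.
  rewrite iter_extension // in h1 h2.
  have D1 := derivableP (IH (ltnW mn)); have D2 := derivableP (Ed h1 h2).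
  exact: (@ex_derive _ _ _ _ _ _ _ (is_derive1_comp D2 D1)).
exact.
Qed.

Lemma one_sided_mvt : exists2 d, 0 < d & forall y z, a <= y -> y < z -> z <= b ->
  `|y - p| < d -> `|z - p| < d -> (z <= p) || (p <= y) ->
  exists2 x, y < x < z & `|iter n F z - iter n F y| = `|derive1 (iter n f) x| * (z - y).
Proof.
have [d d0 Hd] := punctured_derivable; exists d => // y z ay yz zb yd zd side.
have [x|  |x] := @MVT _ (iter n f) (derive1 (iter n f)) y z yz.
- rewrite in_itv /= => /andP[yx xz]; rewrite derive1E; apply: derivableP; apply: Hd.
  + by rewrite (le_lt_trans ay) // (lt_le_trans xz).
  + by case/orP: side => h; [rewrite lt_eqF // (lt_le_trans xz)|rewrite gt_eqF // (le_lt_trans h)].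
  + by move: yd zd; rewrite !ltr_distl => /andP[? ?] /andP[? ?]; between.
- apply: (@subspace_eq_continuous _ _ _ (iter n F)).
    move=> w; rewrite inE /= in_itv /= => /andP[yw wz]; apply: iter_extension.
    by rewrite (le_trans ay) // (le_trans wz).
  exact/continuous_subspaceT/(iter_cont DM).
- rewrite in_itv /= => yxz E1; exists x => //.
  rewrite !iter_extension ?E1 ?normrM ?[`|z - y|]gtr0_norm ?subr_gt0 //.
    by rewrite ay (le_trans (ltW yz)).
  by rewrite zb (le_trans ay) // ltW.
Qed.

Lemma punctured_contracts L e : 0 < e ->
  (forall y, a < y < b -> y != p -> `|y - p| < e -> `|derive1 (iter n f) y| <= L) ->
  exists2 d, 0 < d & forall y, a <= y <= b -> `|y - p| < d ->
    `|iter n F y - iter n F p| <= L * `|y - p|.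
Proof.
move=> e0 H; have [d d0 Hd] := one_sided_mvt; exists (Num.min d e); first by rewrite lt_min d0.
have /andP[ap pb] := pab; have pd : `|p - p| < d by rewrite subrr normr0.
move=> y /andP[ay yb]; rewrite lt_min => /andP[yd]; rewrite ltr_distl => /andP[e1 e2].
case: (ltrgtP y p) => [yp|py|->]; last by rewrite !subrr !normr0 mulr0.
  have [x /andP[yx xp]] := Hd y p ay yp pb yd pd (ltac:(by rewrite lexx)).
  move=> FE; rewrite distrC FE.
  rewrite ler_wpM2r ?subr_ge0 ?(ltW yp) //; apply: H.
  - by rewrite (le_lt_trans ay) // (lt_le_trans xp).
  - by rewrite lt_eqF.
  - by rewrite ltr_distl; between.
have [x /andP[px xy]] := Hd p y ap py yb pd yd (ltac:(by rewrite lexx orbT)).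
move=> ->.
rewrite ler_wpM2r ?subr_ge0 ?(ltW py) //; apply: H.
- by rewrite (le_lt_trans ap) // (lt_le_trans xy).
- by rewrite gt_eqF.
- by rewrite ltr_distl; between.
Qed.

Lemma punctured_expands K e : 0 <= K -> 0 < e ->
  (forall y, a < y < b -> y != p -> `|y - p| < e -> K <= `|derive1 (iter n f) y|) ->
  expands a b F n p K.
Proof.
move=> K0 e0 H; have [d d0 Hd] := one_sided_mvt; have [d' d'0 Hd'] := iter_order_near.
exists (Num.min d (Num.min d' e)); first by rewrite !lt_min d0 d'0.
have /andP[ap pb] := pab; have pd : `|p - p| < d by rewrite subrr normr0.
have side y z : a <= y -> y < z -> z <= b -> `|y - p| < d -> `|z - p| < d ->
    `|y - p| < e -> `|z - p| < e -> (z <= p) || (p <= y) ->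
    K * (z - y) <= `|iter n F z - iter n F y|.
  move=> ay yz zb yd zd ye ze s; have [x /andP[yx xz] ->] := Hd y z ay yz zb yd zd s.
  rewrite ler_wpM2r ?subr_ge0 ?(ltW yz) //; apply: H.
  - by rewrite (le_lt_trans ay) // (lt_le_trans xz).
  - by case/orP: s => h; [rewrite lt_eqF // (lt_le_trans xz)|rewrite gt_eqF // (le_lt_trans h)].
  - by move: ye ze; rewrite !ltr_distl => /andP[? ?] /andP[? ?]; between.
move=> y z yab zab yd zd; wlog yz : y z yab zab yd zd / y < z.
  move=> W; have [->|] := eqVneq y z; first by rewrite !subrr !normr0 mulr0.
  rewrite neq_lt => /orP[yz|zy]; first exact: W.
  by rewrite distrC (distrC (iter n F y)); exact: W.
rewrite distrC (distrC (iter n F y)) (gtr0_norm (_ : 0 < z - y)) ?subr_gt0 //.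
move: yd zd; rewrite !lt_min => /and3P[yd yd' ye] /and3P[zd zd' ze].
have /andP[ay yb] := yab; have /andP[az zb] := zab.
(* The derivative may fail to exist at [p], so the mean value theorem is used on each side.
   Monotonicity puts the image of [p] between the other two, and the estimates add up. *)
have [zp|pz] := leP z p; first by apply: side; rewrite ?zp.
have [py|yp] := leP p y; first by apply: side; rewrite ?py ?orbT.
have [_ /(_ p (ltW yp) (ltW pz))] := Hd' n y z (leqnn n) yd' zd'.
have pe : `|p - p| < e by rewrite subrr normr0.
have h1 := side y p ay yp pb yd pd ye pe (ltac:(by rewrite lexx)).
have h2 := side p z ap pz zb pd zd pe ze (ltac:(by rewrite lexx orbT)).
have -> : K * (z - y) = K * (p - y) + K * (z - p) by ring.
move: h1 h2; move: (K * _) (K * _) (iter n F y) (iter n F z) (iter n F p) => k1 k2 u w v h1 h2.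
case/orP: (le_total u w) => uw; rewrite ?(min_idPl uw) ?(max_idPr uw) ?(min_idPr uw) ?(max_idPl uw);
  move=> /andP[m1 m2]; apply: (le_trans (lerD h1 h2)).
  by rewrite !ger0_norm ?subr_ge0 //; lra.
by rewrite !ler0_norm ?subr_le0 //; lra.
Qed.

End Near.

Lemma hyperbolic_punctured n p : hyperbolic a b f n p ->
  (exists L e, [/\ 0 <= L < 1, 0 < e &
     forall y, a < y < b -> y != p -> `|y - p| < e -> `|derive1 (iter n f) y| <= L]) \/
  (exists K e, [/\ 1 < K, 0 < e &
     forall y, a < y < b -> y != p -> `|y - p| < e -> K <= `|derive1 (iter n f) y|]).
Proof.
have left_near (P : R -> Prop) : (\forall y \near p^'-, P y) ->
    exists2 e, 0 < e & forall y, y < p -> `|y - p| < e -> P y.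
  rewrite near_withinE => /near_distP[e e0 H]; exists e => // y yp ye; exact: H.
have right_near (P : R -> Prop) : (\forall y \near p^'+, P y) ->
    exists2 e, 0 < e & forall y, p < y -> `|y - p| < e -> P y.
  rewrite near_withinE => /near_distP[e e0 H]; exists e => // y yp ye; exact: H.
case=> -[hl hr]; [left|right].
- have [L1 [e1 [L10 e10 H1]]] : exists L e, [/\ 0 <= L < 1, 0 < e & forall y, a < y -> y < p ->
      `|y - p| < e -> `|derive1 (iter n f) y| <= L].
    have [ap|pa] := ltP a p; last first.
      by exists 0, 1; split=> // [|y ay yp]; [lra|have := lt_trans ay yp; rewrite ltNge pa].
    have [l cl l1] := hl ap; pose L := Num.max 0 ((l + 1) / 2).
    have lL : l < L by rewrite lt_max; apply/orP; right; lra.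
    have [e e0 He] := left_near _ (cvgr_lt _ cl _ lL); exists L, e; split=> //.
      by rewrite le_max lexx gt_max; lra.
    by move=> y ay yp ye; apply: ltW; exact: He.
  have [L2 [e2 [L20 e20 H2]]] : exists L e, [/\ 0 <= L < 1, 0 < e & forall y, p < y -> y < b ->
      `|y - p| < e -> `|derive1 (iter n f) y| <= L].
    have [pb|bp] := ltP p b; last first.
      by exists 0, 1; split=> // [|y py yb]; [lra|have := lt_trans py yb; rewrite ltNge bp].
    have [l cl l1] := hr pb; pose L := Num.max 0 ((l + 1) / 2).
    have lL : l < L by rewrite lt_max; apply/orP; right; lra.
    have [e e0 He] := right_near _ (cvgr_lt _ cl _ lL); exists L, e; split=> //.
      by rewrite le_max lexx gt_max; lra.
    by move=> y ay yp ye; apply: ltW; exact: He.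
  exists (Num.max L1 L2), (Num.min e1 e2); split.
  + by move/andP: L10 => [? ?]; move/andP: L20 => [? ?]; rewrite le_max gt_max; apply/and3P; split=> //; apply/orP; left.
  + by rewrite lt_min e10.
  + move=> y /andP[ay yb]; rewrite lt_min neq_lt => /orP[yp|py] /andP[y1 y2]; rewrite le_max.
      by rewrite H1.
    by rewrite H2 ?orbT.
- have [K1 [e1 [K10 e10 H1]]] : exists K e, [/\ 1 < K, 0 < e & forall y, a < y -> y < p ->
      `|y - p| < e -> K <= `|derive1 (iter n f) y|].
    have [ap|pa] := ltP a p; last first.
      by exists 2, 1; split=> // [|y ay yp]; [lra|have := lt_trans ay yp; rewrite ltNge pa].
    have [l cl l1] := hl ap; have Kl : (l + 1) / 2 < l by lra.
    have [e e0 He] := left_near _ (cvgr_gt _ cl _ Kl); exists ((l + 1) / 2), e; split=> //; first by lra.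
    by move=> y ay yp ye; apply: ltW; exact: He.
  have [K2 [e2 [K20 e20 H2]]] : exists K e, [/\ 1 < K, 0 < e & forall y, p < y -> y < b ->
      `|y - p| < e -> K <= `|derive1 (iter n f) y|].
    have [pb|bp] := ltP p b; last first.
      by exists 2, 1; split=> // [|y py yb]; [lra|have := lt_trans py yb; rewrite ltNge bp].
    have [l cl l1] := hr pb; have Kl : (l + 1) / 2 < l by lra.
    have [e e0 He] := right_near _ (cvgr_gt _ cl _ Kl); exists ((l + 1) / 2), e; split=> //; first by lra.
    by move=> y ay yp ye; apply: ltW; exact: He.
  exists (Num.min K1 K2), (Num.min e1 e2); split.
  + by rewrite lt_min K10.
  + by rewrite lt_min e10.
  + move=> y /andP[ay yb]; rewrite lt_min neq_lt => /orP[yp|py] /andP[y1 y2]; rewrite ge_min.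
      by rewrite H1.
    by rewrite H2 ?orbT.
Qed.


Lemma periodic_point_mod n p i : periodic_point a b f n p -> iter i F p = iter (i %% n) F p.
Proof.
move=> [n0 pab per _]; rewrite {1}(divn_eq i n) addnC iterD; congr (iter _ F _).
by elim: (i %/ n)%N => // q IH; rewrite mulSn iterD IH iter_extension.
Qed.

Lemma attracting_basin n p L d : periodic_point a b f n p -> 0 <= L < 1 -> 0 < d ->
  (forall y, a <= y <= b -> `|y - p| < d -> `|iter n F y - iter n F p| <= L * `|y - p|) ->
  forall y, a <= y <= b -> `|y - p| < d -> immediate_basins a b f y.
Proof.
move=> /[dup] pp [n0 pab per _] /andP[L0 L1] d0 H.
have perF : iter n F p = p by rewrite iter_extension.
rewrite perF in H.
have contract y m : a <= y <= b -> `|y - p| < d ->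
    `|iter (m * n) F y - p| <= L ^+ m * `|y - p|.
  move=> yab yd; elim: m => [|m IH]; first by rewrite mul1r.
  rewrite mulSn iterD exprS -mulrA.
  apply: le_trans (H _ (iter_itv DM _ yab) _) _; last by rewrite ler_wpM2l.
  by apply: le_lt_trans IH _; apply: le_lt_trans yd; rewrite ler_piMl // exprn_ile1 // ltW.
have in_basin y : a <= y <= b -> `|y - p| < d -> basin a b f (forward_orbit f p) y.
  move=> yab yd; split=> // N NO.
  have [e e0 He] : exists2 e, 0 < e & forall i z, (i < n)%N -> `|z - p| < e -> N (iter i F z).
    elim: n {n0 per pp perF H contract} => [|m [e e0 IH]]; first by exists 1.
    have : nbhs (iter m F p) N by apply: NO; exists m => //; rewrite iter_extension.
    move=> /near_distP[e1 e10 H1]; have [e2 e20 H2] := iter_near DM m p e10.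
    exists (Num.min e e2); first by rewrite lt_min e0.
    move=> i z; rewrite ltnS leq_eqVlt lt_min => /predU1P[->|im] /andP[z1 z2]; last exact: IH.
    by apply: H1; exact: H2.
  have e1 : 0 < e / d by rewrite divr_gt0.
  have L1' : `|L| < 1 by rewrite ger0_norm.
  have [M _ HM] : \forall m \near \oo, L ^+ m < e / d.
    have := cvg_expr L1' => /cvgrPdist_lt/(_ _ e1); apply: filterS => m.
    by rewrite sub0r normrN ger0_norm // exprn_ge0.
  exists (M * n)%N => // k /= Mk; rewrite -iter_extension // (divn_eq k n) addnC iterD.
  apply: He; first by rewrite ltn_mod.
  apply: le_lt_trans (contract y _ yab yd) _.
  have : L ^+ (k %/ n) < e / d by apply: HM; rewrite /= leq_divRL.
  rewrite ltr_pdivlMr //; apply: le_lt_trans; rewrite ler_wpM2l ?exprn_ge0 //; exact: ltW.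
have att : periodic_attractor a b f (forward_orbit f p).
  split; first by exists n, p.
  (* If [p] is an endpoint of [[a, b]], an interior point of the basin has to be taken beside it. *)
  have [w /andP[aw wb] wd] : exists2 w, a < w < b & `|w - p| < d.
    have /andP[ap pb] := pab; have [pb'|bp] := ltP p b.
      pose m := Num.min d (b - p); have m0 : 0 < m by rewrite lt_min d0 subr_gt0.
      have [m1 m2] : m <= d /\ m <= b - p by rewrite /m !ge_min !lexx orbT.
      exists (p + m / 2); first by between.
      by rewrite ltr_distl; between.
    pose m := Num.min d (p - a); have m0 : 0 < m.
      by rewrite lt_min d0 subr_gt0; exact: lt_le_trans bp.
    have [m1 m2] : m <= d /\ m <= p - a by rewrite /m !ge_min !lexx orbT.
    exists (p - m / 2); first by between.
    by rewrite ltr_distl; between.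
  exists w; apply/near_distP; exists (Num.min (d - `|w - p|) (Num.min (w - a) (b - w))).
    by rewrite !lt_min !subr_gt0 wd aw.
  move=> y; rewrite !lt_min => /andP[yd]; rewrite !ltr_distl => /andP[/andP[? ?] /andP[? ?]].
  apply: in_basin; first by between.
  by rewrite -(subrK w y) -addrA; apply: le_lt_trans (ler_normD _ _) _; lra.
move=> y yab yd; exists (forward_orbit f p) => //; exists p; first by exists 0%N.
apply: (@connected_component_max _ _ [set z | a <= z <= b /\ `|z - p| < d]) => //=.
- by rewrite subrr normr0.
- by move=> z [zab zd]; exact: in_basin.
- apply/connected_intervalP => u v /= [/andP[au ub]] + [/andP[av vb]].
  rewrite !ltr_distl => /andP[? ?] /andP[? ?] w /andP[uw wv].
  by rewrite ltr_distl; split; between.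
Qed.

Lemma minimal_period k p : (0 < k)%N -> a <= p <= b -> iter k f p = p ->
  exists n m, [/\ periodic_point a b f n p, (0 < m)%N & k = (n * m)%N].
Proof.
move=> k0 pab per.
have ex : exists k, (0 < k)%N && (iter k f p == p) by exists k; rewrite k0 per eqxx.
have [n /andP[n0 /eqP pn] minn] := ex_minnP ex.
have pp : periodic_point a b f n p.
  split=> // j /andP[j0 jn] pj.
  by have := minn j; rewrite j0 pj eqxx => /(_ isT); rewrite leqNgt jn.
have kn : (k %% n = 0)%N.
  apply/eqP; rewrite -leqn0 leqNgt; apply/negP => k0'.
  have := minn (k %% n)%N; rewrite k0' -iter_extension // -(periodic_point_mod k pp) iter_extension //.
  by rewrite per eqxx => /(_ isT); rewrite leqNgt ltn_mod n0.
exists n, (k %/ n)%N; split=> //; last by rewrite mulnC; have := divn_eq k n; rewrite kn addn0.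
by rewrite divn_gt0 //; apply: minn; rewrite k0 per eqxx.
Qed.

Lemma turn_free_outside (U : set R) : finite_set T -> set_nbhs T U ->
  exists2 e, 0 < e & forall x, ~ U x -> turn_free T (x - e) (x + e).
Proof.
move=> fT TU; have [s sT] := proj1 (finite_seqP _) fT.
have [e e0 He] : exists2 e, 0 < e & forall t x, t \in s -> ~ U x -> e <= `|x - t|.
  have : forall t, t \in s -> T t by move=> t ts; rewrite sT.
  elim: s {sT} => [|t s IH] Ts; first by exists 1.
  have [e e0 He] := IH (fun t' h => Ts t' (ltac:(by rewrite inE h orbT))).
  have /near_distP[e' e'0 He'] := TU t (Ts t (mem_head _ _)).
  exists (Num.min e e'); first by rewrite lt_min e0.
  move=> t' x; rewrite inE ge_min => /predU1P[->|ts] Ux; last by rewrite He.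
  by apply/orP; right; rewrite leNgt; apply/negP => /He'.
exists e => // x Ux t; rewrite sT /= => ts /andP[h1 h2].
have := He t x ts Ux; rewrite leNgt => /negP; apply.
by rewrite ltr_distl; between.
Qed.

End Transfer.

(** * The theorem *)

(** [K n] is the largest [k <= n] whose threshold [N k] has been reached; an empty maximum is 0,
    which [P n 0] covers. *)
Lemma divergent_bounds {R : realType} (P : nat -> R -> Prop) : (forall n, P n 0) ->
  (forall K, exists N, forall n, (N <= n)%N -> P n K) ->
  exists K : nat -> R, K n @[n --> \oo] --> +oo /\ forall n, P n (K n).
Proof.
move=> P0 H; have /choice[N HN] : forall k : nat, exists N, forall n, (N <= n)%N -> P n k%:R.
  by move=> k; exact: H.
exists (fun n => (\max_(k < n.+1 | (N k <= n)%N) k)%:R); split; last first.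
  move=> n; apply: (big_ind (fun k => P n k%:R)) => // [k l Pk Pl|k].
    by rewrite /maxn; case: ifP.
  exact: HN.
apply/cvgryPge => A; exists (maxn (N (Num.bound A)) (Num.bound A)) => // n /=.
rewrite geq_max => /andP[Nn An]; apply: (@le_trans _ _ (Num.bound A)%:R).
  have [A0|A0] := leP 0 A; first exact/ltW/archi_boundP.
  by apply: le_trans (ltW A0) _; rewrite ler0n.
rewrite ler_nat.
exact: (@leq_bigmax_cond _ (fun k : 'I_n.+1 => (N k <= n)%N) (fun k => nat_of_ord k)
  (Ordinal (leq_ltn_trans An (ltnSn n)))).
Qed.

(* A neighbourhood U of the turning points is arbitrary in the first part.  In
   the second part it is a relatively open one: the claim fails for the union of
   a neighbourhood of the turning point and a neutral, weakly repelling fixed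
   point, since orbits just outside such a U spend long times near that point. *)
Theorem theorem3p1 (R : realType) (a b : R) (hab : a < b) (f : R -> R)
    (hf : class_C a b f) (U : set R) (hUI : U `<=` [set` `[a, b]])
    (hU : set_nbhs (turning_points a b f) U) :
  (exists K : nat -> R,
     K n @[n --> \oo] --> +oo /\
     forall n p, periodic_point a b f n p ->
       forward_orbit f p `<=` [set` `[a, b]] `\` U ->
       ((K n)%:E <= liminf_absD a b f n p)%E) /\
  (open (U : set (subspace [set` `[a, b]])) ->
   (forall n p, periodic_point a b f n p ->
      forward_orbit f p `<=` [set` `[a, b]] `\` U -> hyperbolic a b f n p) ->
   exists C lambda : R,
     [/\ 0 < C, 1 < lambda &
         forall n x, Gamma a b f n (U `|` immediate_basins a b f) x ->
           ((C * lambda ^+ n)%:E <= liminf_absD a b f n x)%E]).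
Proof.
have [cf fab [E0 /finite_seqP[E ->] [dE [C C1 bE]]] bv] := hf.
have Ed x : a < x < b -> x \notin E -> derivable f x 1.
  by move=> xab /negP xE; case: (dE x xab xE).
have Eb x : a < x < b -> x \notin E -> C^-1 <= `|derive1 f x| <= C.
  by move=> xab /negP xE; exact: bE.
have := extension_denjoy hab cf fab Ed C1 Eb bv.
set V := (X in denjoy_map _ _ _ _ _ X _); set Phi := (X in denjoy_map _ _ _ _ _ _ X) => DM.
have Ff : forall x, a <= x <= b -> extension a b f x = f x := extensionE f.
move: (extension a b f) V Phi DM Ff => F V Phi DM Ff.
have itE := iter_extension DM Ff.
have [e e0 He] := turn_free_outside (turning_points_finite Ed C1 Eb) hU.
pose r := Num.min e 1 / 2.
have m0 : 0 < Num.min e 1 by rewrite lt_min e0 ltr01.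
have [me m1] : Num.min e 1 <= e /\ Num.min e 1 <= 1 by rewrite !ge_min !lexx orbT.
have [r0 r1 rr] : [/\ 0 < r, r <= 1 & r + r <= e] by rewrite /r; split; lra.
have fr2 x : ~ U x -> turn_free (turning_points a b f) (x - (r + r)) (x + (r + r)).
  by move=> /He h; apply: (turn_free_sub h); lra.
have fr1 x : ~ U x -> turn_free (turning_points a b f) (x - r) (x + r).
  by move=> /He h; apply: (turn_free_sub h); lra.
have orb p i : a <= p <= b -> forward_orbit f p `<=` [set` `[a, b]] `\` U -> ~ U (iter i F p).
  by move=> pab pO; rewrite itE //; have [] := pO (iter i f p) (ex_intro2 _ _ i I erefl).
split.
  have [||K [Koo HK]] := @divergent_bounds R (fun n K => forall p, periodic_point a b f n p ->
      forward_orbit f p `<=` [set` `[a, b]] `\` U -> (K%:E <= liminf_absD a b f n p)%E).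
  - move=> n p [_ pab _ _] _; apply: (expands_liminf DM Ff pab); exact: expands_nonpos.
  - move=> K; have [N HN] := periodic_expands DM r0 r1 K; exists N => n Nn p [n0 pab per pmin] pO.
    apply: (expands_liminf DM Ff pab); apply: HN => //.
    + by rewrite itE.
    + by move=> i _; apply/fr1/orb.
    + move=> i j ij jn; rewrite !itE //; apply/eqP => fE.
      have jn' : (n - j + j = n)%N by rewrite subnK // ltnW.
      apply: (pmin (n - j + i)%N).
        by rewrite addn_gt0 subn_gt0 jn /= -{2}jn' ltn_add2l.
      by rewrite iterD fE -iterD jn'.
  by exists K; split=> // n p pp pO; exact: HK.
move=> oU hyp.
pose Y := [set x | [/\ a <= x <= b, ~ U x & ~ immediate_basins a b f x]].
have Yab x : Y x -> a <= x <= b by case.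
have Yfree x : Y x -> turn_free (turning_points a b f) (x - (r + r)) (x + (r + r)).
  by case=> _ /fr2.
(* The complement of a relatively open set is closed in the interval, so points of the closure of
   [Y] stay outside [U]. *)
have outU p : a <= p <= b -> (forall d, 0 < d -> exists2 y, Y y & `|y - p| < d) -> ~ U p.
  move=> pab pY Up; have /open_subspaceP[W oW WU] := oU.
  have pI : [set` `[a, b]] p by rewrite /= in_itv.
  have [Wp _] : (W `&` [set` `[a, b]]) p by rewrite WU.
  have /near_distP[d d0 Hd] := open_nbhs_nbhs (conj oW Wp).
  have [y [yab nU _] yp] := pY d d0; apply: nU.
  have [] : (U `&` [set` `[a, b]]) y; last by [].
  by rewrite -WU; split; [exact: Hd|rewrite /= in_itv].
have Yrep p k : (0 < k)%N -> a <= p <= b -> iter k F p = p ->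
    (forall i d, 0 < d -> exists2 y, Y y & `|y - iter i F p| < d) ->
    exists2 K, 1 < K & expands a b F k p K.
  move=> k0 pab per pY; rewrite itE // in per.
  have [n [m [pp m0' kE]]] := minimal_period DM Ff k0 pab per.
  have nU i : ~ U (iter i F p) by apply: outU; [exact: iter_itv DM _ _ _|exact: pY].
  have fri i : (i < n)%N -> turn_free (turning_points a b f) (iter i F p - r) (iter i F p + r).
    by move=> _; exact: fr1.
  have pO : forward_orbit f p `<=` [set` `[a, b]] `\` U.
    move=> _ [i _ <-]; rewrite -itE //; split; last exact: nU.
    by rewrite /= in_itv; exact: iter_itv DM _ _ _.
  (* In the attracting case a neighbourhood of [p] lies in an immediate basin, whereas [Y] avoids
     these basins and accumulates at [p]. *)
  have [[L [d [L01 d0 HL]]]|[K [d [K1 d0 HK]]]] := hyperbolic_punctured (hyp n p pp pO).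
    have [d' d'0 Hd'] := punctured_contracts DM Ff Ed r0 pab fri d0 HL.
    have [y [yab _ nB] yp] := pY 0%N d' d'0; case: nB.
    exact: (attracting_basin hab DM Ff pp L01 d'0 Hd').
  have K0 : 0 <= K by rewrite ltW // (lt_trans ltr01).
  have ex := punctured_expands DM Ff Ed r0 pab fri K0 d0 HK.
  have [_ _ pern _] := pp; rewrite -itE // in pern.
  (* The period [k] is [m] times the minimal one, and each turn contributes a factor [K]. *)
  exists (K ^+ m); first by rewrite exprn_egt1 // -lt0n.
  rewrite kE mulnC; elim: m {m0' kE} => [|m IH].
    by exists 1 => // y z _ _ _ _; rewrite mul0n expr0 mul1r.
  rewrite mulSn exprS; apply: (expands_comp DM); rewrite ?pern ?exprn_ge0 //.
have [c [lam [c0 lam1 H]]] := uniform_expansion DM r0 r1 Yab Yfree Yrep.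
exists c, lam; split=> // n x Gx.
have xab : a <= x <= b by have [+ _] := Gx 0%N (leq0n n); rewrite /= in_itv.
apply: (expands_liminf DM Ff xab); apply: H => i im; have [+ nUB] := Gx i im.
rewrite itE //= in_itv /= => iab; split=> // h; apply: nUB; [left|right]; exact: h.
Qed.
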